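(* Let $N\ge 1$, $q>N$ and $n>1$ be integers. Let $D_1,\dots,D_q$ be hypersurfaces of degree $n$ in $\mathbb{P}^N(\mathbb{C})$ in general position, defined by homogeneous polynomials $Q_1,\dots,Q_q$ of degree $n$ respectively, with $\sum_{j=1}^{q}Q_j\not\equiv0$, and let $D_{q+1}=\{z\in\mathbb{P}^N(\mathbb{C}):\sum_{j=1}^{q}Q_j(z)=0\}$ be the hypersurface of degree $n$ defined by $\sum_{j=1}^{q}Q_j$. Let $f,g:\mathbb{C}\to\mathbb{P}^N(\mathbb{C})$ be two algebraically nondegenerate holomorphic curves, and suppose that $n>2(q^2-1)$. If $f(z)=g(z)$ for all $z\in\bigcup_{j=1}^{q+1}\big(f^{-1}(D_j)\cup g^{-1}(D_j)\big)$, then $f\equiv g$.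
   Context: A holomorphic curve $f:\mathbb{C}\to\mathbb{P}^N(\mathbb{C})$ is algebraically nondegenerate if its image is not contained in any proper algebraic subset of $\mathbb{P}^N(\mathbb{C})$. The set $f^{-1}(D_j)$ is the set of $z\in\mathbb{C}$ with $f(z)\in\mathrm{supp}\,D_j$ (no multiplicities). Hypersurfaces $D_1,\dots,D_q$ ($q>N$) in $\mathbb{P}^N(\mathbb{C})$ are in general position if for any distinct $i_1,\dots,i_{N+1}\in\{1,\dots,q\}$ one has $\bigcap_{k=1}^{N+1}\mathrm{supp}\,D_{i_k}=\varnothing$. *)

(* Defs.v *)
(* MathComp / MathComp-Analysis, over an arbitrary [R : realType], with the
   complex numbers [R[i]] of mathcomp-real-closed.  The notations of [mpoly]
   are not imported: they clash with those of MathComp-Analysis. *)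
From HB Require Import structures.
From mathcomp Require Import all_boot all_order all_algebra.
From mathcomp Require Import all_classical all_reals all_analysis.
From mathcomp Require Import complex.
From mathcomp Require Import -(notations) mpoly.

Set Implicit Arguments.
Unset Strict Implicit.
Unset Printing Implicit Defensive.

Import Order.TTheory GRing.Theory Num.Theory numFieldNormedType.Exports.

Local Open Scope classical_set_scope.
Local Open Scope ring_scope.

(* The complex line with its normed (hence topological) structure over itself;
   the underlying type is [R[i]]. *)
Notation cplane R := ((complex (Real.sort R))^o).

(* Polynomials over the complex numbers in the [N + 1] homogeneous
   coordinates of P^N(C). *)
Notation hcpoly R N := (mpoly N.+1 (complex (Real.sort R))).

Section ProjectiveSpace.
Variables (R : realType) (N : nat).

(* P^N(C) is the set of lines through the origin of C^(N+1).  Subspaces in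
   [{vspace _}] are canonical, so Leibniz equality is equality of points. *)
Definition proj_space : Type :=
  {L : {vspace 'rV[R[i]]_N.+1} | \dim L == 1%N}.

Definition homogeneous (d : nat) (P : hcpoly R N) : Prop :=
  P \is ishomog1 d mdeg.

Definition zero_locus (P : hcpoly R N) : set proj_space :=
  [set x : proj_space | forall v : 'rV[R[i]]_N.+1,
    v \in val x -> meval (fun i => v ord0 i) P = 0].

Definition algebraic_set (S : set proj_space) : Prop :=
  exists I : set (hcpoly R N),
    (forall P, I P -> exists d, homogeneous d P) /\
    S = [set x : proj_space | forall P, I P -> zero_locus P x].

(* [vpick L] is some nonzero vector of the line [L]; neither [std_open] nor the
   quotient [affine_coord] depends on which one. *)
Definition std_open (i : 'I_N.+1) : set proj_space :=
  [set x : proj_space | vpick (val x) ord0 i != 0].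

Definition affine_coord (i j : 'I_N.+1) (x : proj_space) : cplane R :=
  vpick (val x) ord0 j / vpick (val x) ord0 i.

(* Holomorphy in the standard atlas of the complex manifold P^N(C): the maps
   [affine_coord i], for [j] varying, form the chart [std_open i -> C^N] (the
   component [j = i] is constantly 1).  The topology of P^N(C) is the one for
   which the [std_open i] are open and the charts are homeomorphisms, so the
   two clauses also give the continuity of [f]. *)
Definition holomorphic_curve (f : cplane R -> proj_space) : Prop :=
  forall i : 'I_N.+1,
    open (f @^-1` std_open i) /\
    forall z, (f @^-1` std_open i) z ->
      forall j : 'I_N.+1, derivable (affine_coord i j \o f) z 1.

Definition algebraically_nondegenerate (f : cplane R -> proj_space) : Prop :=
  forall S, algebraic_set S -> S <> setT -> ~ (range f `<=` S).

Definition general_position (q : nat) (D : 'I_q -> set proj_space) : Prop :=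
  forall i : 'I_N.+1 -> 'I_q, injective i -> \bigcap_k D (i k) = set0.

End ProjectiveSpace.

(* Main.v *)
(* Write F and G for holomorphic homogeneous coordinates of f and g on a disc.  General position
   yields linearly independent forms p_1, ..., p_s of degree n (s <= q) without common zero such
   that each p_k, and also p_0 = p_1 + ... + p_s, is a multiple of some Q_j or of the sum of the
   Q_j.  The Wronskian W of the functions p_k(F) does not change when one of them is replaced by
   p_0(F); hence, if P is the product of z - a over the distinct zeros of all p_k(F) and p_k(G),
   P^(s(s-1)/2) W is divisible by the product of p_0(F), ..., p_s(F).  If f <> g, some minor
   F_i G_j - F_j G_i is nonzero, and it vanishes at all these zeros, hence is divisible by P.  As
   n - 1 >= s(s-1), the quotients combine into a function Th such that the products F_i G_j Th
   represent (f, g) again, with a value at 0 that does not depend on F and G.  On suitable circles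
   the derivatives of p_k(F) are at most p_k(F) times a power of log B, where B bounds F and G, so
   on a slightly smaller disc the new representation is bounded by a power of log B.  Iterating
   gives representations with a fixed bound on arbitrarily large discs; by Liouville's argument f
   has derivative 0 at the base point, which contradicts its nondegeneracy. *)
Require Import Defs.
From mathcomp Require Import all_boot all_order all_algebra.
From mathcomp Require Import all_classical all_reals all_analysis.
From mathcomp Require Import complex.
From mathcomp Require Import -(notations) mpoly.
From mathcomp Require Import perm ring lra.
Set Implicit Arguments.
Unset Strict Implicit.
Unset Printing Implicit Defensive.
Import Order.TTheory GRing.Theory Num.Theory numFieldNormedType.Exports.
Local Open Scope classical_set_scope.
Local Open Scope ring_scope.

(** [Th] is W_f W_g (minor)^(n-1) divided by all p_k(F) and p_k(G); the factorisations by P only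
    show that its poles cancel. The degree enters by compactness: as p_1, ..., p_s have no common
    zero, max |p_k(F)| >= c |F|^n for the maximum norm |F|. On the circle W_f p_k(F) / (p_0(F) ...
    p_s(F)) is bounded for every k, so the two Wronskian quotients together are at most a constant
    times (|F| |G|)^(-n). The minor costs at most (2 |F| |G|)^(n-1), and the single factor |F| |G|
    that is left pays for F_i G_j.

    Only these products are controlled, not F and G separately. The object that is iterated is
    therefore a matrix E_ij representing (f, g); a column of it represents f and a row represents g.

    The constants must stay the same along the iteration. Near 0 any F with F_0(0) = 1 is F_0 times
    a fixed germ, so every value at 0 that enters is a value of the germs of f and g.

    Function theory is built from ultrafilter limits of finite sums: dyadic Riemann sums give
    Goursat's theorem, means over roots of unity give Cauchy's formula. *)

(** * Modulus of complex numbers and limits along an ultrafilter *)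

Section ComplexModulus.
Variable R : realType.
Implicit Types (z w : R[i]) (x y : R).

(** The norm of [R[i]] takes its values in [R[i]]; a real-valued modulus keeps all estimates in the
    ordered field [R]. *)
Definition nm z : R := Normc.normc z.

Lemma normE z : `|z| = (nm z)%:C%C.
Proof. by []. Qed.

Lemma nm0 : nm 0 = 0. Proof. exact: Normc.normc0. Qed.
Lemma nm1 : nm 1 = 1. Proof. exact: Normc.normc1. Qed.
Lemma nmM z w : nm (z * w) = nm z * nm w. Proof. exact: Normc.normcM. Qed.
Lemma nmV z : nm z^-1 = (nm z)^-1. Proof. exact: Normc.normcV. Qed.
Lemma nmN z : nm (- z) = nm z. Proof. exact: normcN. Qed.
Lemma nmD z w : nm (z + w) <= nm z + nm w. Proof. exact: le_normcD. Qed.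
Lemma nmB z w : nm (z - w) <= nm z + nm w.
Proof. by rewrite -[nm w]nmN nmD. Qed.
Lemma nmBC z w : nm (z - w) = nm (w - z).
Proof. by rewrite -nmN opprB. Qed.
Lemma nm_ge0 z : 0 <= nm z.
Proof. by rewrite /nm; case: z => a b; rewrite sqrtr_ge0. Qed.
Hint Resolve nm_ge0 : core.

Lemma nm_eq0 z : (nm z == 0) = (z == 0).
Proof.
by apply/eqP/eqP => [/Normc.eq0_normc //|->]; rewrite nm0.
Qed.

Lemma nm_gt0 z : (0 < nm z) = (z != 0).
Proof. by rewrite lt_neqAle nm_ge0 andbT eq_sym nm_eq0. Qed.

Lemma nm_real x : nm x%:C%C = `|x|.
Proof. by rewrite /nm /= expr0n /= addr0 sqrtr_sqr. Qed.

Lemma nm_i : nm 'i%C = 1.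
Proof. by rewrite /nm /= expr0n /= add0r expr1n sqrtr1. Qed.

Lemma nmX z n : nm (z ^+ n) = nm z ^+ n.
Proof. by elim: n => [|n IH]; rewrite ?expr0 ?nm1 // !exprS nmM IH. Qed.

Lemma nm_nat n : nm n%:R = n%:R.
Proof. by rewrite -(rmorph_nat (real_complex R)) nm_real ger0_norm. Qed.

Lemma nm_sum (I : Type) (r : seq I) (P : pred I) (F : I -> R[i]) :
  nm (\sum_(i <- r | P i) F i) <= \sum_(i <- r | P i) nm (F i).
Proof.
elim/big_ind2: _ => [|a b c d ab cd|//]; first by rewrite nm0.
by rewrite (le_trans (nmD _ _))// lerD.
Qed.

Lemma nm_prod (I : Type) (r : seq I) (P : pred I) (F : I -> R[i]) :
  nm (\prod_(i <- r | P i) F i) = \prod_(i <- r | P i) nm (F i).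
Proof. exact: (big_morph nm nmM nm1). Qed.

Lemma nm_sub z w : nm z - nm w <= nm (z - w).
Proof. by rewrite lerBlDr (le_trans _ (nmD _ _))// subrK. Qed.

Lemma Re_le_nm z : `|complex.Re z| <= nm z.
Proof. by have := normc_ge_Re z; rewrite normE lecR. Qed.

Lemma Im_le_nm z : `|complex.Im z| <= nm z.
Proof.
case: z => a b; rewrite /nm /= -(sqrtr_sqr b) ler_sqrt ?addr_ge0 ?sqr_ge0//.
by rewrite lerDr sqr_ge0.
Qed.

Lemma nm_le_ReIm z : nm z <= `|complex.Re z| + `|complex.Im z|.
Proof.
rewrite {1}(complexE z) (le_trans (nmD _ _))// nm_real nmM nm_i mul1r nm_real.
by [].
Qed.

Lemma nm_sqr z : nm z ^+ 2 = complex.Re z ^+ 2 + complex.Im z ^+ 2.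
Proof. by case: z => a b; rewrite /nm /= sqr_sqrtr// addr_ge0 ?sqr_ge0. Qed.

Lemma nm_conj z : nm (conjc z) = nm z.
Proof. by case: z => a b; rewrite /nm /= sqrrN. Qed.

Lemma mul_conj z : z * conjc z = (nm z ^+ 2)%:C%C.
Proof. by rewrite -sqr_normc normE rmorphXn. Qed.

Lemma small_eq0 z : (forall e : R, 0 < e -> nm z <= e) -> z = 0.
Proof.
move=> h; apply/eqP; rewrite -nm_eq0 eq_le nm_ge0 andbT.
by apply/ler_addgt0Pr => e e0; rewrite add0r h.
Qed.

Lemma ltr0c x : (0 < x%:C%C) = (0 < x).
Proof. by rewrite -ltcR. Qed.

Lemma nbhs_nm (z : cplane R) (P : cplane R -> Prop) :
  (\forall w \near z, P w) <-> exists2 d : R, 0 < d & forall w, nm (w - z) < d -> P w.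
Proof.
split=> [/nbhs_ballP [e /= e0 he]|[d d0 hd]].
  (* A positive element of [R[i]] is real, since the order compares only numbers with equal
     imaginary parts. *)
  have ie : complex.Im e = 0 by move: e0; rewrite ltcE => /andP[/eqP /= -> _].
  exists (complex.Re e); first by move: e0; rewrite ltcE => /andP[].
  move=> w hw; apply: he; rewrite /ball /= /ball_ distrC normE.
  by case: e ie hw {e0} => a b /= -> hw; rewrite -[Complex a 0]/(a%:C%C) ltcR.
apply/nbhs_ballP; exists d%:C%C => /=; first by rewrite ltr0c.
by move=> w; rewrite /ball /= /ball_ distrC normE ltcR => /hd.
Qed.

(** The filter is arbitrary, so that one algebra of limits serves both continuity at a point and
    limits along an ultrafilter. *)
Definition ccvg (T : Type) (F : set_system T) (x : T -> R[i]) (l : R[i]) :=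
  forall e : R, 0 < e -> F (fun t => nm (x t - l) < e).

Section Convergence.
Context {T : Type} {F : set_system T} {FF : Filter F}.
Implicit Types (u v : T -> R[i]) (a b : R[i]).

Lemma ccvg_cst a : ccvg F (fun=> a) a.
Proof. by move=> e e0; apply: filterE => t; rewrite subrr nm0. Qed.

Lemma ccvgD u v a b : ccvg F u a -> ccvg F v b -> ccvg F (fun t => u t + v t) (a + b).
Proof.
move=> hu hv e e0; have e2 : 0 < e / 2 by lra.
apply: filterS2 (hu _ e2) (hv _ e2) => t h1 h2.
have -> : u t + v t - (a + b) = (u t - a) + (v t - b) by ring.
by apply: le_lt_trans (nmD _ _) _; lra.
Qed.

Lemma ccvgN u a : ccvg F u a -> ccvg F (fun t => - u t) (- a).
Proof.
move=> hu e e0; apply: filterS (hu _ e0) => t.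
by rewrite -opprD nmN.
Qed.

Lemma ccvgM u v a b : ccvg F u a -> ccvg F v b -> ccvg F (fun t => u t * v t) (a * b).
Proof.
move=> hu hv e e0.
have K0 : 0 < 1 + nm a + nm b by rewrite !ltr_pwDl ?nm_ge0.
pose d := Num.min 1 (e / (1 + nm a + nm b)).
have d0 : 0 < d by rewrite lt_min ltr01 divr_gt0.
have d1 : d <= 1 by rewrite ge_min lexx.
have d2 : d * (1 + nm a + nm b) <= e.
  by rewrite -ler_pdivlMr// ge_min lexx orbT.
apply: filterS2 (hu _ d0) (hv _ d0) => t h1 h2.
have -> : u t * v t - a * b = (u t - a) * (v t - b) + (a * (v t - b) + (u t - a) * b) by ring.
apply: le_lt_trans (nmD _ _) _; apply: le_lt_trans (lerD (lexx _) (nmD _ _)) _.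
rewrite !nmM; apply: lt_le_trans d2.
have := nm_ge0 (u t - a); have := nm_ge0 (v t - b); have := nm_ge0 a; have := nm_ge0 b.
by move: (nm (u t - a)) (nm (v t - b)) (nm a) (nm b) h1 h2 => p q r s; nra.
Qed.

Lemma ccvgV u a : a != 0 -> ccvg F u a -> ccvg F (fun t => (u t)^-1) a^-1.
Proof.
move=> a0 hu e e0; have na : 0 < nm a by rewrite nm_gt0.
pose d := Num.min (nm a / 2) (e * nm a ^+ 2 / 2).
have d0 : 0 < d by rewrite lt_min !divr_gt0// mulr_gt0// exprn_gt0.
have d1 : d <= nm a / 2 by rewrite ge_min lexx.
have d2 : d <= e * nm a ^+ 2 / 2 by rewrite ge_min lexx orbT.
apply: filterS (hu _ d0) => t h.
have h1 : nm a / 2 < nm (u t).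
  by have := nm_sub a (u t); rewrite nmBC; lra.
have ut : u t != 0 by rewrite -nm_gt0; apply: lt_trans h1; lra.
have -> : (u t)^-1 - a^-1 = (a - u t) / (u t * a) by field; rewrite ut a0.
rewrite nmM nmV nmM ltr_pdivrMr ?mulr_gt0 ?nm_gt0// nmBC.
apply: lt_le_trans h _; apply: le_trans d2 _; rewrite expr2 -mulrA ler_pM2l//.
by nra.
Qed.

End Convergence.

Definition near_pt (z : R[i]) : set_system R[i] :=
  fun P => exists2 r : R, 0 < r & forall w, nm (w - z) < r -> P w.

#[global] Instance near_pt_filter z : Filter (near_pt z).
Proof.
split; first by exists 1.
  move=> P Q [r r0 hr] [s s0 hs]; exists (Num.min r s); first by rewrite lt_min r0.
  by move=> w; rewrite lt_min => /andP[/hr ? /hs ?].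
by move=> P Q PQ [r r0 hr]; exists r => // w /hr /PQ.
Qed.

Definition ccont (h : R[i] -> R[i]) z := ccvg (near_pt z) h (h z).

End ComplexModulus.
Arguments nm : simpl never.
#[global] Hint Resolve nm_ge0 : core.

Section UltraLimit.
Variable R : realType.

Lemma ex_ultra : exists U : set_system nat, UltraFilter U /\ \oo `<=` U.
Proof. exact: ultraFilterLemma. Qed.

(** One free ultrafilter, fixed once: along it every bounded sequence converges, linearly in the
    sequence. It replaces both the passage to subsequences and the convergence of integrals. *)
Definition uset : set_system nat := sval (cid ex_ultra).

#[global] Instance uset_ultra : UltraFilter uset.
Proof. by case: (svalP (cid ex_ultra)). Qed.

Lemma uset_oo : \oo `<=` uset.
Proof. by case: (svalP (cid ex_ultra)). Qed.

Lemma uset_ge (P : nat -> Prop) n0 : (forall n, (n0 <= n)%N -> P n) -> uset P.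
Proof. by move=> h; apply: uset_oo; exists n0. Qed.

Lemma uset_ex (P : nat -> Prop) n0 : uset P -> exists2 n, (n0 <= n)%N & P n.
Proof.
move=> hP; have hn : uset [set n | (n0 <= n)%N] by apply: (@uset_ge _ n0).
by have [n [? ?]] := filter_ex (filterI hn hP); exists n.
Qed.

Lemma ucvgR (x : nat -> R) M : (forall n, `|x n| <= M) ->
  exists l, forall e, 0 < e -> uset (fun n => `|x n - l| < e).
Proof.
move=> hx; have := @segment_compact R (- M) M.
move=> /(_ (x @ uset) _) [|l [_ hl]].
  have h : uset (x @^-1` `[- M, M]) by apply: filterE => n; rewrite /= in_itv /= -ler_norml hx.
  exact: h.
exists l => e e0; pose A : set nat := fun n => `|x n - l| < e.
have [//|hA] := in_ultra_setVsetC A uset_ultra.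
have h1 : (x @ uset) (x @` (~` A)) by apply: filterS hA => n hn; exists n.
have h2 : nbhs l (ball l e) by exact: nbhsx_ballx.
have [_ [[n hn <-]]] := hl _ _ h1 h2.
by rewrite /ball /= distrC => h; exfalso; apply: hn.
Qed.

Definition ubounded (x : nat -> R[i]) := exists M, forall n, nm (x n) <= M.

Definition ulim (x : nat -> R[i]) : R[i] :=
  xget 0 (ccvg uset x).

Lemma ulim_cvg (x : nat -> R[i]) : ubounded x -> ccvg uset x (ulim x).
Proof.
move=> [M hM]; rewrite /ulim; case: xgetP => [//|].
have [a ha] := @ucvgR (fun n => complex.Re (x n)) M (fun n => le_trans (Re_le_nm _) (hM n)).
have [b hb] := @ucvgR (fun n => complex.Im (x n)) M (fun n => le_trans (Im_le_nm _) (hM n)).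
move=> /(_ (Complex a b)); case=> e e0.
have e2 : 0 < e / 2 by lra.
apply: filterS2 (ha _ e2) (hb _ e2) => n h1 h2.
apply: le_lt_trans (nm_le_ReIm _) _.
by case: (x n) h1 h2 => c d /= h1 h2; lra.
Qed.

Lemma ccvg_unique (x : nat -> R[i]) l l' : ccvg uset x l -> ccvg uset x l' -> l = l'.
Proof.
move=> h h'; apply/eqP; rewrite -subr_eq0; apply/eqP; apply: small_eq0 => e e0.
have e2 : 0 < e / 2 by lra.
have [n [h1 h2]] := filter_ex (filterI (h _ e2) (h' _ e2)).
have -> : l - l' = (x n - l') - (x n - l) by ring.
by apply: le_trans (nmB _ _) _; lra.
Qed.

Lemma ulimE (x : nat -> R[i]) (l : R[i]) : ccvg uset x l -> ulim x = l.
Proof. by move=> h; apply: xget_unique => // y hy; exact: (ccvg_unique hy h). Qed.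

Lemma uboundedB x y : ubounded x -> ubounded y -> ubounded (fun n => x n - y n).
Proof.
by move=> [M hM] [K hK]; exists (M + K) => n; rewrite (le_trans (nmB _ _))// lerD.
Qed.

Lemma ulimB x y : ubounded x -> ubounded y ->
  ulim (fun n => x n - y n) = ulim x - ulim y.
Proof. by move=> hx hy; apply: ulimE; apply: ccvgD; [|apply: ccvgN]; exact: ulim_cvg. Qed.

Lemma ulimZ c x : ubounded x -> ulim (fun n => c * x n) = c * ulim x.
Proof.
by move=> hx; apply: ulimE; apply: ccvgM; [exact: ccvg_cst|exact: ulim_cvg].
Qed.

Lemma ulim_le x B l : ubounded x ->
  (forall e, 0 < e -> uset (fun n => nm (x n - l) <= B + e)) ->
  nm (ulim x - l) <= B.
Proof.
move=> hx h; apply/ler_addgt0Pr => e e0; have e2 : 0 < e / 2 by lra.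
have h1 := ulim_cvg hx e2.
have [n [h2 h3]] := filter_ex (filterI h1 (h _ e2)).
have -> : ulim x - l = (x n - l) - (x n - ulim x) by ring.
by apply: le_trans (nmB _ _) _; lra.
Qed.

Lemma cluster_point (x : nat -> R[i]) M : (forall n, nm (x n) <= M) ->
  exists l, nm l <= M /\
    forall e, 0 < e -> uset (fun n => nm (x n - l) < e).
Proof.
move=> hx; have bx : ubounded x by exists M.
exists (ulim x); split; last exact: ulim_cvg.
by rewrite -[ulim x]subr0; apply: ulim_le => // e e0; apply: filterE => n; rewrite subr0 ler_wpDr// ltW.
Qed.

End UltraLimit.

(** * Bisection of rectangles and complex derivatives *)

Section Cousin.
Variable R : realType.

Lemma pow2_small (w d : R) : 0 < d -> exists n0, forall n, (n0 <= n)%N -> w / 2 ^+ n < d.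
Proof.
move=> d0; exists (Num.trunc (`|w| / d)).+1 => n hn.
have h1 : `|w| / d < n%:R.
  by apply: lt_le_trans (truncnS_gt _) _; rewrite ler_nat.
have h2 : (n%:R : R) < 2 ^+ n by rewrite -natrX ltr_nat ltn_expl.
have p0 : (0 : R) < 2 ^+ n by rewrite exprn_gt0.
rewrite ltr_pdivrMr//; apply: le_lt_trans (ler_norm w) _.
rewrite ltr_pdivrMr// in h1; apply: lt_trans h1 _.
by rewrite mulrC ltr_pM2l.
Qed.

Lemma nested_point (a b : nat -> R) :
  (forall n, a n <= a n.+1) -> (forall n, b n.+1 <= b n) -> (forall n, a n <= b n) ->
  exists x, forall n, a n <= x <= b n.
Proof.
move=> ha hb hab.
have ma : {homo a : m n / (m <= n)%N >-> m <= n} by apply: homo_leq => //; exact: le_trans.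
have mb : {homo b : m n / (m <= n)%N >-> n <= m}.
  by move=> m n /subnK <-; elim: (n - m)%N => // k IH; exact: le_trans (hb _) IH.
have hm m n : a m <= b n.
  have [mn|nm] := leqP m n; first exact: le_trans (ma _ _ mn) (hab _).
  by apply: le_trans (hab _) (mb _ _ (ltnW nm)).
have sa : has_sup (range a).
  by split; [exists (a 0), 0%N|exists (b 0) => _ [n _ <-]].
exists (sup (range a)) => n; apply/andP; split.
  by apply: sup_upper_bound => //; exists n.
by apply: ge_sup; [case: sa|move=> _ [m _ <-]].
Qed.

(** If [Q] failed, it would fail on one of the four quarters, and so on; these nested rectangles
    shrink to a point at which the local hypothesis is violated. With y1 = y2 this is the
    compactness of a segment, which is how [mvt_loc] and [clopen_segment] use it. *)
Lemma cousin (Q : R -> R -> R -> R -> Prop) (x1 x2 y1 y2 : R) :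
  x1 <= x2 -> y1 <= y2 ->
  (forall a b c d, a <= b -> c <= d ->
     Q a ((a + b) / 2) c ((c + d) / 2) -> Q ((a + b) / 2) b c ((c + d) / 2) ->
     Q a ((a + b) / 2) ((c + d) / 2) d -> Q ((a + b) / 2) b ((c + d) / 2) d ->
     Q a b c d) ->
  (forall x y, x1 <= x <= x2 -> y1 <= y <= y2 ->
     exists2 e, 0 < e & forall a b c d, x1 <= a -> b <= x2 -> y1 <= c -> d <= y2 ->
       a <= x <= b -> c <= y <= d -> b - a < e -> d - c < e -> Q a b c d) ->
  Q x1 x2 y1 y2.
Proof.
move=> hx hy hsplit hloc; apply: contrapT => nQ.
pose T := (R * R * R * R)%type.
pose bad (t : T) := let: (a, b, c, d) := t in
  [/\ x1 <= a /\ b <= x2, y1 <= c /\ d <= y2, a <= b, c <= d & ~ Q a b c d].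
pose sub (t t' : T) := let: (a, b, c, d) := t in let: (a', b', c', d') := t' in
  [/\ a <= a' /\ b' <= b, c <= c' /\ d' <= d, b' - a' = (b - a) / 2
    & d' - c' = (d - c) / 2].
have step (t : {t | bad t}) : {t' : {t | bad t} | sub (sval t) (sval t')}.
  apply: cid; case: t => [[[[a b] c] d]] /= ht; have [[h1 h2] [h3 h4] h5 h6 h7] := ht.
  have bd a' b' c' d' : a <= a' -> b' <= b -> c <= c' -> d' <= d -> b' - a' = (b - a) / 2 ->
    d' - c' = (d - c) / 2 -> ~ Q a' b' c' d' ->
    exists t', sub (a, b, c, d) (sval (t' : {t | bad t})).
    move=> k1 k2 k3 k4 k5 k6 k7.
    have hb : bad (a', b', c', d') by split => //; try split; lra.
    by exists (exist _ (a', b', c', d') hb).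
  apply: contrapT => hn; apply: h7; apply: hsplit => //;
    (apply: contrapT => hq; apply: hn; apply: bd hq; lra).
have bad0 : bad (x1, x2, y1, y2) by [].
pose s := fix s n := if n is m.+1 then sval (step (s m)) else exist bad _ bad0.
pose A n := (sval (s n)).1.1.1; pose B n := (sval (s n)).1.1.2.
pose C n := (sval (s n)).1.2; pose D n := (sval (s n)).2.
have hbad n : bad (A n, B n, C n, D n).
  by have := svalP (s n); rewrite /A /B /C /D; case: (sval (s n)) => [[[a b] c] d].
have hsub n : sub (A n, B n, C n, D n) (A n.+1, B n.+1, C n.+1, D n.+1).
  have := svalP (step (s n)); rewrite /A /B /C /D /=.
  by move: (sval (sval (step (s n)))) => [[[a' b'] c'] d']; case: (sval (s n)) => [[[a b] c] d].
have wAB n : B n - A n = (x2 - x1) / 2 ^+ n.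
  elim: n => [|n IH]; first by rewrite expr0 divr1.
  by have [_ _ -> _] := hsub n; rewrite IH exprSr invfM mulrA.
have wCD n : D n - C n = (y2 - y1) / 2 ^+ n.
  elim: n => [|n IH]; first by rewrite expr0 divr1.
  by have [_ _ _ ->] := hsub n; rewrite IH exprSr invfM mulrA.
have [x hxn] : exists x, forall n, A n <= x <= B n.
  by apply: nested_point => n; [have [[]] := hsub n|have [[]] := hsub n|have [] := hbad n].
have [y hyn] : exists y, forall n, C n <= y <= D n.
  by apply: nested_point => n; [have [_ []] := hsub n|have [_ []] := hsub n|have [] := hbad n].
have [e e0 he] := hloc x y (hxn 0%N) (hyn 0%N).
have [n1 hn1] := pow2_small (x2 - x1) e0; have [n2 hn2] := pow2_small (y2 - y1) e0.
pose n := maxn n1 n2.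
have [[h1 h2] [h3 h4] h5 h6 h7] := hbad n; apply: h7; apply: he => //.
  by rewrite wAB hn1// leq_maxl.
by rewrite wCD hn2// leq_maxr.
Qed.

End Cousin.

Section ComplexDerivative.
Variable R : realType.
Local Notation C := R[i].
Implicit Types (h k : C -> C) (z w d : C).

(** Caratheodory's form of the derivative: the difference quotient is replaced by a factor [phi]
    continuous at [z], so that the rules of differentiation become identities plus limits of
    products. *)
Definition is_cder h z d := exists phi : C -> C,
  [/\ phi z = d, ccont phi z & forall w, h w = h z + phi w * (w - z)].

Lemma is_cderP h z d : is_cder h z d <-> forall e : R, 0 < e -> exists2 r : R, 0 < r &
  forall w, nm (w - z) < r -> nm (h w - h z - d * (w - z)) <= e * nm (w - z).
Proof.
split=> [[phi [<- hc hphi]] e e0|H].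
  have [r r0 hr] := hc e e0.
  exists r => // w /hr hw; rewrite hphi.
  have -> : h z + phi w * (w - z) - h z - phi z * (w - z) = (phi w - phi z) * (w - z) by ring.
  by rewrite nmM ler_wpM2r ?nm_ge0// ltW.
exists (fun w => if w == z then d else (h w - h z) / (w - z)); split.
- by rewrite eqxx.
- move=> e e0; have e2 : 0 < e / 2 by lra.
  have [r r0 hr] := H _ e2; exists r => // w hw; rewrite eqxx.
  case: eqVneq => [_|wz]; first by rewrite subrr nm0.
  have wz0 : w - z != 0 by rewrite subr_eq0.
  have -> : (h w - h z) / (w - z) - d = (h w - h z - d * (w - z)) / (w - z) by field.
  rewrite nmM nmV ltr_pdivrMr ?nm_gt0//; apply: le_lt_trans (hr _ hw) _.
  by rewrite ltr_pM2r ?nm_gt0//; lra.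
- move=> w; case: eqVneq => [->|wz]; first by rewrite subrr mulr0 addr0.
  have wz0 : w - z != 0 by rewrite subr_eq0.
  by field.
Qed.

Lemma is_cder_near h k z d (r : R) : 0 < r -> (forall w, nm (w - z) < r -> h w = k w) ->
  is_cder h z d -> is_cder k z d.
Proof.
move=> r0 hk /is_cderP H; apply/is_cderP => e e0; have [s s0 hs] := H _ e0.
exists (Num.min r s); first by rewrite lt_min r0.
move=> w; rewrite lt_min => /andP[h1 h2].
by rewrite -hk// -(hk z) ?subrr ?nm0//; exact: hs.
Qed.

Lemma is_cder_unique h z d d' : is_cder h z d -> is_cder h z d' -> d = d'.
Proof.
move=> /is_cderP H /is_cderP H'; apply/eqP; rewrite -subr_eq0; apply/eqP.
apply: small_eq0 => e e0; have e2 : 0 < e / 2 by lra.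
have [r r0 hr] := H _ e2; have [s s0 hs] := H' _ e2.
pose t : R := Num.min r s / 2.
have t0 : 0 < t by rewrite /t divr_gt0// lt_min r0.
have tm : t < Num.min r s by rewrite /t ltr_pdivrMr// ltr_pMr ?lt_min ?r0//; lra.
move: tm; rewrite lt_min => /andP[tr ts].
pose w := z + t%:C%C.
have wz : w - z = t%:C%C by rewrite /w; ring.
have nw : nm (w - z) = t by rewrite wz nm_real gtr0_norm.
have := hr w; have := hs w; rewrite nw => /(_ ts) h1 /(_ tr) h2.
have E : (d - d') * (w - z) = (h w - h z - d' * (w - z)) - (h w - h z - d * (w - z)) by ring.
have := nmB (h w - h z - d' * (w - z)) (h w - h z - d * (w - z)).
rewrite -E nmM nw => h3; rewrite -(ler_pM2r t0).
by apply: le_trans h3 _; apply: le_trans (lerD h1 h2) _; nra.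
Qed.

Lemma derivable_cder (h : cplane R -> cplane R) (z : cplane R) :
  derivable h z 1 -> exists d, is_cder h z d.
Proof.
move=> /cvg_ex [d /cvgrPdistC_lt hd]; exists d; apply/is_cderP => e e0.
have := hd e%:C%C; rewrite ltr0c => /(_ e0); rewrite /dnbhs near_withinE => /nbhs_nm [r r0 hr].
exists r => // w hw; case: (eqVneq w z) => [->|wz].
  by rewrite !subrr mulr0 subr0 nm0 mulr0.
have wz0 : w - z != 0 by rewrite subr_eq0.
have := hr (w - z); rewrite subr0 => /(_ hw wz0) /=.
rewrite scaler1 subrK normE ltcR => h1.
have -> : h w - h z - d * (w - z) = ((w - z)^-1 * (h w - h z) - d) * (w - z) by field.
by rewrite nmM ler_wpM2r ?nm_ge0// ltW.
Qed.

Lemma is_cder_cont h z d : is_cder h z d ->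
  ccont h z.
Proof.
move=> /is_cderP H e e0.
have [r r0 hr] := H 1 ltr01.
have D0 : 0 < 1 + nm d by rewrite ltr_pwDl ?nm_ge0.
exists (Num.min r (e / (1 + nm d))).
  by rewrite lt_min r0 divr_gt0.
move=> w; rewrite lt_min => /andP[/hr h1 h2].
have -> : h w - h z = (h w - h z - d * (w - z)) + d * (w - z) by ring.
apply: le_lt_trans (nmD _ _) _; rewrite nmM; rewrite ltr_pdivlMr// in h2.
by apply: le_lt_trans (lerD h1 (lexx _)) _; lra.
Qed.

Lemma is_cder_cst c z : is_cder (fun=> c) z 0.
Proof.
by exists (fun=> 0); split => // [|w]; [exact: ccvg_cst|rewrite mul0r addr0].
Qed.

Lemma is_cder_id z : is_cder id z 1.
Proof.
by exists (fun=> 1); split => // [|w]; [exact: ccvg_cst|rewrite mul1r addrC subrK].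
Qed.

Lemma is_cderD h k z d d' : is_cder h z d -> is_cder k z d' ->
  is_cder (fun w => h w + k w) z (d + d').
Proof.
move=> [p [<- hp Ep]] [q [<- hq Eq]]; exists (fun w => p w + q w); split => //.
  exact: ccvgD.
by move=> w; rewrite Ep Eq; ring.
Qed.

Lemma is_cderN h z d : is_cder h z d -> is_cder (fun w => - h w) z (- d).
Proof.
move=> [p [<- hp Ep]]; exists (fun w => - p w); split => //.
  exact: ccvgN.
by move=> w; rewrite Ep; ring.
Qed.

Lemma is_cderB h k z d d' : is_cder h z d -> is_cder k z d' ->
  is_cder (fun w => h w - k w) z (d - d').
Proof. by move=> hh hk; apply: is_cderD => //; exact: is_cderN. Qed.

Lemma is_cderM h k z d d' : is_cder h z d -> is_cder k z d' ->
  is_cder (fun w => h w * k w) z (d * k z + h z * d').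
Proof.
move=> hh hk; have kc := is_cder_cont hk.
case: hh hk => [p [<- hp Ep]] [q [<- hq Eq]].
exists (fun w => p w * k w + h z * q w); split => //.
  by apply: ccvgD; apply: ccvgM => //; exact: ccvg_cst.
by move=> w; rewrite (Ep w) mulrDl {1}(Eq w); ring.
Qed.

Lemma is_cderV h z d : h z != 0 -> is_cder h z d ->
  is_cder (fun w => (h w)^-1) z (- d / h z ^+ 2).
Proof.
move=> hz hh; have hc := is_cder_cont hh.
have [r r0 hr] : exists2 r : R, 0 < r & forall w, nm (w - z) < r -> h w != 0.
  have n0 : 0 < nm (h z) by rewrite nm_gt0.
  have [r r0 hr] := hc _ n0; exists r => // w /hr.
  by apply: contraTneq => ->; rewrite sub0r nmN ltxx.
case: hh => [p [<- hp Ep]].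
pose q w := - p w / (h w * h z).
have hq : ccont q z.
  apply: ccvgM; first exact: ccvgN.
  by apply: ccvgV; [rewrite mulf_neq0|apply: ccvgM => //; exact: ccvg_cst].
have E w : nm (w - z) < r -> (h w)^-1 = (h z)^-1 + q w * (w - z).
  move=> /hr hw; rewrite /q.
  have -> : - p w / (h w * h z) * (w - z) = - (p w * (w - z)) / (h w * h z) by ring.
  have -> : p w * (w - z) = h w - h z by rewrite (Ep w); ring.
  by field; rewrite hz.
apply: (@is_cder_near (fun w => (h z)^-1 + q w * (w - z)) _ _ _ r) => //.
  by move=> w hw; rewrite -E.
exists q; split => // w.
by rewrite subrr mulr0 addr0.
Qed.

Lemma is_cder_shift h a z d : is_cder h (z + a) d -> is_cder (fun w => h (w + a)) z d.
Proof.
move=> /is_cderP H; apply/is_cderP => e e0; have [r r0 hr] := H _ e0.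
exists r => // w hw; have E : w + a - (z + a) = w - z by ring.
by have := hr (w + a); rewrite E; apply.
Qed.

Lemma is_cderZ c h z d : is_cder h z d -> is_cder (fun w => c * h w) z (c * d).
Proof.
move=> hh; have := is_cderM (is_cder_cst c z) hh.
by rewrite mul0r add0r.
Qed.

(** The value 0 at points without derivative is a mere default; it makes [cder] a total operator
    that can be iterated. *)
Definition cder h z : C := xget 0 (is_cder h z).

Lemma cderE h z d : is_cder h z d -> cder h z = d.
Proof. by move=> hd; apply: xget_unique => // y hy; exact: is_cder_unique hy hd. Qed.

(** Only differentiability on the open disc is asked; continuity of the derivative is proved in
    [hol0_cauchy]. *)
Definition hol (a : C) (r : R) h := forall z, nm (z - a) < r -> exists d, is_cder h z d.

Lemma hol_cder a r h z : hol a r h -> nm (z - a) < r -> is_cder h z (cder h z).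
Proof. by move=> hh /hh [d hd]; rewrite (cderE hd). Qed.

Lemma hol_cont a r h z : hol a r h -> nm (z - a) < r ->
  ccont h z.
Proof. by move=> hh /hh [d]; exact: is_cder_cont. Qed.

Lemma disc_open (a z : C) (r : R) : nm (z - a) < r ->
  exists2 s, 0 < s & forall w, nm (w - z) < s -> nm (w - a) < r.
Proof.
move=> hz; exists (r - nm (z - a)); first by rewrite subr_gt0.
move=> w hw; have -> : w - a = (w - z) + (z - a) by ring.
by apply: le_lt_trans (nmD _ _) _; rewrite -ltrBrDr.
Qed.

Lemma hol_ext a r h k : (forall z, nm (z - a) < r -> h z = k z) -> hol a r h -> hol a r k.
Proof.
move=> hk hh z hz; have [d hd] := hh _ hz; exists d.
have [s s0 hs] := disc_open hz.
by apply: is_cder_near s0 _ hd => w /hs /hk.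
Qed.

Lemma cder_ext a r h k z : (forall z, nm (z - a) < r -> h z = k z) -> hol a r h ->
  nm (z - a) < r -> cder h z = cder k z.
Proof.
move=> hk hh hz; have [s s0 hs] := disc_open hz.
symmetry; apply: cderE; apply: is_cder_near s0 _ (hol_cder hh hz) => w /hs /hk //.
Qed.

Lemma hol_sub a r b s h : (forall z, nm (z - b) < s -> nm (z - a) < r) ->
  hol a r h -> hol b s h.
Proof. by move=> hs hh z /hs /hh. Qed.

Lemma hol_le a r s h : s <= r -> hol a r h -> hol a s h.
Proof. by move=> sr; apply: hol_sub => z /lt_le_trans; apply. Qed.

Lemma hol_cst a r c : hol a r (fun=> c).
Proof. by move=> z _; exists 0; exact: is_cder_cst. Qed.

Lemma hol_id a r : hol a r id.
Proof. by move=> z _; exists 1; exact: is_cder_id. Qed.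

Lemma holD a r h k : hol a r h -> hol a r k -> hol a r (fun z => h z + k z).
Proof. by move=> hh hk z hz; exists (cder h z + cder k z); apply: is_cderD; exact: hol_cder hz. Qed.

Lemma holN a r h : hol a r h -> hol a r (fun z => - h z).
Proof. by move=> hh z hz; exists (- cder h z); apply: is_cderN; exact: hol_cder hz. Qed.

Lemma holB a r h k : hol a r h -> hol a r k -> hol a r (fun z => h z - k z).
Proof. by move=> hh hk; apply: holD => //; exact: holN. Qed.

Lemma holM a r h k : hol a r h -> hol a r k -> hol a r (fun z => h z * k z).
Proof.
move=> hh hk z hz; exists (cder h z * k z + h z * cder k z).
by apply: is_cderM; exact: hol_cder hz.
Qed.

Lemma holV a r h : hol a r h -> (forall z, nm (z - a) < r -> h z != 0) ->
  hol a r (fun z => (h z)^-1).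
Proof.
by move=> hh h0 z hz; eexists; apply: is_cderV; [exact: h0|exact: hol_cder hh hz].
Qed.

Lemma holX a r h n : hol a r h -> hol a r (fun z => h z ^+ n).
Proof.
move=> hh; elim: n => [|n IH].
  by apply: hol_ext (@hol_cst a r 1) => z _; rewrite expr0.
by apply: hol_ext (holM hh IH) => z _; rewrite exprS.
Qed.

Lemma hol_sum a r (I : Type) (s : seq I) (P : pred I) (F : I -> C -> C) :
  (forall i, P i -> hol a r (F i)) -> hol a r (fun z => \sum_(i <- s | P i) F i z).
Proof.
move=> hF; elim: s => [|i s IH].
  by apply: hol_ext (@hol_cst a r 0) => z _; rewrite big_nil.
case Pi : (P i); last by apply: hol_ext IH => z _; rewrite big_cons Pi.
by apply: hol_ext (holD (hF i Pi) IH) => z _; rewrite big_cons Pi.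
Qed.

Lemma hol_prod a r (I : Type) (s : seq I) (P : pred I) (F : I -> C -> C) :
  (forall i, P i -> hol a r (F i)) -> hol a r (fun z => \prod_(i <- s | P i) F i z).
Proof.
move=> hF; elim: s => [|i s IH].
  by apply: hol_ext (@hol_cst a r 1) => z _; rewrite big_nil.
case Pi : (P i); last by apply: hol_ext IH => z _; rewrite big_cons Pi.
by apply: hol_ext (holM (hF i Pi) IH) => z _; rewrite big_cons Pi.
Qed.

Lemma hol_shift a r b h : hol a r h -> hol (a - b) r (fun z => h (z + b)).
Proof.
move=> hh z hz; have hz' : nm (z + b - a) < r by rewrite (_ : _ - a = z - (a - b))//; ring.
by exists (cder h (z + b)); apply: is_cder_shift; exact: hol_cder hh hz'.
Qed.

Lemma cder_shift a r b h z : hol a r h -> nm (z + b - a) < r ->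
  cder (fun w => h (w + b)) z = cder h (z + b).
Proof. by move=> hh hz; apply: cderE; apply: is_cder_shift; exact: hol_cder hh hz. Qed.

End ComplexDerivative.

(** * Goursat's theorem and primitives on discs *)

Section Primitive.
Variable R : realType.
Local Notation C := R[i].
Implicit Types (phi psi : R -> C).

(* Integration from -L by dyadic Riemann sums; the ultralimit makes it defined and
   linear on all bounded functions, without any integrability condition. *)
Definition rcount (L b : R) (k : nat) : nat := Num.trunc ((b + L) * 2 ^+ k).
Definition rpt (L : R) (k j : nat) : R := j.+1%:R / 2 ^+ k - L.
Definition rsum (L : R) phi (b : R) (k : nat) : C :=
  ((2 ^+ k)^-1)%:C%C * \sum_(0 <= j < rcount L b k) phi (rpt L k j).
Definition prim (L : R) phi (b : R) : C := ulim (rsum L phi b).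

Lemma exp2_gt0 k : (0 : R) < 2 ^+ k. Proof. by rewrite exprn_gt0. Qed.

Lemma rcount_itv L b k : - L <= b ->
  (rcount L b k)%:R <= (b + L) * 2 ^+ k < (rcount L b k)%:R + 1.
Proof.
move=> hb; rewrite natr1; apply: truncn_itv.
by rewrite mulr_ge0 ?(ltW (exp2_gt0 k))//; lra.
Qed.

Lemma rsum_bounded L phi b M : - L <= b -> (forall t, nm (phi t) <= M) ->
  ubounded (rsum L phi b).
Proof.
move=> hb hM; exists (M * (b + L)) => k; rewrite /rsum nmM nm_real.
have p0 := exp2_gt0 k.
rewrite gtr0_norm ?invr_gt0// ler_pdivrMl//.
apply: le_trans (nm_sum _ _ _) _.
apply: (@le_trans _ _ (\sum_(0 <= j < rcount L b k) M)).
  by apply: ler_sum => j _; exact: hM.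
rewrite big_const_nat subn0 iter_addr_0 -[M *+ _]mulr_natr.
have M0 : 0 <= M := le_trans (nm_ge0 _) (hM 0).
have /andP[h _] := rcount_itv k hb.
have := ler_wpM2l M0 h; nra.
Qed.

Lemma primB L phi psi b M K : - L <= b ->
  (forall t, nm (phi t) <= M) -> (forall t, nm (psi t) <= K) ->
  prim L (fun t => phi t - psi t) b = prim L phi b - prim L psi b.
Proof.
move=> hb hM hK; rewrite /prim -ulimB; try exact: rsum_bounded.
by congr ulim; apply: funext => k; rewrite /rsum sumrB mulrBr.
Qed.

(** The number [N] of sample points between a and b differs from (b - a) 2^k by at most 1, so
    sampling the constant c costs at most |c| / 2^k, which disappears in the limit. This estimate is
    the only property of [prim], besides additivity, on which Goursat's theorem rests. *)
Lemma prim_est_le L phi a b M c B : - L <= a -> a <= b ->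
  (forall t, nm (phi t) <= M) -> (forall t, a <= t <= b -> nm (phi t - c) <= B) ->
  nm (prim L phi b - prim L phi a - c * (b - a)%:C%C) <= B * (b - a).
Proof.
move=> ha ab hM hB; have hb : - L <= b := le_trans ha ab.
have B0 : 0 <= B by apply: le_trans (nm_ge0 _) (hB a _); rewrite lexx ab.
rewrite /prim -ulimB; try exact: rsum_bounded hM.
apply: ulim_le; first by apply: uboundedB; exact: rsum_bounded hM.
move=> e e0; have [n0 hn0] := pow2_small (B + nm c) e0.
apply: (uset_ge (n0 := n0)) => k hk.
have p0 := exp2_gt0 k.
have /andP[a1 a2] := rcount_itv k ha; have /andP[b1 b2] := rcount_itv k hb.
have hab : (rcount L a k <= rcount L b k)%N.
  by apply: le_truncn; rewrite ler_wpM2r ?(ltW p0)// lerD2r.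
rewrite /rsum -mulrBr (big_cat_nat _ hab)//= addrAC subrr add0r.
set N := (rcount L b k - rcount L a k)%N.
have E : ((2 ^+ k)^-1)%:C%C * \sum_(rcount L a k <= i < rcount L b k) phi (rpt L k i)
     - c * (b - a)%:C%C
   = ((2 ^+ k)^-1)%:C%C * \sum_(rcount L a k <= i < rcount L b k) (phi (rpt L k i) - c)
     + c * (N%:R / 2 ^+ k - (b - a))%:C%C.
  rewrite sumrB [X in _ = _ * (_ - X) + _]big_const_nat iter_addr_0 -/N.
  rewrite !rmorphB /= rmorphM /= rmorph_nat -[c *+ N]mulr_natr; ring.
rewrite E; apply: le_trans (nmD _ _) _.
have NE : N%:R = (rcount L b k)%:R - (rcount L a k)%:R :> R by rewrite natrB.
have h1 : nm (((2 ^+ k)^-1)%:C%C * \sum_(rcount L a k <= i < rcount L b k) (phi (rpt L k i) - c))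
    <= B * N%:R / 2 ^+ k.
  rewrite nmM nm_real gtr0_norm ?invr_gt0// mulrC ler_pM2r ?invr_gt0//.
  apply: le_trans (nm_sum _ _ _) _.
  apply: (@le_trans _ _ (\sum_(rcount L a k <= j < rcount L b k) B)).
    rewrite !big_nat; apply: ler_sum => j /andP[j1 j2]; apply: hB; rewrite /rpt.
    have q1 : (rcount L a k)%:R <= j%:R :> R by rewrite ler_nat.
    have q2 : j.+1%:R <= (rcount L b k)%:R :> R by rewrite ler_nat.
    rewrite -natr1 in q2 *.
    apply/andP; split.
      by rewrite lerBrDr ler_pdivlMr//; lra.
    by rewrite lerBlDr ler_pdivrMr//; lra.
  by rewrite big_const_nat iter_addr_0 -/N mulr_natr.
have h2 : `|N%:R / 2 ^+ k - (b - a)| <= (2 ^+ k)^-1.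
  rewrite -[X in _ <= X]mul1r -[X in `|_ - X|](mulfK (lt0r_neq0 p0)) -mulrBl normrM.
  rewrite (gtr0_norm (x := (2 ^+ k)^-1)) ?invr_gt0// ler_pM2r ?invr_gt0// NE ler_norml.
  by apply/andP; split; nra.
have h3 : nm (c * (N%:R / 2 ^+ k - (b - a))%:C%C) <= nm c / 2 ^+ k.
  by rewrite nmM nm_real ler_wpM2l ?nm_ge0.
have h4 : N%:R / 2 ^+ k <= (b - a) + (2 ^+ k)^-1.
  by move: h2; rewrite ler_norml => /andP[_]; lra.
have h5 := hn0 k hk; rewrite mulrDl in h5.
have h6 : B * N%:R / 2 ^+ k <= B * ((b - a) + (2 ^+ k)^-1).
  by rewrite -mulrA ler_wpM2l.
by rewrite mulrDr in h6; lra.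
Qed.

Lemma prim_est L phi a b M c B : - L <= a -> - L <= b ->
  (forall t, nm (phi t) <= M) ->
  (forall t, Num.min a b <= t <= Num.max a b -> nm (phi t - c) <= B) ->
  nm (prim L phi b - prim L phi a - c * (b - a)%:C%C) <= B * `|b - a|.
Proof.
move=> ha hb hM hB; have [ab|ba] := leP a b.
  rewrite ger0_norm ?subr_ge0//; apply: prim_est_le hM _ => // t ht; apply: hB.
  by rewrite min_l// max_r.
rewrite distrC gtr0_norm ?subr_gt0//.
have -> : prim L phi b - prim L phi a - c * (b - a)%:C%C =
  - (prim L phi a - prim L phi b - c * (a - b)%:C%C) by rewrite !rmorphB /=; ring.
rewrite nmN; apply: prim_est_le hM _ => //; first exact: ltW.
by move=> t ht; apply: hB; rewrite min_r ?max_l// ltW.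
Qed.

Local Notation cx := (@Complex R).

Lemma nm_box (x y x' y' s t : R) : `|x - x'| <= s -> `|y - y'| <= t ->
  nm (cx x y - cx x' y') <= s + t.
Proof. by move=> h1 h2; apply: le_trans (nm_le_ReIm _) _; rewrite /= lerD. Qed.

Section Goursat.
Variables (h : C -> C) (M L : R).
Hypothesis hM : forall z, nm (h z) <= M.

Let H y := prim L (fun x => h (cx x y)).
Let V x := prim L (fun y => h (cx x y)).

(** The integral of h over the positively oriented boundary of the rectangle [a, b] x [c, d]: bottom
    minus top, plus i times right minus left. *)
Definition circ (a b c d : R) : C :=
  (H c b - H c a) - (H d b - H d a) + 'i%C * ((V b d - V b c) - (V a d - V a c)).


(** The bound e (width + height)^2 passes from four quarters to the whole rectangle, since each
    quarter has half the side lengths. By bisection it is enough to prove it for small rectangles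
    around a point, where h is affine up to a small relative error. *)
Lemma goursat (a b c d : R) : - L <= a -> a <= b -> - L <= c -> c <= d ->
  (forall x y, a <= x <= b -> c <= y <= d -> exists D, is_cder h (cx x y) D) ->
  circ a b c d = 0.
Proof.
move=> La ab Lc cd hder;
suff key e : 0 < e -> nm (circ a b c d) <= e * ((b - a) + (d - c)) ^+ 2.
  apply: small_eq0 => e e0; set S := (b - a) + (d - c).
  have S0 : 0 < 1 + S ^+ 2 by rewrite ltr_pwDl ?sqr_ge0.
  apply: le_trans (key (e / (1 + S ^+ 2)) _) _; first by rewrite divr_gt0.
  rewrite mulrAC ler_pdivrMr// ler_pM2l//; rewrite -/S; lra.
move=> e0; pose Q a b c d := nm (circ a b c d) <= e * ((b - a) + (d - c)) ^+ 2.
apply: (@cousin R Q) => //.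
  move=> {La ab Lc cd hder} {}a {}b {}c {}d ab cd; rewrite /Q.
  set m := (a + b) / 2; set n := (c + d) / 2 => h1 h2 h3 h4.
  have -> : circ a b c d = circ a m c n + circ m b c n + (circ a m n d + circ m b n d).
    by rewrite /circ; ring.
  apply: le_trans (nmD _ _) _; apply: le_trans (lerD (nmD _ _) (nmD _ _)) _.
  apply: le_trans (lerD (lerD h1 h2) (lerD h3 h4)) _.
  by rewrite le_eqVlt; apply/orP; left; apply/eqP; rewrite /m /n; field.
move=> x y hx hy; have [D /is_cderP hD] := hder x y hx hy.
have e2 : 0 < e / 2 by lra.
have [r r0 hr] := hD _ e2; exists (r / 2); first lra.
move=> a' b' c' d' k1 k2 k3 k4 /andP[k5 k6] /andP[k7 k8] k9 k10; rewrite /Q.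
have La' : - L <= a' := le_trans La k1.
have Lc' : - L <= c' := le_trans Lc k3.
have Lb' : - L <= b' by lra.
have Ld' : - L <= d' by lra.
set s := (b' - a') + (d' - c').
have hbox u v : a' <= u <= b' -> c' <= v <= d' ->
    nm (h (cx u v) - h (cx x y) - D * (cx u v - cx x y)) <= e / 2 * s.
  move=> /andP[u1 u2] /andP[v1 v2].
  have hn : nm (cx u v - cx x y) <= s.
    by apply: nm_box; rewrite ler_norml; apply/andP; split; lra.
  apply: le_trans (hr _ _) _; first by apply: le_lt_trans hn _; rewrite /s; lra.
  by rewrite ler_pM2l.
have bnd u v : nm (h u - h v) <= M + M by apply: le_trans (nmB _ _) _; rewrite lerD.
have s0 : 0 <= e / 2 * s by rewrite mulr_ge0 ?(ltW e2)// /s; lra.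
(* Opposite sides are paired: the difference of h between them is constant up to the error, so the
   affine part need not be integrated. The constants of [E1] and [E2] cancel in [circ]. *)
have E1 : nm ((H c' b' - H c' a') - (H d' b' - H d' a') - D * ('i%C * (c' - d')%:C%C) * (b' - a')%:C%C)
    <= (e / 2 * s + e / 2 * s) * (b' - a').
  have -> : (H c' b' - H c' a') - (H d' b' - H d' a') =
     prim L (fun x => h (cx x c') - h (cx x d')) b' - prim L (fun x => h (cx x c') - h (cx x d')) a'.
    by rewrite !(@primB L _ _ _ M M)// /H; ring.
  apply: (@prim_est_le L _ a' b' (M + M)) => //; first lra.
  move=> t ht.
  have -> : h (cx t c') - h (cx t d') - D * ('i%C * (c' - d')%:C%C) =
     (h (cx t c') - h (cx x y) - D * (cx t c' - cx x y)) -
     (h (cx t d') - h (cx x y) - D * (cx t d' - cx x y)).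
    have -> : 'i%C * (c' - d')%:C%C = cx t c' - cx t d'.
      by apply/eqP; rewrite eq_complex /=; apply/andP; split; apply/eqP; ring.
    by ring.
  by apply: le_trans (nmB _ _) _; apply: lerD; apply: hbox => //; lra.
have E2 : nm ((V b' d' - V b' c') - (V a' d' - V a' c') - D * (b' - a')%:C%C * (d' - c')%:C%C)
    <= (e / 2 * s + e / 2 * s) * (d' - c').
  have -> : (V b' d' - V b' c') - (V a' d' - V a' c') =
     prim L (fun y => h (cx b' y) - h (cx a' y)) d' - prim L (fun y => h (cx b' y) - h (cx a' y)) c'.
    by rewrite !(@primB L _ _ _ M M)// /V; ring.
  apply: (@prim_est_le L _ c' d' (M + M)) => //; first lra.
  move=> t ht.
  have -> : h (cx b' t) - h (cx a' t) - D * (b' - a')%:C%C =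
     (h (cx b' t) - h (cx x y) - D * (cx b' t - cx x y)) -
     (h (cx a' t) - h (cx x y) - D * (cx a' t - cx x y)).
    have -> : (b' - a')%:C%C = cx b' t - cx a' t.
      by apply/eqP; rewrite eq_complex /=; apply/andP; split; apply/eqP; ring.
    by ring.
  by apply: le_trans (nmB _ _) _; apply: lerD; apply: hbox => //; lra.
have -> : circ a' b' c' d' =
   ((H c' b' - H c' a') - (H d' b' - H d' a') - D * ('i%C * (c' - d')%:C%C) * (b' - a')%:C%C) +
   'i%C * ((V b' d' - V b' c') - (V a' d' - V a' c') - D * (b' - a')%:C%C * (d' - c')%:C%C).
  by rewrite /circ !rmorphB /=; ring.
apply: le_trans (nmD _ _) _; rewrite nmM nm_i mul1r.
apply: le_trans (lerD E1 E2) _; rewrite /s; nra.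
Qed.

Lemma circ_swapx a b c d : circ a b c d = - circ b a c d.
Proof. by rewrite /circ; ring. Qed.

Lemma circ_swapy a b c d : circ a b c d = - circ a b d c.
Proof. by rewrite /circ; ring. Qed.

Lemma goursat_any (a b c d : R) : - L <= a -> - L <= b -> - L <= c -> - L <= d ->
  (forall x y, Num.min a b <= x <= Num.max a b -> Num.min c d <= y <= Num.max c d ->
     exists D, is_cder h (cx x y) D) ->
  circ a b c d = 0.
Proof.
move=> La Lb Lc Ld hder; have [ab|ba] := leP a b.
  have [cd|dc] := leP c d.
    by apply: goursat => // x y hx hy; apply: hder; rewrite ?(min_l ab) ?(max_r ab) ?(min_l cd) ?(max_r cd).
  rewrite circ_swapy goursat ?oppr0//; first exact: ltW.
  by move=> x y hx hy; apply: hder; rewrite ?(min_l ab) ?(max_r ab) ?(min_r (ltW dc)) ?(max_l (ltW dc)).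
have [cd|dc] := leP c d.
  rewrite circ_swapx goursat ?oppr0//; first exact: ltW.
  by move=> x y hx hy; apply: hder; rewrite ?(min_r (ltW ba)) ?(max_l (ltW ba)) ?(min_l cd) ?(max_r cd).
rewrite circ_swapx circ_swapy goursat ?oppr0//; try exact: ltW.
by move=> x y hx hy; apply: hder; rewrite ?(min_r (ltW ba)) ?(max_l (ltW ba)) ?(min_r (ltW dc)) ?(max_l (ltW dc)).
Qed.

Lemma between_abs (a b t : R) : Num.min a b <= t <= Num.max a b -> `|t - a| <= `|b - a|.
Proof.
have [ab|ba] := leP a b => /andP[h1 h2].
  by rewrite !ger0_norm; lra.
by rewrite !ler0_norm; lra.
Qed.

Lemma primitive_bounded (rho : R) : rho <= L -> hol 0 rho h ->
  exists P, forall z, nm z < rho -> is_cder P z (h z).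
Proof.
(* [P] integrates h from 0 along the real axis to x and then vertically to x + iy. *)
move=> rL hh; pose P (z : C) : C := let: Complex x y := z in
  (H 0 x - H 0 0) + 'i%C * (V x y - V x 0).
exists P => z hz; apply/is_cderP => e e0.
have e2 : 0 < e / 2 by lra.
have hz' : nm (z - 0) < rho by rewrite subr0.
have [r r0 hr] := hol_cont hh hz' e2.
have [s s0 hs] := disc_open hz'.
exists (Num.min (r / 2) s); first by rewrite lt_min s0 andbT; lra.
case: z hz hz' hr hs => x y hz hz' hr hs [x' y']; rewrite lt_min => /andP[k1 k2].
have dx : `|x' - x| <= nm (cx x' y' - cx x y) := Re_le_nm (cx x' y' - cx x y).
have dy : `|y' - y| <= nm (cx x' y' - cx x y) := Im_le_nm (cx x' y' - cx x y).
have ab u v : nm (cx u v) < rho -> - L <= u /\ - L <= v.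
  move=> huv; have := Re_le_nm (cx u v); have := Im_le_nm (cx u v) => /=.
  by rewrite !ler_norml => /andP[? _] /andP[? _]; lra.
have hw' : nm (cx x' y') < rho by have := hs _ k2; rewrite subr0.
have [Lx Ly] := ab _ _ hz; have [Lx' Ly'] := ab _ _ hw'.
have L0 : - L <= 0 by have := nm_ge0 (cx x y); lra.
(* This rectangle moves the horizontal increment of [P] from the real axis to height y. It lies in
   the disc because its points u + iv satisfy |u + iv| <= |u + iy|. *)
have C0 : circ x x' 0 y = 0.
  apply: goursat_any => // u v hu hv; apply: hh; rewrite subr0.
  have hu' := between_abs hu.
  have h1 : nm (cx u y) < rho.
    have := hs (cx u y); rewrite subr0; apply; apply: le_lt_trans k2.
    apply: le_trans dx; apply: le_trans hu'; apply: le_trans (nm_le_ReIm _) _.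
    by rewrite /= subrr normr0 addr0.
  apply: le_lt_trans h1; rewrite -(ler_pXn2r (n := 2)) ?nnegrE ?nm_ge0// !nm_sqr /= lerD2l.
  by have [h0|h0] := leP 0 y; move: hv; rewrite ?(min_l h0) ?(max_r h0) ?(min_r (ltW h0)) ?(max_l (ltW h0)) => /andP[? ?]; nra.
have E : P (cx x' y') - P (cx x y) = (H y x' - H y x) + 'i%C * (V x' y' - V x' y).
  rewrite /P -[RHS]addr0 -[X in _ = _ + X]C0 /circ; ring.
have E1 : nm (H y x' - H y x - h (cx x y) * (x' - x)%:C%C) <= e / 2 * `|x' - x|.
  apply: (@prim_est L _ _ _ M) => // t /between_abs ht; apply: ltW; apply: hr.
  apply: le_lt_trans (nm_le_ReIm _) _; rewrite /= subrr normr0 addr0.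
  by apply: le_lt_trans ht _; apply: le_lt_trans dx _; lra.
have E2 : nm (V x' y' - V x' y - h (cx x y) * (y' - y)%:C%C) <= e / 2 * `|y' - y|.
  apply: (@prim_est L _ _ _ M) => // t /between_abs ht; apply: ltW; apply: hr.
  apply: le_lt_trans (nm_le_ReIm _) _; rewrite /=.
  by apply: le_lt_trans (lerD (lexx _) ht) _; apply: le_lt_trans (lerD dx dy) _; lra.
have -> : P (cx x' y') - P (cx x y) - h (cx x y) * (cx x' y' - cx x y) =
   (H y x' - H y x - h (cx x y) * (x' - x)%:C%C) +
   'i%C * (V x' y' - V x' y - h (cx x y) * (y' - y)%:C%C).
  have -> : cx x' y' - cx x y = (x' - x)%:C%C + 'i%C * (y' - y)%:C%C.
    by apply/eqP; rewrite eq_complex /=; apply/andP; split; apply/eqP; ring.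
  by rewrite E; ring.
apply: le_trans (nmD _ _) _; rewrite nmM nm_i mul1r.
by apply: le_trans (lerD E1 E2) _; nra.
Qed.

End Goursat.

Lemma cont_bounded (h : C -> C) (r : R) : (forall z, nm z <= r -> ccont h z) ->
  exists M, forall z, nm z <= r -> nm (h z) <= M.
Proof.
move=> hc; apply: contrapT => hn.
have ex (n : nat) : exists z, nm z <= r /\ n%:R < nm (h z).
  apply: contrapT => hz; apply: hn; exists n%:R => z hzr; rewrite leNgt; apply/negP => k.
  by apply: hz; exists z.
have [x hx] := choice ex.
have [l [hl hul]] := cluster_point (fun n => (hx n).1).
have [d d0 hd] := hc l hl 1 ltr01.
pose n0 := (Num.trunc (nm (h l) + 1)).+1.
have [n hn0 hnn] := uset_ex n0 (hul d d0).
have h1 := hd _ hnn; have [_ h2] := hx n.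
have h3 : nm (h l) + 1 < n%:R.
  by apply: lt_le_trans (truncnS_gt _) _; rewrite ler_nat.
have := nm_sub (h (x n)) (h l); lra.
Qed.

Lemma cont_unif (h : C -> C) (r : R) (e : R) : 0 < e -> (forall z, nm z <= r -> ccont h z) ->
  exists2 d, 0 < d & forall z w, nm z <= r -> nm w <= r -> nm (z - w) < d -> nm (h z - h w) < e.
Proof.
move=> e0 hc; apply: contrapT => hn.
have ex (n : nat) : exists zw : C * C, [/\ nm zw.1 <= r, nm zw.2 <= r,
    nm (zw.1 - zw.2) < n.+1%:R^-1 & e <= nm (h zw.1 - h zw.2)].
  apply: contrapT => hz; apply: hn; exists n.+1%:R^-1; first by rewrite invr_gt0.
  move=> z w h1 h2 h3; rewrite ltNge; apply/negP => k.
  by apply: hz; exists (z, w).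
have [x hx] := choice ex.
have hx1 n : nm (x n).1 <= r by case: (hx n).
have [l [hl hul]] := cluster_point hx1.
have e2 : 0 < e / 2 by lra.
have [d d0 hd] := hc l hl _ e2.
have d2 : 0 < d / 2 by lra.
pose n0 := (Num.trunc (d / 2)^-1).+1.
have [n hn0 hnn] := uset_ex n0 (hul _ d2).
have [_ _ h3 h4] := hx n.
have h5 : n.+1%:R^-1 < d / 2.
  rewrite invf_plt ?posrE//; apply: lt_le_trans (truncnS_gt _) _.
  by rewrite ler_nat; exact: leqW.
have h8 := lt_trans h3 h5.
have h6 : nm (h (x n).1 - h l) < e / 2 by apply: hd; lra.
have h7 : nm (h (x n).2 - h l) < e / 2.
  apply: hd; have -> : (x n).2 - l = ((x n).1 - l) - ((x n).1 - (x n).2) by ring.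
  by apply: le_lt_trans (nmB _ _) _; lra.
have := nmB (h (x n).1 - h l) (h (x n).2 - h l).
have -> : h (x n).1 - h l - (h (x n).2 - h l) = h (x n).1 - h (x n).2 by ring.
lra.
Qed.

Lemma primitive (h : C -> C) (rho r : R) : hol 0 rho h -> r < rho ->
  exists P, forall z, nm z < r -> is_cder P z (h z).
Proof.
move=> hh rr.
have [M hM] : exists M, forall z, nm z <= r -> nm (h z) <= M.
  by apply: cont_bounded => z hz; apply: hol_cont hh _; rewrite subr0; apply: le_lt_trans rr.
(* [prim] needs a bound on the whole plane, so h is cut off outside the smaller disc. *)
pose h1 z := if nm z < r then h z else 0.
have E z : nm (z - 0) < r -> h z = h1 z by rewrite subr0 /h1 => ->.
have hh1 : hol 0 r h1 by apply: hol_ext E _; apply: hol_le hh; exact: ltW.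
have hM1 z : nm (h1 z) <= Num.max M 0.
  rewrite /h1; case: ifP => hz; last by rewrite nm0 le_max lexx orbT.
  by rewrite le_max hM// ltW.
have [P hP] := primitive_bounded hM1 (lexx r) hh1.
by exists P => z hz; rewrite (E z) ?subr0//; exact: hP.
Qed.

End Primitive.

(** * Cauchy's formula by averages over roots of unity *)

Section CauchyFormula.
Variable R : realType.
Local Notation C := R[i].
Local Notation Creal x := (real_complex R x).

Lemma geo_small (x : R) (e : R) : 0 <= x -> x < 1 -> 0 < e ->
  exists n0, forall n, (n0 <= n)%N -> x ^+ n < e.
Proof.
move=> x0 x1 e0; have [->|xn0] := eqVneq x 0.
  by exists 1%N => -[|n] // _; rewrite expr0n.
have xp : 0 < x by rewrite lt_neqAle eq_sym xn0.
have y1 : 0 < x^-1 - 1 by rewrite subr_gt0 invf_gt1.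
exists (Num.Def.trunc (e^-1 / (x^-1 - 1))).+1 => n hn.
have h1 : e^-1 / (x^-1 - 1) < n%:R.
  by apply: lt_le_trans (truncnS_gt _) _; rewrite ler_nat.
rewrite ltr_pdivrMr// in h1.
have bern m : 1 + m%:R * (x^-1 - 1) <= x^-1 ^+ m.
  elim: m => [|m IH]; first by rewrite mul0r addr0 expr0.
  rewrite exprS -natr1; have m0 : (0 : R) <= m%:R by rewrite ler0n.
  have x1' : 0 <= x^-1 by rewrite invr_ge0.
  by apply: le_trans (ler_wpM2l x1' IH); have := mulr_ge0 m0 (sqr_ge0 (x^-1 - 1)); nra.
have h2 := bern n; rewrite exprVn in h2.
rewrite -[x ^+ n]invrK -[e]invrK ltf_pV2 ?posrE ?invr_gt0 ?exprn_gt0//.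
by apply: lt_le_trans h1 _; lra.
Qed.

(** Iterated square roots of -1 are primitive roots of unity of order 2^(k+1). Choosing the root
    with nonnegative real part makes them tend to 1: |w^2 - 1| = |w - 1| |w + 1| with |w + 1|^2 >=
    2. *)
Fixpoint rt (k : nat) : C :=
  if k is k'.+1 then
    let s := sqrtc (rt k') in if 0 <= complex.Re s then s else - s
  else - 1.

Lemma rt_sqr k : rt k.+1 ^+ 2 = rt k.
Proof. by rewrite /=; case: ifP => _; rewrite ?sqrrN sqr_sqrtc. Qed.

Lemma rt_Re k : 0 <= complex.Re (rt k.+1).
Proof.
rewrite /=; case: ifP => // /negbT; rewrite -ltNge.
by case: (sqrtc _) => a b /= ha; rewrite oppr_ge0 ltW.
Qed.

Lemma rt_pow k : rt k ^+ (2 ^ k) = -1.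
Proof.
elim: k => [|k IH]; first by rewrite expn0 expr1.
by rewrite expnS exprM rt_sqr IH.
Qed.

Lemma rt_pow1 k : rt k ^+ (2 ^ k.+1) = 1.
Proof. by rewrite expnSr exprM rt_pow sqrrN expr1n. Qed.

Lemma rt_nm k : nm (rt k) = 1.
Proof.
have := nmX (rt k) (2 ^ k.+1); rewrite rt_pow1 nm1 => /esym/eqP.
by rewrite pexpr_eq1 ?nm_ge0 ?expn_gt0// => /eqP.
Qed.

Lemma rt_neq0 k : rt k != 0.
Proof. by rewrite -nm_gt0 rt_nm. Qed.

Lemma rt_dist k : nm (rt k - 1) ^+ 2 <= 4 / 2 ^+ k.
Proof.
elim: k => [|k IH].
  have -> : rt 0 - 1 = - 2%:R :> C by rewrite /=; ring.
  by rewrite nmN nm_nat expr0; lra.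
have E : rt k - 1 = (rt k.+1 - 1) * (rt k.+1 + 1) by rewrite -rt_sqr; ring.
have E2 : nm (rt k - 1) ^+ 2 = nm (rt k.+1 - 1) ^+ 2 * nm (rt k.+1 + 1) ^+ 2.
  by rewrite E nmM exprMn.
have h2 : 2 <= nm (rt k.+1 + 1) ^+ 2.
  rewrite nm_sqr; have := nm_sqr (rt k.+1); rewrite rt_nm expr1n.
  have := rt_Re k; case: (rt k.+1) => a b /= a0 hab; rewrite addr0; nra.
have h3 := sqr_ge0 (nm (rt k.+1 - 1)).
have h4 : nm (rt k.+1 - 1) ^+ 2 * 2 <= 4 / 2 ^+ k.
  by apply: le_trans IH; rewrite E2 ler_wpM2l.
rewrite [2 ^+ k.+1]exprS invfM; lra.
Qed.

Lemma rt_prim k : (2 ^ k.+1)%N.-primitive_root (rt k).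
Proof.
have h0 : (0 < 2 ^ k.+1)%N by rewrite expn_gt0.
have [m hm hdvd] := prim_order_exists h0 (rt_pow1 k).
have /(dvdn_pfactor _ _ (isT : prime 2)) [i hi E] := hdvd.
move: hi; rewrite leq_eqVlt => /orP[/eqP hi|]; first by rewrite -hi -E.
rewrite ltnS => hik; exfalso.
have : rt k ^+ (2 ^ k) == 1 by rewrite -(prim_order_dvd hm) E dvdn_exp2l.
rewrite rt_pow -subr_eq0 -opprD oppr_eq0 -[1 + 1]/(2%:R : C) pnatr_eq0 //.
Qed.

Lemma rt_sum k m : (m < 2 ^ k.+1)%N ->
  \sum_(j < 2 ^ k.+1) rt k ^+ (j * m) = ((m == 0%N) * 2 ^ k.+1)%:R.
Proof.
move=> hm; have [->|m0] := eqVneq m 0%N.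
  by under eq_bigr do rewrite muln0 expr0; rewrite sumr_const card_ord mul1n.
rewrite mul0n; have hw : rt k ^+ m - 1 != 0.
  rewrite subr_eq0 -(prim_order_dvd (rt_prim k)) gtnNdvd// lt0n //.
apply: (mulfI hw); rewrite mulr0.
under eq_bigr do rewrite mulnC exprM.
by rewrite -subrX1 -exprM mulnC exprM rt_pow1 expr1n subrr.
Qed.

Lemma rt_neq1 k : rt k != 1.
Proof.
apply/eqP => E; have := rt_pow k; rewrite E expr1n => /eqP.
by rewrite -subr_eq0 opprK -[1 + 1]/(2%:R : C) pnatr_eq0.
Qed.

(** With the inverse root, w / [cpt r k j] is (w / r) times a positive power of [rt k], as the
    geometric sums of [mean_kernel] require. *)
Definition cpt (r : R) k (j : nat) : C := r%:C%C * (rt k)^-1 ^+ j.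

Lemma cpt_nm r k j : 0 <= r -> nm (cpt r k j) = r.
Proof. by move=> r0; rewrite nmM nmX nmV rt_nm invr1 expr1n mulr1 nm_real ger0_norm. Qed.

Lemma cptS r k j : cpt r k j.+1 = cpt r k j * (rt k)^-1.
Proof. by rewrite /cpt exprSr mulrA. Qed.

Lemma cpt_per r k : cpt r k (2 ^ k.+1) = cpt r k 0.
Proof. by rewrite /cpt exprVn rt_pow1 invr1 expr0. Qed.

Definition mean (r : R) k (phi : C -> C) : C :=
  (2 ^ k.+1)%:R^-1 * \sum_(j < 2 ^ k.+1) phi (cpt r k j).

Lemma mean_le r k phi B : 0 <= r -> (forall z, nm z = r -> nm (phi z) <= B) ->
  nm (mean r k phi) <= B.
Proof.
move=> r0 hB; rewrite /mean nmM nmV nm_nat.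
have N0 : (0 : R) < (2 ^ k.+1)%:R by rewrite ltr0n expn_gt0.
rewrite ler_pdivrMl//; apply: le_trans (nm_sum _ _ _) _.
apply: (@le_trans _ _ (\sum_(j < 2 ^ k.+1) B)).
  by apply: ler_sum => j _; apply: hB; rewrite cpt_nm.
by rewrite sumr_const card_ord -[B *+ _]mulr_natl.
Qed.

(** This plays the part of the integral of phi(z) dz / (2 pi i z) over |z| = r, and is meaningful
    for every phi bounded on the circle. *)
Definition cm (r : R) phi : C := ulim (fun k => mean r k phi).

Definition cbd (r : R) (phi : C -> C) := exists B, forall z, nm z = r -> nm (phi z) <= B.

Lemma mean_bounded r phi : 0 <= r -> cbd r phi -> ubounded (fun k => mean r k phi).
Proof. by move=> r0 [B hB]; exists B => k; exact: mean_le. Qed.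

Lemma cm_le r phi B : 0 <= r -> (forall z, nm z = r -> nm (phi z) <= B) -> nm (cm r phi) <= B.
Proof.
move=> r0 hB; rewrite -[cm r phi]subr0; apply: ulim_le.
  by apply: mean_bounded => //; exists B.
by move=> e e0; apply: filterE => k; rewrite subr0 ler_wpDr ?(ltW e0)// mean_le.
Qed.

Lemma mean_ext r k phi psi : 0 <= r -> (forall z, nm z = r -> phi z = psi z) ->
  mean r k phi = mean r k psi.
Proof.
by move=> r0 h; rewrite /mean; congr (_ * _); apply: eq_bigr => j _; rewrite h// cpt_nm.
Qed.

Lemma cm_ext r phi psi : 0 <= r -> (forall z, nm z = r -> phi z = psi z) ->
  cm r phi = cm r psi.
Proof. by move=> r0 h; congr ulim; apply: funext => k; exact: mean_ext. Qed.

Lemma cmB r phi psi : 0 <= r -> cbd r phi -> cbd r psi ->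
  cm r (fun z => phi z - psi z) = cm r phi - cm r psi.
Proof.
move=> r0 h1 h2; rewrite /cm -ulimB; try exact: mean_bounded.
by congr ulim; apply: funext => k; rewrite /mean sumrB mulrBr.
Qed.

Lemma cmZ r c phi : 0 <= r -> cbd r phi -> cm r (fun z => c * phi z) = c * cm r phi.
Proof.
move=> r0 h; rewrite /cm -ulimZ; last exact: mean_bounded.
by congr ulim; apply: funext => k; rewrite /mean -mulr_sumr mulrCA.
Qed.

Lemma cbdM r phi psi : cbd r phi -> cbd r psi -> cbd r (fun z => phi z * psi z).
Proof.
by move=> [B hB] [K hK]; exists (B * K) => z hz; rewrite nmM ler_pM ?nm_ge0 ?hB ?hK.
Qed.

Lemma cbdX r phi n : cbd r phi -> cbd r (fun z => phi z ^+ n).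
Proof.
move=> h; elim: n => [|n IH]; first by exists 1 => z _; rewrite expr0 nm1.
by have [B hB] := cbdM h IH; exists B => z hz; rewrite exprS; exact: hB.
Qed.

Lemma cbd_kernel r w : nm w < r -> cbd r (fun z => (z - w)^-1).
Proof.
move=> wr; exists (r - nm w)^-1 => z hz; rewrite nmV lef_pV2 ?posrE ?subr_gt0//.
  by rewrite -hz; exact: nm_sub.
by apply: lt_le_trans (nm_sub _ _); rewrite hz subr_gt0.
Qed.

Lemma cbd_id r : cbd r id. Proof. by exists r => z ->. Qed.

(** With b = w / z one has z / (z - w) = 1 / (1 - b), and b^N is the same at all N sample points. So
    z / (z - w) times 1 - b^N is a finite geometric sum, of which the mean over the roots of unity
    keeps only the constant term. *)
Lemma mean_kernel r k w : nm w < r ->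
  mean r k (fun z => z / (z - w)) * (1 - (w / r%:C%C) ^+ (2 ^ k.+1)) = 1.
Proof.
move=> wr; have r0 : 0 < r := le_lt_trans (nm_ge0 _) wr.
have rc0 : r%:C%C != 0 :> C by rewrite -nm_gt0 nm_real gtr0_norm.
set a := w / _; set N := (2 ^ k.+1)%N.
have N0 : N%:R != 0 :> C by rewrite pnatr_eq0 -lt0n expn_gt0.
have E (j : 'I_N) : cpt r k j / (cpt r k j - w) * (1 - a ^+ N) =
    \sum_(m < N) a ^+ m * rt k ^+ (j * m).
  have z0 : cpt r k j != 0 by rewrite -nm_gt0 cpt_nm// ltW.
  have zw : cpt r k j - w != 0.
    by rewrite -nm_gt0; apply: lt_le_trans (nm_sub _ _); rewrite cpt_nm ?(ltW r0)// subr_gt0.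
  pose b := a * rt k ^+ j.
  have bE : w = b * cpt r k j.
    rewrite /b /a /cpt exprVn; have := expf_neq0 j (rt_neq0 k) => h; field.
    by rewrite h rc0.
  have bN : b ^+ N = a ^+ N by rewrite exprMn -exprM mulnC exprM rt_pow1 expr1n mulr1.
  have b1 : 1 - b != 0.
    by apply: contra zw; rewrite subr_eq0 => /eqP b1; rewrite bE -b1 mul1r subrr.
  have -> : cpt r k j / (cpt r k j - w) = (1 - b)^-1.
    have -> : cpt r k j - w = (1 - b) * cpt r k j by rewrite bE; ring.
    by rewrite invfM mulrCA mulfV ?mulr1.
  have -> : 1 - a ^+ N = (1 - b) * \sum_(m < N) b ^+ m by rewrite -bN -[1 - b ^+ N]opprB subrX1; ring.
  rewrite mulKf//.
  by apply: eq_bigr => m _; rewrite exprMn exprM.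
rewrite /mean -mulrA mulr_suml (eq_bigr _ (fun j _ => E j)) exchange_big /=.
under eq_bigr => m _ do rewrite -mulr_sumr rt_sum//.
rewrite (bigD1 (Ordinal (expn_gt0 2 k.+1 : (0 < N)%N)))//= big1 ?addr0.
  by rewrite expr0 mul1r mul1n mulVf.
move=> m hm; have -> : (m == 0%N :> nat) = false by apply/negbTE.
by rewrite mul0n mulr0.
Qed.

Lemma mvt_loc (g : R -> C) (c : R) : 0 <= c ->
  (forall t, 0 <= t <= 1 -> forall e, 0 < e -> exists2 d, 0 < d &
    forall s, `|s - t| < d -> nm (g s - g t) <= (c + e) * `|s - t|) ->
  nm (g 1 - g 0) <= c.
Proof.
move=> c0 hg; apply/ler_addgt0Pr => e e0.
have : nm (g 1 - g 0) <= (c + e) * (1 - 0); last by rewrite subr0 mulr1.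
apply: (@cousin R (fun a b _ _ => nm (g b - g a) <= (c + e) * (b - a)) 0 1 0 0) => //.
  move=> a b _ _ ab _ h1 h2 _ _; set m := (a + b) / 2 in h1 h2 *.
  have -> : g b - g a = (g b - g m) + (g m - g a) by ring.
  by apply: le_trans (nmD _ _) _; apply: le_trans (lerD h2 h1) _; lra.
move=> t y ht _; have [d d0 hd] := hg t ht e e0; exists d => //.
move=> a b _ _ _ _ _ _ /andP[h1 h2] _ h3 _.
have -> : g b - g a = (g b - g t) - (g a - g t) by ring.
have k1 := hd b; have k2 := hd a.
rewrite ger0_norm ?subr_ge0// in k1; rewrite ler0_norm ?subr_le0// in k2.
apply: le_trans (nmB _ _) _; apply: le_trans (lerD (k1 _) (k2 _)) _; lra.
Qed.

Lemma is_cder_comp (h k : C -> C) z d d' : is_cder k z d -> is_cder h (k z) d' ->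
  is_cder (fun w => h (k w)) z (d' * d).
Proof.
move=> hk; have kc := is_cder_cont hk; case: hk => [p [<- hp Ep]] [q [<- hq Eq]].
exists (fun w => q (k w) * p w); split => // [|w].
  apply: ccvgM => // e e0; have [s s0 hs] := hq e e0.
  by apply: filterS (kc s s0) => w; exact: hs.
by rewrite Eq {2}(Ep w); ring.
Qed.

Lemma is_cder_sum (I : Type) (s : seq I) (F : I -> C -> C) (D : I -> C) z :
  (forall i, is_cder (F i) z (D i)) ->
  is_cder (fun w => \sum_(i <- s) F i w) z (\sum_(i <- s) D i).
Proof.
move=> hF; elim: s => [|i s IH].
  rewrite big_nil; have := is_cder_cst 0 z; congr is_cder.
  by apply: funext => w; rewrite big_nil.
rewrite big_cons; have := is_cderD (hF i) IH; congr is_cder.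
by apply: funext => w; rewrite big_cons.
Qed.

Lemma mvt_segment (P h : C -> C) (p q c : C) (B : R) :
  (forall t, 0 <= t <= 1 -> is_cder P (p + t%:C%C * (q - p)) (h (p + t%:C%C * (q - p)))) ->
  (forall t, 0 <= t <= 1 -> nm (h (p + t%:C%C * (q - p)) - c) <= B) ->
  nm (P q - P p - c * (q - p)) <= B * nm (q - p).
Proof.
move=> hP hB; pose g (t : R) := P (p + t%:C%C * (q - p)) - c * (t%:C%C * (q - p)).
have -> : P q - P p - c * (q - p) = g 1 - g 0.
  rewrite /g rmorph1 rmorph0 !mul1r !mul0r mulr0 addr0 subr0.
  have -> : p + (q - p) = q by ring.
  by ring.
have B0 : 0 <= B by apply: le_trans (nm_ge0 _) (hB 0 _); rewrite lexx ler01.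
apply: mvt_loc; first by rewrite mulr_ge0 ?nm_ge0.
move=> t ht e e0; set x := p + t%:C%C * (q - p).
have K0 : 0 < 1 + nm (q - p) by rewrite ltr_pwDl ?nm_ge0.
have /is_cderP/(_ (e / (1 + nm (q - p)))) [|d d0 hd] := hP t ht.
  by rewrite divr_gt0.
exists (d / (1 + nm (q - p))); first by rewrite divr_gt0.
move=> s hs; set y := p + s%:C%C * (q - p).
have Ey : y - x = (s - t)%:C%C * (q - p) by rewrite /y /x rmorphB /=; ring.
have ny : nm (y - x) = `|s - t| * nm (q - p) by rewrite Ey nmM nm_real.
have nyd : nm (y - x) < d.
  rewrite ltr_pdivlMr// in hs; apply: le_lt_trans hs; rewrite ny.
  by rewrite ler_wpM2l// lerDr.
have := hd y nyd => h1.
have -> : g s - g t = (P y - P x - h x * (y - x)) + (h x - c) * (y - x).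
  by rewrite /g -/x -/y Ey rmorphB /=; ring.
apply: le_trans (nmD _ _) _; rewrite nmM.
have h2 : nm (h x - c) * nm (y - x) <= B * nm (y - x) by rewrite ler_wpM2r ?nm_ge0 ?hB.
apply: le_trans (lerD h1 h2) _; rewrite ny.
have h3 : e / (1 + nm (q - p)) * (`|s - t| * nm (q - p)) <= e * `|s - t|.
  rewrite mulrAC ler_pdivrMr// -mulrA ler_pM2l// ler_wpM2l// lerDr //.
lra.
Qed.

Lemma convex_nm (r : R) (p q : C) (t : R) : nm p <= r -> nm q <= r -> 0 <= t <= 1 ->
  nm (p + t%:C%C * (q - p)) <= r.
Proof.
move=> hp hq /andP[t0 t1].
have -> : p + t%:C%C * (q - p) = (1 - t)%:C%C * p + t%:C%C * q.
  by rewrite rmorphB rmorph1 /=; ring.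
apply: le_trans (nmD _ _) _; rewrite !nmM !nm_real !ger0_norm ?subr_ge0//.
have h1 : (1 - t) * nm p <= (1 - t) * r by rewrite ler_wpM2l// subr_ge0.
have h2 : t * nm q <= t * r by rewrite ler_wpM2l.
lra.
Qed.

Lemma rt_close (e : R) : 0 < e -> exists n0, forall k, (n0 <= k)%N -> nm ((rt k)^-1 - 1) < e.
Proof.
move=> e0; have e2 : 0 < e ^+ 2 by rewrite exprn_gt0.
have [n0 hn0] := pow2_small 4 e2; exists n0 => k /hn0 h.
have -> : (rt k)^-1 - 1 = - ((rt k - 1) / rt k) by field; exact: rt_neq0.
rewrite nmN nmM nmV rt_nm invr1 mulr1 -(ltr_pXn2r (n := 2)) ?nnegrE ?nm_ge0 ?ltW//.
exact: le_lt_trans (rt_dist k) h.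
Qed.

(** Let g(t) be the mean of P(w + t(z - w)) z / (z - w). Then g(1) is the mean wanted and g(0) is
    P(w) times the mean of the kernel, which tends to 1. In g'(t) the kernel cancels and a Riemann
    sum of h over a closed circle is left, small because P is a primitive of h. *)
Lemma cauchy_C1 (P h : C -> C) (rho r : R) (w : C) : r < rho -> nm w < r ->
  (forall z, nm z < rho -> is_cder P z (h z)) -> (forall z, nm z < rho -> ccont h z) ->
  P w = cm r (fun z => P z * (z / (z - w))).
Proof.
move=> rr wr hP hc; have r0 : 0 < r := le_lt_trans (nm_ge0 _) wr.
symmetry; apply: ulimE => e e0.
have nzw z : nm z = r -> z - w != 0.
  by move=> hz; rewrite -nm_gt0; apply: lt_le_trans (nm_sub _ _); rewrite hz subr_gt0.
(* the average of P over the homothetic circles (1-t) w + t z is almost constant in t *)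
have e1 : 0 < e / 2 / r by rewrite !divr_gt0.
have [d d0 hd] : exists2 d, 0 < d & forall z w, nm z <= r -> nm w <= r ->
    nm (z - w) < d -> nm (h z - h w) < e / 2 / r.
  by apply: cont_unif => // z hz; apply: hc; exact: le_lt_trans hz rr.
have dr : 0 < d / r by rewrite divr_gt0.
have [n1 hn1] := rt_close dr.
have a1 : nm (w / r%:C%C) < 1.
  by rewrite nmM nmV nm_real gtr0_norm// ltr_pdivrMr// mul1r.
(* The bound 1/2 gives |m| <= 2 for the mean [m] of the kernel; the second bound makes |P w| |m|
   |a^N| smaller than e/2. *)
pose e3 : R := Num.min (1 / 2) (e / (4 * (1 + nm (P w)))).
have e30 : 0 < e3.
  by rewrite lt_min; apply/andP; split; [lra|rewrite divr_gt0// mulr_gt0// ltr_pwDl ?nm_ge0].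
have [n2 hn2] := geo_small (nm_ge0 _) a1 e30.
apply: (uset_ge (n0 := maxn n1 n2)) => k; rewrite geq_max => /andP[k1 k2].
set N := (2 ^ k.+1)%N.
have N0 : N%:R != 0 :> C by rewrite pnatr_eq0 -lt0n expn_gt0.
pose pt (j : nat) (t : C) := w + t * (cpt r k j - w).
pose g (t : C) := N%:R^-1 * \sum_(j < N) P (pt j t) * (cpt r k j / (cpt r k j - w)).
have cn j : nm (cpt r k j) = r by rewrite cpt_nm// ltW.
have ptr j (t : R) : 0 <= t <= 1 -> nm (pt j t%:C%C) <= r.
  by move=> ht; apply: convex_nm => //; [exact: ltW|rewrite cn].
pose D (t : C) := N%:R^-1 * \sum_(j < N) h (pt j t) * cpt r k j.
have hg (t : R) : 0 <= t <= 1 -> is_cder g t%:C%C (D t%:C%C).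
  move=> ht; apply: is_cderZ; apply: is_cder_sum => j.
  have h1 : is_cder (fun t => pt j t) t%:C%C (cpt r k j - w).
    have := is_cderD (is_cder_cst w t%:C%C) (is_cderM (is_cder_id t%:C%C) (is_cder_cst (cpt r k j - w) t%:C%C)).
    by rewrite mulr0 addr0 add0r mul1r.
  have h2 := is_cder_comp h1 (hP _ (le_lt_trans (ptr j t ht) rr)).
  have := is_cderM h2 (is_cder_cst (cpt r k j / (cpt r k j - w)) t%:C%C).
  rewrite mulr0 addr0; congr is_cder.
  by field; exact: nzw.
have hD (t : R) : 0 <= t <= 1 -> nm (D t%:C%C) <= e / 2.
  (* t = 0 is apart because the identity [E] below only determines t D(t). There all points [pt j 0]
     equal w, and the sample points sum to 0. *)
  move=> ht; have [->|t0] := eqVneq t 0.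
    rewrite /D rmorph0 /pt; under eq_bigr do rewrite mul0r addr0.
    rewrite -mulr_sumr; have -> : \sum_(i < N) cpt r k i = 0.
      rewrite /cpt -mulr_sumr; under eq_bigr do rewrite exprVn.
      have hw : (rt k)^-1 - 1 != 0.
        by rewrite subr_eq0 invr_eq1 rt_neq1.
      have -> : \sum_(i < N) (rt k ^+ i)^-1 = 0.
        apply: (mulfI hw); rewrite mulr0; under eq_bigr do rewrite -exprVn.
        by rewrite -subrX1 exprVn rt_pow1 invr1 subrr.
      by rewrite mulr0.
    by rewrite !mulr0 nm0; lra.
  have tp : 0 < t by rewrite lt_neqAle eq_sym t0; case/andP: ht.
  have hw : (rt k)^-1 - 1 != 0.
    by rewrite subr_eq0 invr_eq1 rt_neq1.
  have dlt : r * nm ((rt k)^-1 - 1) < d.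
    by have := hn1 k k1; rewrite ltr_pdivlMr// mulrC.
  have step j : nm (P (pt j.+1 t%:C%C) - P (pt j t%:C%C) -
       h (pt j t%:C%C) * (pt j.+1 t%:C%C - pt j t%:C%C)) <=
       e / 2 / r * nm (pt j.+1 t%:C%C - pt j t%:C%C).
    have Ept : pt j.+1 t%:C%C - pt j t%:C%C = t%:C%C * (cpt r k j * ((rt k)^-1 - 1)).
      by rewrite /pt cptS; ring.
    have npt : nm (pt j.+1 t%:C%C - pt j t%:C%C) < d.
      apply: le_lt_trans dlt; rewrite Ept nmM nmM cn nm_real ger0_norm ?(ltW tp)//.
      rewrite -[X in _ <= X]mul1r ler_wpM2r ?mulr_ge0 ?nm_ge0 ?(ltW r0)//.
      by case/andP: ht.
    apply: (@mvt_segment P h) => s hs.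
      by apply: hP; apply: le_lt_trans rr; apply: convex_nm => //; exact: ptr.
    apply: ltW; apply: hd; [by apply: convex_nm => //; exact: ptr|exact: ptr|].
    rewrite addrAC subrr add0r nmM nm_real.
    apply: le_lt_trans npt; rewrite -[X in _ <= X]mul1r ler_wpM2r ?nm_ge0//.
    by case/andP: hs => s0 s1; rewrite ger0_norm.
  have tel : \sum_(j < N) (P (pt j.+1 t%:C%C) - P (pt j t%:C%C)) = 0.
    have := telescope_sumr (fun j => P (pt j t%:C%C)) (leq0n N).
    by rewrite big_mkord => ->; rewrite /pt cpt_per subrr.
  (* From j to j + 1 the point [pt] moves by t (rt^-1 - 1) times [cpt r k j]. Up to this factor [D]
     is a sum of h times chords of a closed polygon; the increments of P telescope to 0, and only
     the errors bounded in [step] remain. *)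
  have E : t%:C%C * ((rt k)^-1 - 1) * (N%:R * D t%:C%C) =
      - \sum_(j < N) (P (pt j.+1 t%:C%C) - P (pt j t%:C%C) -
       h (pt j t%:C%C) * (pt j.+1 t%:C%C - pt j t%:C%C)).
    rewrite sumrB tel sub0r opprK /D mulVKf// mulr_sumr.
    by apply: eq_bigr => j _; rewrite /pt cptS; ring.
  have tw0 : 0 < t * nm ((rt k)^-1 - 1) by rewrite mulr_gt0 ?nm_gt0.
  have NR0 : 0 < N%:R :> R by rewrite ltr0n expn_gt0.
  rewrite -(ler_pM2l NR0) -(ler_pM2l tw0).
  have -> : t * nm ((rt k)^-1 - 1) * (N%:R * nm (D t%:C%C)) =
      nm (t%:C%C * ((rt k)^-1 - 1) * (N%:R * D t%:C%C)).
    by rewrite !nmM nm_nat nm_real (gtr0_norm tp).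
  rewrite E nmN; apply: le_trans (nm_sum _ _ _) _.
  apply: (@le_trans _ _ (\sum_(j < N) (t * nm ((rt k)^-1 - 1) * (e / 2)))).
    apply: ler_sum => j _; apply: le_trans (step j) _.
    have -> : pt j.+1 t%:C%C - pt j t%:C%C = t%:C%C * (cpt r k j * ((rt k)^-1 - 1)).
      by rewrite /pt cptS; ring.
    rewrite nmM nmM cn nm_real (gtr0_norm tp) le_eqVlt; apply/orP; left; apply/eqP.
    by field; exact: lt0r_neq0.
  by rewrite sumr_const card_ord -[_ *+ N]mulr_natl mulrCA.
have g1 : nm (g 1 - g 0) <= e / 2.
  have -> : g 1 - g 0 = (fun t : R => g t%:C%C) 1 - (fun t : R => g t%:C%C) 0.
    by rewrite rmorph1 rmorph0.
  apply: (@mvt_loc (fun t : R => g t%:C%C)); first lra.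
  move=> t ht e' e'0; have /is_cderP/(_ e' e'0) [s s0 hs] := hg t ht.
  exists s => // u hu; have := hs u%:C%C; rewrite -rmorphB nm_real => /(_ hu) h1.
  have -> : g u%:C%C - g t%:C%C = (g u%:C%C - g t%:C%C - D t%:C%C * (u - t)%:C%C) + D t%:C%C * (u - t)%:C%C.
    by ring.
  apply: le_trans (nmD _ _) _; rewrite nmM nm_real.
  have h2 : nm (D t%:C%C) * `|u - t| <= e / 2 * `|u - t| by rewrite ler_wpM2r ?hD.
  by apply: le_trans (lerD h1 h2) _; rewrite mulrDl addrC.
have Eg1 : g 1 = mean r k (fun z => P z * (z / (z - w))).
  rewrite /g /mean; congr (_ * _); apply: eq_bigr => j _; congr (P _ * _).
  by rewrite /pt mul1r; ring.
have Eg0 : g 0 = P w * mean r k (fun z => z / (z - w)).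
  rewrite /g /mean [RHS]mulrCA [X in _ = _ * X]mulr_sumr; congr (_ * _); apply: eq_bigr => j _; congr (P _ * _).
  by rewrite /pt mul0r addr0.
have mk := mean_kernel k wr; set a := w / r%:C%C in a1 hn2 mk.
set m := mean r k _ in Eg0 mk.
have aN : nm (a ^+ N) < e3.
  by rewrite nmX; apply: hn2; apply: leq_trans k2 _; apply: ltnW; apply: leq_trans (ltn_expl k.+1 (isT : 1 < 2)%N).
have aN2 : nm (a ^+ N) < 1 / 2 by apply: lt_le_trans aN _; rewrite ge_min lexx.
have aN3 : nm (a ^+ N) < e / (4 * (1 + nm (P w))) by apply: lt_le_trans aN _; rewrite ge_min lexx orbT.
have mB : nm m <= 2.
  have := nm_sub 1 (a ^+ N); rewrite nm1 => h1.
  have : nm m * nm (1 - a ^+ N) = 1 by rewrite -nmM mk nm1.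
  have := nm_ge0 m; move: (nm m) (nm (1 - a ^+ N)) h1 => x y h1 x0 xy.
  by rewrite leNgt; apply/negP => hx; nra.
have Em : m - 1 = m * a ^+ N by rewrite -[X in m - X]mk; ring.
rewrite -Eg1; have -> : g 1 - P w = (g 1 - g 0) + P w * (m - 1) by rewrite Eg0; ring.
apply: le_lt_trans (nmD _ _) _; rewrite Em nmM [nm (m * _)]nmM.
have Pw0 := nm_ge0 (P w).
have h1 : nm (P w) * (nm m * nm (a ^+ N)) < e / 2.
  have K0 : 0 < 1 + nm (P w) by rewrite ltr_pwDl.
  have q0 : 0 < e / (4 * (1 + nm (P w))) by rewrite divr_gt0// mulr_gt0.
  apply: (@le_lt_trans _ _ (nm (P w) * (2 * (e / (4 * (1 + nm (P w))))))).
    rewrite ler_wpM2l// ler_pM ?nm_ge0//; exact: ltW.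
  have -> : nm (P w) * (2 * (e / (4 * (1 + nm (P w))))) = nm (P w) * (e / 2) / (1 + nm (P w)).
    by field; exact: lt0r_neq0.
  rewrite ltr_pdivrMr//; nra.
lra.
Qed.

End CauchyFormula.

(** * Cauchy estimates, maximum principle, identity theorem *)

Section CauchyConsequences.
Variable R : realType.
Local Notation C := R[i].
Implicit Types (h k : C -> C) (z w a : C).

(** To be read with u = 1/(z - w), v = 1/(z - w') and t = w' - w: the remainder of (z - w)^(-m)
    after its linear term is O(t^2) uniformly in z on a circle, as differentiation under the mean
    requires. *)
Lemma kernel_taylor (K : R) (m : nat) : 0 <= K -> exists2 D : R, 0 <= D &
  forall u v t : C, nm u <= K -> nm v <= K -> v - u = t * u * v ->
    nm (v ^+ m - u ^+ m - m%:R * t * u ^+ m.+1) <= D * nm t ^+ 2.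
Proof.
move=> K0; elim: m => [|m [D D0 hD]].
  by exists 0 => // u v t _ _ _; rewrite !expr0 !mul0r subrr subr0 nm0.
exists (K * D + m.+1%:R * K ^+ m.+3).
  by apply: addr_ge0; apply: mulr_ge0; rewrite ?exprn_ge0 ?ler0n.
move=> u v t hu hv E.
have -> : v ^+ m.+1 - u ^+ m.+1 - m.+1%:R * t * u ^+ m.+2 =
    v * (v ^+ m - u ^+ m - m%:R * t * u ^+ m.+1) + m.+1%:R * t * u ^+ m.+1 * (v - u) +
    ((v - u) - t * u * v) * u ^+ m.
  by rewrite -natr1 !exprS; ring.
rewrite E subrr mul0r addr0; apply: le_trans (nmD _ _) _; rewrite mulrDl; apply: lerD.
  by rewrite nmM -[K * D * _]mulrA; exact: (ler_pM (nm_ge0 _) (nm_ge0 _) hv (hD _ _ _ hu hv E)).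
have -> : m.+1%:R * t * u ^+ m.+1 * (t * u * v) = m.+1%:R * (u ^+ m.+2 * v) * t ^+ 2.
  by rewrite !exprS expr0; ring.
rewrite nmM nmX ler_wpM2r ?exprn_ge0 ?nm_ge0// nmM nm_nat ler_wpM2l ?ler0n//.
by rewrite nmM nmX [K ^+ _]exprSr ler_pM ?exprn_ge0 ?nm_ge0// lerXn2r ?nnegrE ?nm_ge0.
Qed.

Definition ctr (r : R) (m : nat) psi w : C := cm r (fun z => psi z * (z - w)^-1 ^+ m).

Lemma is_cder_ctr (r : R) m psi w : cbd r psi -> nm w < r ->
  is_cder (ctr r m psi) w (m%:R * ctr r m.+1 psi w).
Proof.
move=> hpsi wr; have r0 : 0 < r := le_lt_trans (nm_ge0 _) wr.
have r0' := ltW r0.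
set s := (r - nm w) / 2; have s0 : 0 < s by rewrite divr_gt0// subr_gt0.
have [B hB] := hpsi.
have B0 : 0 <= B by apply: le_trans (nm_ge0 _) (hB (cpt r 0 0) _); rewrite cpt_nm.
have K0 : 0 <= s^-1 by rewrite invr_ge0 ltW.
have [D D0 hD] := kernel_taylor m K0.
apply/is_cderP => e e0.
have BD : 0 < B * D + 1 by rewrite ltr_wpDl// mulr_ge0.
exists (Num.min s (e / (B * D + 1))); first by rewrite lt_min s0 divr_gt0.
move=> w'; rewrite lt_min => /andP[h1 h2].
have w'r : nm w' < r - s.
  have -> : w' = w + (w' - w) by ring.
  apply: le_lt_trans (nmD _ _) _; rewrite /s in h1 *; lra.
have w'r' : nm w' < r by lra.
have bk x n : nm x < r -> cbd r (fun z => psi z * (z - x)^-1 ^+ n).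
  by move=> hx; apply: cbdM => //; apply: cbdX; exact: cbd_kernel.
rewrite /ctr -cmZ//; last exact: bk.
have bZ : cbd r (fun z => m%:R * (psi z * (z - w)^-1 ^+ m.+1)).
  by apply: cbdM; [exists (nm (m%:R : C))|exact: bk].
rewrite -cmB; [|exact: r0'|exact: bk|exact: bk].
rewrite mulrC -cmZ//.
have E : forall z, nm z = r -> (psi z * (z - w')^-1 ^+ m - psi z * (z - w)^-1 ^+ m) -
     (w' - w) * (m%:R * (psi z * (z - w)^-1 ^+ m.+1)) =
   psi z * ((z - w')^-1 ^+ m - (z - w)^-1 ^+ m - m%:R * (w' - w) * (z - w)^-1 ^+ m.+1).
  by move=> z _; ring.
rewrite -cmB; last first.
- by apply: cbdM => //; exists (nm (w' - w)).
- have [B1 hB1] := bk _ m w'r'; have [B2 hB2] := bk _ m wr.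
  by exists (B1 + B2) => z hz; apply: le_trans (nmB _ _) _; rewrite lerD ?hB1 ?hB2.
- exact: r0'.
rewrite (cm_ext r0' E); apply: (@le_trans _ _ (B * (D * nm (w' - w) ^+ 2))).
  apply: cm_le => // z hz; rewrite nmM ler_pM ?nm_ge0 ?hB//.
  have zw : s <= nm (z - w).
    by have := nm_sub z w; rewrite hz /s; have := nm_ge0 w; lra.
  have zw' : s <= nm (z - w').
    by have := nm_sub z w'; rewrite hz; lra.
  have n0 x : s <= nm x -> x != 0 by move=> hx; rewrite -nm_gt0; exact: lt_le_trans hx.
  apply: hD.
  - by rewrite nmV lef_pV2 ?posrE// (lt_le_trans s0).
  - by rewrite nmV lef_pV2 ?posrE// (lt_le_trans s0).
  - by have := n0 _ zw; have := n0 _ zw' => ? ?; field; apply/andP.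
rewrite mulrA expr2 mulrA ler_wpM2r ?nm_ge0//.
rewrite ltr_pdivlMr// in h2.
have := nm_ge0 (w' - w); nra.
Qed.

(** A primitive P of h has the continuous derivative h, so [cauchy_C1] exhibits P as a Cauchy
    transform. Then h = P' and h' are Cauchy transforms as well, h' is continuous, and [cauchy_C1]
    applies to h itself. *)
Lemma hol0_cauchy (rho r : R) h w : hol 0 rho h -> r < rho -> nm w < r ->
  h w = cm r (fun z => h z * (z / (z - w))).
Proof.
move=> hh rr wr.
suff hc z : nm z < rho -> ccont (cder h) z.
  apply: (@cauchy_C1 R h (cder h) rho) => // z hz.
  by apply: hol_cder hh _; rewrite subr0.
move=> hz; pose r3 := (nm z + rho) / 2; have zr3 : nm z < r3 by rewrite /r3; lra.
have r3r : r3 < rho by rewrite /r3; lra.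
pose r4 := (r3 + rho) / 2; have r34 : r3 < r4 by rewrite /r4; lra.
have [P hP] := primitive hh (r := r4) ltac:(rewrite /r4; lra).
have hcont x : nm x < r4 -> ccont h x.
  by move=> hx; apply: hol_cont hh _; rewrite subr0 /r4 in hx *; lra.
have r30 : 0 < r3 := le_lt_trans (nm_ge0 _) zr3.
have bP : cbd r3 (fun z => P z * z).
  apply: cbdM (cbd_id _); have [M hM] : exists M, forall x, nm x <= r3 -> nm (P x) <= M.
    apply: cont_bounded => x hx; apply: is_cder_cont; apply: hP; lra.
  by exists M => x hx; apply: hM; rewrite hx.
have E1 x : nm (x - 0) < r3 -> P x = ctr r3 1 (fun z => P z * z) x.
  rewrite subr0 => hx; rewrite (cauchy_C1 r34 hx hP hcont).
  by apply: cm_ext; [exact: ltW|move=> y _; rewrite expr1 mulrA].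
have E2 x : nm (x - 0) < r3 -> h x = ctr r3 2 (fun z => P z * z) x.
  move=> hx; have hx' := hx; rewrite subr0 in hx'.
  have d1 := is_cder_ctr 1 bP hx'; rewrite mul1r in d1.
  have [s s0 hs] := disc_open hx.
  have d2 : is_cder P x (ctr r3 2 (fun z => P z * z) x).
    by apply: is_cder_near s0 _ d1 => y /hs /E1.
  by apply: is_cder_unique d2; apply: hP; lra.
have E3 x : nm (x - 0) < r3 -> cder h x = 2%:R * ctr r3 3 (fun z => P z * z) x.
  move=> hx; have hx' := hx; rewrite subr0 in hx'.
  apply: cderE; have [s s0 hs] := disc_open hx.
  by apply: is_cder_near s0 _ (is_cder_ctr 2 bP hx') => y /hs /E2.
have hz3 : nm (z - 0) < r3 by rewrite subr0.
have [s s0 hs] := disc_open hz3.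
apply: (@is_cder_cont _ _ _ (2%:R * (3%:R * ctr r3 4 (fun z => P z * z) z))).
have d3 := is_cderZ 2%:R (is_cder_ctr 3 bP zr3).
by apply: is_cder_near s0 _ d3 => y /hs /E3.
Qed.

Lemma hol_bounded_circle (rho r : R) h : hol 0 rho h -> r < rho -> cbd r h.
Proof.
move=> hh rr; have [M hM] : exists M, forall x, nm x <= r -> nm (h x) <= M.
  apply: cont_bounded => x hx; apply: hol_cont hh _; rewrite subr0; lra.
by exists M => x hx; apply: hM; rewrite hx.
Qed.

Lemma hol0_ctr (rho r : R) h w : hol 0 rho h -> r < rho -> nm w < r ->
  h w = ctr r 1 (fun z => h z * z) w.
Proof.
move=> hh rr wr; rewrite (hol0_cauchy hh rr wr).
apply: cm_ext; first by apply: ltW; exact: le_lt_trans (nm_ge0 _) wr.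
by move=> y _; rewrite expr1 mulrA.
Qed.

Lemma cder0_ctr (rho r : R) h w : hol 0 rho h -> r < rho -> nm w < r ->
  cder h w = ctr r 2 (fun z => h z * z) w.
Proof.
move=> hh rr wr; have wr' : nm (w - 0) < r by rewrite subr0.
have bh : cbd r (fun z => h z * z) by apply: cbdM (cbd_id _); exact: hol_bounded_circle hh rr.
apply: cderE; have [s s0 hs] := disc_open wr'.
have := is_cder_ctr 1 bh wr; rewrite mul1r; apply: is_cder_near s0 _ => y /hs.
by rewrite subr0 => hy; rewrite -(hol0_ctr hh rr).
Qed.

Lemma hol0_der (rho : R) h : hol 0 rho h -> hol 0 rho (cder h).
Proof.
move=> hh z; rewrite subr0 => hz; pose r := (nm z + rho) / 2.
have zr : nm z < r by rewrite /r; lra.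
have rr : r < rho by rewrite /r; lra.
have bh : cbd r (fun z => h z * z) by apply: cbdM (cbd_id _); exact: hol_bounded_circle hh rr.
exists (2%:R * ctr r 3 (fun z => h z * z) z).
have zr' : nm (z - 0) < r by rewrite subr0.
have [s s0 hs] := disc_open zr'.
apply: is_cder_near s0 _ (is_cder_ctr 2 bh zr) => y /hs.
by rewrite subr0 => hy; rewrite -(cder0_ctr hh rr).
Qed.

(** Inside a circle the divided difference, with its value at a included, is the Cauchy transform of
    h(z) z / (z - a); hence it is holomorphic at a too. *)
Lemma hol0_div (rho : R) h a : hol 0 rho h -> nm a < rho ->
  hol 0 rho (fun z => if z == a then cder h a else (h z - h a) / (z - a)).
Proof.
move=> hh ha; set k := fun z => _.
move=> z; rewrite subr0 => hz; pose r := (Num.max (nm z) (nm a) + rho) / 2.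
have hm : Num.max (nm z) (nm a) < rho by rewrite gt_max hz ha.
have hzm : nm z <= Num.max (nm z) (nm a) by rewrite le_max lexx.
have ham : nm a <= Num.max (nm z) (nm a) by rewrite le_max lexx orbT.
have zr : nm z < r by rewrite /r; lra.
have ar : nm a < r by rewrite /r; lra.
have rr : r < rho by rewrite /r; lra.
have r0 : 0 <= r := ltW (le_lt_trans (nm_ge0 _) ar).
have bh : cbd r (fun z => h z * z) by apply: cbdM (cbd_id _); exact: hol_bounded_circle hh rr.
have bha : cbd r (fun z => h z * z * (z - a)^-1) by apply: cbdM => //; exact: cbd_kernel.
have n0 x y : nm x = r -> nm y < r -> x - y != 0.
  by move=> hx hy; rewrite -nm_gt0; apply: lt_le_trans (nm_sub _ _); rewrite hx subr_gt0.
have E w : nm w < r -> ctr r 1 (fun z => h z * z * (z - a)^-1) w = k w.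
  move=> wr; rewrite /k; case: eqVneq => [->|wa].
    rewrite (cder0_ctr hh rr ar); apply: cm_ext => // y _.
    by rewrite expr1 expr2 mulrA.
  have wa0 : w - a != 0 by rewrite subr_eq0.
  rewrite (hol0_ctr hh rr ar) (hol0_ctr hh rr wr) /ctr -cmB; last first.
  - by apply: cbdM => //; apply: cbdX; exact: cbd_kernel.
  - by apply: cbdM => //; apply: cbdX; exact: cbd_kernel.
  - exact: r0.
  rewrite mulrC -cmZ//; last first.
    have [B1 hB1] := cbdM bh (cbdX 1 (cbd_kernel wr)).
    have [B2 hB2] := cbdM bh (cbdX 1 (cbd_kernel ar)).
    by exists (B1 + B2) => y hy; apply: le_trans (nmB _ _) _; rewrite lerD ?hB1 ?hB2.
  apply: cm_ext => // y hy; have h1 := n0 _ _ hy wr; have h2 := n0 _ _ hy ar.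
  by rewrite !expr1; field; rewrite wa0 h1 h2.
have zr' : nm (z - 0) < r by rewrite subr0.
have [s s0 hs] := disc_open zr'.
eexists; apply: is_cder_near s0 _ (is_cder_ctr 1 bha zr) => y /hs.
by rewrite subr0; exact: E.
Qed.

Lemma cauchy0_est (rho r B : R) h : hol 0 rho h -> 0 < r -> r < rho ->
  (forall z, nm z = r -> nm (h z) <= B) -> nm (cder h 0) <= B / r.
Proof.
move=> hh r0 rr hB; rewrite (cder0_ctr hh rr) ?nm0//.
apply: cm_le; first exact: ltW.
move=> z hz; have z0 : z != 0 by rewrite -nm_gt0 hz.
have -> : h z * z * (z - 0)^-1 ^+ 2 = h z / z by rewrite subr0; field.
by rewrite nmM nmV hz ler_wpM2r ?invr_ge0 ?(ltW r0)// hB.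
Qed.

(** Cauchy's formula for h^n gives |h(w)|^n <= B^n r / (r - |w|); since n is arbitrary, the last
    factor cannot compensate |h(w)| > B. *)
Lemma maxmod0 (rho r B : R) h : hol 0 rho h -> r < rho ->
  (forall z, nm z = r -> nm (h z) <= B) -> forall w, nm w <= r -> nm (h w) <= B.
Proof.
move=> hh rr hB w; rewrite le_eqVlt => /orP[/eqP|wr]; first exact: hB.
have r0 : 0 < r := le_lt_trans (nm_ge0 _) wr.
have B0 : 0 <= B by apply: le_trans (nm_ge0 _) (hB (cpt r 0 0) _); rewrite cpt_nm// ltW.
have key n : nm (h w) ^+ n <= B ^+ n * (r / (r - nm w)).
  have hn : hol 0 rho (fun z => h z ^+ n) by apply: holX.
  rewrite -nmX (hol0_cauchy hn rr wr); apply: cm_le; first exact: ltW.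
  move=> z hz; rewrite nmM nmX.
  apply: ler_pM; rewrite ?exprn_ge0 ?nm_ge0//; first by rewrite lerXn2r ?nnegrE ?nm_ge0 ?hB.
  rewrite nmM nmV hz ler_wpM2l ?(ltW r0)// lef_pV2 ?posrE ?subr_gt0//.
    by rewrite -hz nm_sub.
  by apply: lt_le_trans (nm_sub _ _); rewrite hz subr_gt0.
rewrite leNgt; apply/negP => hlt.
have hw0 : 0 < nm (h w) := le_lt_trans B0 hlt.
have q0 : 0 <= B / nm (h w) by rewrite divr_ge0// nm_ge0.
have q1 : B / nm (h w) < 1 by rewrite ltr_pdivrMr// mul1r.
have c0 : 0 < r / (r - nm w) by rewrite divr_gt0// subr_gt0.
have e0 : 0 < (r / (r - nm w))^-1 by rewrite invr_gt0.
have [n hn] := geo_small q0 q1 e0.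
have := hn n (leqnn _); have := key n.
rewrite expr_div_n ltr_pdivrMr ?exprn_gt0// => h1 h2.
have : B ^+ n * (r / (r - nm w)) < nm (h w) ^+ n by rewrite -ltr_pdivlMr// mulrC.
by rewrite ltNge h1.
Qed.

Lemma hol_to0 a r h : hol a r h -> hol 0 r (fun z => h (z + a)).
Proof. by move=> hh; have := hol_shift (b := a) hh; rewrite subrr. Qed.

Lemma hol_from0 a r h : hol 0 r (fun z => h (z + a)) -> hol a r h.
Proof.
move=> hh; have := hol_shift (b := - a) hh; rewrite sub0r opprK.
by apply: hol_ext => z _; rewrite subrK.
Qed.

Lemma hol_der a r h : hol a r h -> hol a r (cder h).
Proof.
move=> hh; apply: hol_from0; apply: hol_ext (hol0_der (hol_to0 hh)) => z.
by rewrite subr0 => hz; rewrite (cder_shift hh)// addrK.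
Qed.

Lemma cauchy_est a (rho r B : R) h : hol a rho h -> 0 < r -> r < rho ->
  (forall z, nm (z - a) = r -> nm (h z) <= B) -> nm (cder h a) <= B / r.
Proof.
move=> hh r0 rr hB; have := @cauchy0_est rho r B _ (hol_to0 hh) r0 rr.
rewrite (cder_shift hh) ?add0r ?subrr ?nm0 ?(lt_trans r0)//; apply.
by move=> z hz; apply: hB; rewrite addrK.
Qed.

Lemma maxmod a (rho r B : R) h : hol a rho h -> r < rho ->
  (forall z, nm (z - a) = r -> nm (h z) <= B) -> forall w, nm (w - a) <= r -> nm (h w) <= B.
Proof.
move=> hh rr hB w hw; have := @maxmod0 rho r B _ (hol_to0 hh) rr _ (w - a) hw.
by rewrite subrK; apply => z hz; apply: hB; rewrite addrK.
Qed.

Lemma hol_div c rho h a : hol c rho h -> nm (a - c) < rho -> h a = 0 ->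
  exists2 k, hol c rho k & forall z, h z = (z - a) * k z.
Proof.
move=> hh ha h0; exists (fun z => if z == a then cder h a else (h z - h a) / (z - a)).
  apply: hol_from0; apply: hol_ext (hol0_div (hol_to0 hh) ha) => z.
  rewrite subr0 => hz; rewrite (cder_shift hh) ?subrK// -subr_eq opprK.
  by case: eqP => // _; congr (_ / _); ring.
move=> z; case: eqVneq => [->|za]; first by rewrite h0 subrr mul0r.
by rewrite h0 subr0 mulrC divfK// subr_eq0.
Qed.

Lemma hol_bounded a rho r h : hol a rho h -> r < rho ->
  exists M, forall z, nm (z - a) <= r -> nm (h z) <= M.
Proof.
move=> hh rr; have [M hM] : exists M, forall z, nm z <= r -> nm (h (z + a)) <= M.
  apply: (@cont_bounded R (fun z => h (z + a))) => z hz.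
  by apply: hol_cont (hol_to0 hh) _; rewrite subr0; exact: le_lt_trans rr.
by exists M => z /hM; rewrite subrK.
Qed.

(* a zero of infinite order forces h = 0, by the maximum principle *)
Lemma hol_order a rho h : 0 < rho -> hol a rho h ->
  (forall z, nm (z - a) < rho -> h z = 0) \/
  exists m k, [/\ hol a rho k, k a != 0 & forall z, h z = (z - a) ^+ m * k z].
Proof.
move=> rho0 hh; have aa : nm (a - a) < rho by rewrite subrr nm0.
have [[m [k hk]]|hn] := pselect (exists m k, [/\ hol a rho k, k a != 0 & forall z, h z = (z - a) ^+ m * k z]).
  by right; exists m, k.
left => w hw.
have it m : exists2 k, hol a rho k & forall z, h z = (z - a) ^+ m * k z.
  elim: m => [|m [k hk Ek]]; first by exists h => // z; rewrite expr0 mul1r.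
  have k0 : k a = 0 by apply: contrapT => k0; apply: hn; exists m, k; split => //; apply/eqP.
  have [k' hk' Ek'] := hol_div hk aa k0; exists k' => // z.
  by rewrite Ek Ek' exprSr mulrA.
apply: small_eq0 => e e0.
pose r := (nm (w - a) + rho) / 2; have wr : nm (w - a) < r by rewrite /r; lra.
have rr : r < rho by rewrite /r; lra.
have r0 : 0 < r := le_lt_trans (nm_ge0 _) wr.
have [M hM] := hol_bounded hh rr.
have M0 : 0 <= M by apply: le_trans (nm_ge0 _) (hM a _); rewrite subrr nm0 ltW.
have q0 : 0 <= nm (w - a) / r by rewrite divr_ge0 ?nm_ge0// ltW.
have q1 : nm (w - a) / r < 1 by rewrite ltr_pdivrMr// mul1r.
have e1 : 0 < e / (M + 1) by rewrite divr_gt0// ltr_wpDl.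
have [m hm] := geo_small q0 q1 e1.
have [k hk Ek] := it m.
have kb : nm (k w) <= M / r ^+ m.
  apply: (maxmod hk rr) (ltW wr) => z hz.
  rewrite ler_pdivlMr ?exprn_gt0//; have := hM z; rewrite hz lexx Ek nmM nmX hz mulrC.
  by apply.
rewrite Ek nmM nmX; have := hm m (leqnn _); rewrite expr_div_n => h1.
apply: (@le_trans _ _ (nm (w - a) ^+ m * (M / r ^+ m))).
  by rewrite ler_wpM2l ?exprn_ge0 ?nm_ge0.
rewrite mulrCA; apply: (@le_trans _ _ (M * (e / (M + 1)))); first by rewrite ler_wpM2l// ltW.
by rewrite mulrA ler_pdivrMr ?ltr_wpDl//; nra.
Qed.

Lemma hol_isolated a rho h : 0 < rho -> hol a rho h ->
  (exists2 d, 0 < d & forall z, nm (z - a) < d -> h z = 0) \/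
  (exists2 d, 0 < d & forall z, nm (z - a) < d -> z != a -> h z != 0).
Proof.
move=> rho0 hh; have [h0|[m [k [hk ka Ek]]]] := hol_order rho0 hh.
  by left; exists rho.
right; have aa : nm (a - a) < rho by rewrite subrr nm0.
have n0 : 0 < nm (k a) by rewrite nm_gt0.
have [d d0 hd] := hol_cont hk aa n0; exists d => // z hz za.
rewrite Ek mulf_neq0 ?expf_neq0 ?subr_eq0//.
by apply/negP => /eqP kz; have := hd z hz; rewrite kz sub0r nmN ltxx.
Qed.

End CauchyConsequences.

(** * Blaschke factors and logarithmic derivatives *)

Section GrowthTools.
Variable R : realType.
Local Notation C := R[i].
Implicit Types (h k u v : C -> C) (z w a : C).

Lemma blaschke_circle (r : R) a z : nm z = r ->
  nm ((r ^+ 2)%:C%C - conjc a * z) = r * nm (z - a).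
Proof.
move=> hz; have -> : (r ^+ 2)%:C%C = z * conjc z by rewrite mul_conj hz.
have -> : z * conjc z - conjc a * z = z * conjc (z - a) by rewrite rmorphB /=; ring.
by rewrite nmM nm_conj hz.
Qed.

Lemma blaschke_den (r1 r2 : R) a z : nm a < r2 -> r2 < r1 -> nm z <= r1 ->
  r1 * (r1 - r2) <= nm ((r1 ^+ 2)%:C%C - conjc a * z).
Proof.
move=> ha hr hz; have := nm_sub ((r1 ^+ 2)%:C%C) (conjc a * z).
rewrite nmM nm_conj nm_real ger0_norm ?sqr_ge0// => h.
apply: le_trans h; have := nm_ge0 a; have := nm_ge0 z; nra.
Qed.

Lemma hol_poly1 c rho a : hol c rho (fun z => z - a).
Proof. by apply: holB; [exact: hol_id|exact: hol_cst]. Qed.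

Lemma hol_bden c rho (r : R) a : hol c rho (fun z => (r ^+ 2)%:C%C - conjc a * z).
Proof.
by apply: holB; [exact: hol_cst|apply: holM; [exact: hol_cst|exact: hol_id]].
Qed.

(** Numerator of the finite Blaschke product of the disc of radius r with zeros s; [bden] is its
    denominator. Keeping them apart lets the factorisations hold at every z, without a condition on
    poles. *)
Definition bnum (r : R) (s : seq C) z : C := \prod_(a <- s) (r%:C%C * (z - a)).
Definition bden (r : R) (s : seq C) z : C := \prod_(a <- s) ((r ^+ 2)%:C%C - conjc a * z).

(* each division by a Blaschke factor keeps the bound on the circle and multiplies the
   value at 0 by at least r1 / r2, so it can only be repeated finitely often *)
Lemma blaschke_factor (I : Type) (i0 : I) (h : I -> C -> C) (rho r1 r2 B : R) :
  0 < r2 -> r2 < r1 -> r1 < rho -> (forall i, hol 0 rho (h i)) ->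
  (forall i z, nm z = r1 -> nm (h i z) <= B) -> h i0 0 != 0 ->
  exists (s : seq C) (v : I -> C -> C),
  [/\ forall i, hol 0 rho (v i),
      forall a, a \in s -> nm a < r2 /\ a != 0,
      forall i z, h i z * bden r1 s z = v i z * bnum r1 s z,
      forall i z, nm z = r1 -> nm (v i z) <= B &
      nm (h i0 0) <= nm (v i0 0) * (r2 / r1) ^+ size s /\
      forall z, nm z < r2 -> exists i, v i z != 0].
Proof.
move=> r20 r21 r1r hh hB h0.
have r10 : 0 < r1 := lt_trans r20 r21.
have q0 : 0 <= r2 / r1 by rewrite divr_ge0 ?ltW.
have q1 : r2 / r1 < 1 by rewrite ltr_pdivrMr// mul1r.
have mm (k : C -> C) : hol 0 rho k -> (forall z, nm z = r1 -> nm (k z) <= B) -> nm (k 0) <= B.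
  by move=> hk kB; apply: (maxmod0 hk r1r kB); rewrite nm0 ltW.
have B0 : 0 < B by apply: lt_le_trans (mm _ (hh i0) (hB i0)); rewrite nm_gt0.
have [n hn] : exists n, B * (r2 / r1) ^+ n < nm (h i0 0).
  have e0 : 0 < nm (h i0 0) / B by rewrite divr_gt0// nm_gt0.
  have [n hn] := geo_small q0 q1 e0; exists n.
  by rewrite mulrC -ltr_pdivlMr// hn.
elim: n h hh hB h0 hn => [|n IH] h hh hB h0 hn.
  by move: hn; rewrite expr0 mulr1 => /lt_le_trans/(_ (mm _ (hh i0) (hB i0))); rewrite ltxx.
(* Only common zeros of the family are divided out: [zero_list] uses one function, [clean_rep] all
   coordinates of a representation. *)
have [[a [ar ha]]|hno] := pselect (exists a, nm a < r2 /\ forall i, h i a = 0); last first.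
  exists [::], h; split => //.
    by move=> i z; rewrite /bden /bnum !big_nil.
  split; first by rewrite expr0 mulr1.
  move=> z hz; apply: contrapT => hi; apply: hno; exists z; split => // i.
  by apply: contrapT => hiz; apply: hi; exists i; apply/eqP.
have a0 : a != 0 by apply/eqP => E; move: h0; rewrite -E ha E eqxx.
have ar' : nm (a - 0) < rho by rewrite subr0; lra.
have ex i : exists k, hol 0 rho k /\ forall z, h i z = (z - a) * k z.
  by have [k hk Ek] := hol_div (hh i) ar' (ha i); exists k.
have [k hk] := choice ex.
have rc0 : r1%:C%C != 0 :> C by rewrite -nm_gt0 nm_real gtr0_norm.
pose v i z := k i z * (((r1 ^+ 2)%:C%C - conjc a * z) / r1%:C%C).
have hv i : hol 0 rho (v i).
  apply: holM; first by case: (hk i).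
  by apply: holM; [exact: hol_bden|exact: hol_cst].
have vB i z : nm z = r1 -> nm (v i z) <= B.
  move=> hz; have := hB i z hz; rewrite (hk i).2 !nmM blaschke_circle// nmV nm_real gtr0_norm//.
  by rewrite [r1 * _]mulrC mulfK ?lt0r_neq0// mulrC.
have v0 : nm (v i0 0) * (nm a / r1) = nm (h i0 0).
  rewrite (hk i0).2 /v !nmM mulr0 subr0 nmV !nm_real ger0_norm ?sqr_ge0// gtr0_norm// sub0r nmN.
  by field; exact: lt0r_neq0.
have ar1 : nm a / r1 <= r2 / r1 by rewrite ler_pM2r ?invr_gt0// ltW.
have na0 : 0 < nm a / r1 by rewrite divr_gt0// nm_gt0.
have v00 : v i0 0 != 0.
  by apply: contra h0 => /eqP E; rewrite -nm_eq0 -v0 E nm0 mul0r.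
have vn : B * (r2 / r1) ^+ n < nm (v i0 0).
  have h1 : B * (r2 / r1) ^+ n.+1 < nm (v i0 0) * (r2 / r1).
    by apply: lt_le_trans hn _; rewrite -v0 ler_wpM2l ?nm_ge0.
  by move: h1; rewrite exprSr mulrA ltr_pM2r// divr_gt0.
have [s [v' [c1 c2 c3 c4 [c5 c6]]]] := IH v hv vB v00 vn.
exists (a :: s), v'; split => //.
- move=> b; rewrite inE => /orP[/eqP ->|]; [by split|exact: c2].
- move=> i z; rewrite /bden /bnum !big_cons -/(bden r1 s z) -/(bnum r1 s z).
  have E : h i z * ((r1 ^+ 2)%:C%C - conjc a * z) = (r1%:C%C * (z - a)) * v i z.
    by rewrite (hk i).2 /v; field.
  rewrite mulrA E -mulrA c3; ring.
- split => //; rewrite -v0 exprSr; apply: le_trans (ler_wpM2r (ltW na0) c5) _.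
  by rewrite -mulrA ler_wpM2l ?nm_ge0// ler_wpM2l ?exprn_ge0.
Qed.

Lemma ln1_bound (x : R) : `|x| <= 1 / 2 -> `|ln (1 + x) - x| <= 2 * x ^+ 2.
Proof.
rewrite ler_norml => /andP[h1 h2].
have p : 0 < 1 + x by lra.
have up (y : R) : 0 < 1 + y -> ln (1 + y) <= y.
  move=> hy; rewrite -[X in _ <= X]expRK ler_ln ?posrE ?expR_gt0//; exact: expR_ge1Dx.
have lo : x / (1 + x) <= ln (1 + x).
  have q : 0 < 1 + (- x / (1 + x)).
    by rewrite (_ : 1 + _ = (1 + x)^-1) ?invr_gt0//; field; rewrite gt_eqF.
  have := up _ q; rewrite (_ : 1 + - x / (1 + x) = (1 + x)^-1); last by field; rewrite gt_eqF.
  rewrite lnV ?posrE// mulNr; lra.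
have hx : x - x / (1 + x) <= 2 * x ^+ 2.
  rewrite (_ : x - x / (1 + x) = x ^+ 2 / (1 + x)); last by field; rewrite gt_eqF.
  rewrite ler_pdivrMr//; have := sqr_ge0 x; nra.
have := up _ p; have := sqr_ge0 x; rewrite ler_norml => ? ?; apply/andP; split; lra.
Qed.

Lemma ln_nm_bound (y : C) : nm y <= 1 / 8 -> `|ln (nm (1 + y)) - complex.Re y| <= 10 * nm y ^+ 2.
Proof.
move=> hy; set x := 2 * complex.Re y + nm y ^+ 2.
have E : nm (1 + y) ^+ 2 = 1 + x.
  rewrite /x !nm_sqr; case: y {hy x} => a b /=; ring.
have hr := Re_le_nm y; have y0 := nm_ge0 y.
have x1 : `|x| <= 3 * nm y.
  move: hr; rewrite /x !ler_norml => /andP[r1 r2]; apply/andP; split; nra.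
have x2 : `|x| <= 1 / 2 by lra.
have h := ln1_bound x2.
have p : 0 < nm (1 + y).
  by have := nm_sub 1 (- y); rewrite opprK nm1 nmN; lra.
have : ln (1 + x) = 2 * ln (nm (1 + y)).
  by rewrite -E expr2 lnM ?posrE//; ring.
move=> L; rewrite L in h.
have x3 : x ^+ 2 <= 9 * nm y ^+ 2.
  rewrite -[x ^+ 2]ger0_norm ?sqr_ge0// normrX.
  have := normr_ge0 x; nra.
move: h; rewrite /x !ler_norml => /andP[h1 h2]; rewrite /x in x3; apply/andP; split; nra.
Qed.

(** A substitute for the complex logarithm: [phi] is a primitive of v'/v, and by [ln_nm_bound] ln
    |v| - Re phi has derivative zero along the segment from 0 to z. *)
Lemma ln_modulus (v phi : C -> C) (r : R) : hol 0 r v -> (forall z, nm z < r -> v z != 0) ->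
  (forall z, nm z < r -> is_cder phi z (cder v z / v z)) -> forall z, nm z < r ->
  ln (nm (v z)) = ln (nm (v 0)) + complex.Re (phi z - phi 0).
Proof.
move=> hv v0 hphi z hz.
pose g (t : R) : C := (ln (nm (v (t%:C%C * z))) - complex.Re (phi (t%:C%C * z)))%:C%C.
suff : nm (g 1 - g 0) <= 0.
  rewrite le_eqVlt ltNge nm_ge0 orbF nm_eq0 subr_eq0 /g rmorph1 rmorph0 mul1r mul0r.
  move=> /eqP/complexI; case: (phi z) => a b; case: (phi 0) => c d /=; lra.
apply: mvt_loc => // t /andP[t0 t1] e e0; rewrite add0r.
set w := t%:C%C * z.
have hw : nm w < r.
  by rewrite /w nmM nm_real ger0_norm//; apply: le_lt_trans hz; rewrite ler_piMl ?nm_ge0.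
have hw' : nm (w - 0) < r by rewrite subr0.
set L := cder v w / v w.
have Z0 : 0 < 1 + nm z by rewrite ltr_pwDl ?nm_ge0.
set e1 := Num.min 1 (e / (4 * (1 + nm z))).
have e10 : 0 < e1 by rewrite lt_min ltr01 divr_gt0// mulr_gt0.
have e11 : e1 <= 1 by rewrite ge_min lexx.
have e12 : e1 * (4 * (1 + nm z)) <= e by rewrite -ler_pdivlMr ?mulr_gt0// ge_min lexx orbT.
have V0 : 0 < nm (v w) by rewrite nm_gt0 v0.
have /is_cderP hc := hol_cder hv hw'.
have [d1 d10 hd1] := hc (e1 * nm (v w)) (mulr_gt0 e10 V0).
have /is_cderP hp := hphi w hw.
have [d2 d20 hd2] := hp e1 e10.
set K := 1 + nm L; have K0 : 0 < K by rewrite /K ltr_pwDl ?nm_ge0.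
set d3 := Num.min (1 / (8 * K)) (e1 / (10 * K ^+ 2)).
have d30 : 0 < d3 by rewrite lt_min !divr_gt0 ?mulr_gt0 ?exprn_gt0.
have d31 : d3 * (8 * K) <= 1 by rewrite -ler_pdivlMr ?mulr_gt0// ge_min lexx.
have d32 : d3 * (10 * K ^+ 2) <= e1 by rewrite -ler_pdivlMr ?mulr_gt0 ?exprn_gt0// ge_min lexx orbT.
exists (Num.min d1 (Num.min d2 d3) / (1 + nm z)).
  by rewrite divr_gt0// lt_min d10 lt_min d20 d30.
move=> s; rewrite ltr_pdivlMr// => hs.
set w' := s%:C%C * z; set D := w' - w.
have ED : D = (s - t)%:C%C * z by rewrite /D /w' /w rmorphB /=; ring.
have nD : nm D = `|s - t| * nm z by rewrite ED nmM nm_real.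
have nD1 : nm D < Num.min d1 (Num.min d2 d3).
  by apply: le_lt_trans hs; rewrite nD ler_wpM2l// lerDr.
move: nD1; rewrite lt_min => /andP[k1]; rewrite lt_min => /andP[k2 k3].
have a1 := hd1 w' k1; have a2 := hd2 w' k2.
set y := v w' / v w - 1.
have vw0 : v w != 0 := v0 _ hw.
have Ey : v w' = v w * (1 + y) by rewrite /y; field.
have yL : nm (y - L * D) <= e1 * nm D.
  have -> : y - L * D = (v w' - v w - cder v w * D) / v w by rewrite /y /L /D; field.
  by rewrite nmM nmV ler_pdivrMr// mulrAC.
have ny : nm y <= K * nm D.
  have -> : y = (y - L * D) + L * D by ring.
  apply: le_trans (nmD _ _) _; rewrite nmM /K; have := nm_ge0 D; nra.
have nD0 := nm_ge0 D.
have ny8 : nm y <= 1 / 8 by apply: le_trans ny _; nra.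
have hl := ln_nm_bound ny8.
have Y0 : 0 < nm (1 + y).
  by have := nm_sub 1 (- y); rewrite opprK nm1 nmN; lra.
have E1 : ln (nm (v w')) = ln (nm (v w)) + ln (nm (1 + y)).
  by rewrite Ey nmM lnM ?posrE.
have -> : g s - g t = (ln (nm (1 + y)) - complex.Re (phi w' - phi w))%:C%C.
  rewrite /g -/w -/w' E1 -rmorphB; congr (real_complex _ _).
  by case: (phi w') => p1 p2; case: (phi w) => q1 q2 /=; ring.
rewrite nm_real.
have -> : ln (nm (1 + y)) - complex.Re (phi w' - phi w) =
   (ln (nm (1 + y)) - complex.Re y) + complex.Re ((y - L * D) - (phi w' - phi w - L * D)).
  by case: y {Ey yL ny ny8 hl Y0 E1} => y1 y2; case: (L * D) => l1 l2; case: (phi w' - phi w) => p1 p2 /=; ring.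
apply: le_trans (ler_normD _ _) _.
apply: le_trans (lerD hl (Re_le_nm _)) _.
apply: le_trans (lerD (lexx _) (nmB _ _)) _.
apply: le_trans (lerD (lexx _) (lerD yL a2)) _; rewrite -/D.
have h10 : 10 * nm y ^+ 2 <= e1 * nm D.
  have y0 := nm_ge0 y.
  have h1 : nm y ^+ 2 <= (K * nm D) ^+ 2 by rewrite lerXn2r ?nnegrE// mulr_ge0 // ltW.
  have h2 : 10 * (K * nm D) ^+ 2 <= d3 * (10 * K ^+ 2) * nm D.
    have : 0 <= 10 * K ^+ 2 * nm D by rewrite !mulr_ge0 ?exprn_ge0 // ltW.
    move: k3; rewrite exprMn; move: (K ^+ 2) => K2; nra.
  nra.
have h11 : nm D <= `|s - t| * (1 + nm z) by rewrite nD ler_wpM2l// lerDr.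
have h12 : e1 * nm D <= e1 * (`|s - t| * (1 + nm z)) by rewrite ler_wpM2l ?(ltW e10).
have h13 := normr_ge0 (s - t); nra.
Qed.

(** A primitive phi of v'/v with phi(0) = 0 has real part at most A. So psi = phi / (2A - phi) has
    modulus at most 1 and vanishes at 0; Schwarz's lemma bounds psi, hence phi, and Cauchy's
    estimate bounds phi'. *)
Lemma borel_caratheodory (v : C -> C) (rho r d A : R) : 0 <= r -> 0 < d -> 0 < A -> r + 4 * d <= rho ->
  hol 0 rho v -> (forall z, nm z < r + 4 * d -> v z != 0) ->
  (forall z, nm z < r + 4 * d -> nm (v z) <= nm (v 0) * expR A) ->
  forall z, nm z <= r -> nm (cder v z / v z) <= 2 * A * (r + 2 * d) / d ^+ 2.
Proof.
move=> r0 d0 A0 hrho hv v0 hB z hz.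
(* One width d is spent each time: no zeros on r + 4d, primitive on r + 3d, Schwarz on r + 2d, bound
   of phi on r + d, derivative on r. *)
set r4 := r + 4 * d in hrho v0 hB; set r3 := r + 3 * d; set r2 := r + 2 * d.
have r34 : r3 < r4 by rewrite /r3 /r4; lra.
have hv4 : hol 0 r4 v by exact: hol_le hrho hv.
have hL : hol 0 r4 (fun z => cder v z / v z).
  apply: holM; first exact: hol_der.
  by apply: holV => // w; rewrite subr0; exact: v0.
have [phi0 hphi0] := primitive hL r34.
pose phi z := phi0 z - phi0 0.
have hphi w : nm w < r3 -> is_cder phi w (cder v w / v w).
  by move=> hw; have := is_cderB (hphi0 w hw) (is_cder_cst (phi0 0) w); rewrite subr0.
have phi00 : phi 0 = 0 by rewrite /phi subrr.
have hphol : hol 0 r3 phi by move=> w; rewrite subr0 => /hphi ?; eexists; eassumption.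
have z4 w : nm w < r3 -> nm w < r4 by lra.
have r30 : 0 < r3 by rewrite /r3; lra.
have ReA w : nm w < r3 -> complex.Re (phi w) <= A.
  move=> hw; have := @ln_modulus v phi r3 (hol_le (ltW r34) hv4) (fun x hx => v0 x (z4 _ hx)) hphi w hw.
  rewrite phi00 subr0 => E.
  have n0 : 0 < nm (v 0) by rewrite nm_gt0; apply: v0; rewrite nm0; lra.
  have nw : 0 < nm (v w) by rewrite nm_gt0 v0// z4.
  have := hB w (z4 _ hw); rewrite -ler_ln ?posrE ?mulr_gt0 ?expR_gt0// lnM ?posrE ?expR_gt0//.
  by rewrite expRK E lerD2l.
pose A2 : C := (2 * A)%:C%C.
have den w : nm w < r3 -> A2 - phi w != 0.
  move=> hw; apply/eqP => E; have := ReA w hw.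
  have -> : phi w = A2 by apply/eqP; rewrite -subr_eq0 -opprB E oppr0.
  by rewrite /A2 /=; lra.
pose psi w := phi w / (A2 - phi w).
have hpsi : hol 0 r3 psi.
  apply: holM => //; apply: holV; last by move=> w; rewrite subr0; exact: den.
  by apply: holB => //; exact: hol_cst.
have psi1 w : nm w < r3 -> nm (psi w) <= 1.
  move=> hw; rewrite /psi nmM nmV ler_pdivrMr ?nm_gt0 ?den// mul1r.
  rewrite -(ler_pXn2r (n := 2)) ?nnegrE ?nm_ge0// !nm_sqr.
  by have := ReA w hw; rewrite /A2; case: (phi w) => a b /=; nra.
have psi0 : psi 0 = 0 by rewrite /psi phi00 mul0r.
have z3 : nm (0 - 0 : C) < r3 by rewrite subrr nm0.
have [k hk Ek] := hol_div hpsi z3 psi0.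
have r20 : 0 < r2 by rewrite /r2; lra.
have r23 : r2 < r3 by rewrite /r2 /r3; lra.
have kB w : nm w <= r2 -> nm (k w) <= r2^-1.
  apply: (maxmod0 hk r23) => x hx.
  have := psi1 x; rewrite hx => /(_ r23); rewrite Ek subr0 nmM hx mulrC.
  by rewrite -ler_pdivlMr// mul1r.
have psiB w : nm w <= r + d -> nm (psi w) <= (r + d) / r2.
  move=> hw; rewrite Ek subr0 nmM ler_pM ?nm_ge0// kB// /r2; lra.
have phiB w : nm w <= r + d -> nm (phi w) <= 2 * A * r2 / d.
  move=> hw; have hw3 : nm w < r3 by rewrite /r3; lra.
  have p1 := psiB w hw.
  have q1 : 1 - (r + d) / r2 = d / r2 by rewrite /r2; field; rewrite /r2 in r20; rewrite gt_eqF.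
  have q0 : 0 < d / r2 by rewrite divr_gt0.
  have n1 : d / r2 <= nm (1 + psi w).
    by have := nm_sub 1 (- psi w); rewrite opprK nm1 nmN; lra.
  have e1 : psi w * (A2 - phi w) = phi w := divfK (den w hw3) _.
  have Ep : phi w * (1 + psi w) = A2 * psi w by rewrite mulrDr mulr1 -{1}e1; ring.
  have := psi1 w hw3 => p2.
  have E2 : nm (phi w) * nm (1 + psi w) = 2 * A * nm (psi w).
    by rewrite -nmM Ep nmM nm_real gtr0_norm ?mulr_gt0.
  rewrite ler_pdivlMr//.
  have h1 : nm (phi w) * (d / r2) <= 2 * A.
    by have := nm_ge0 (phi w); nra.
  by move: h1; rewrite mulrA ler_pdivrMr.
rewrite -(cderE (hphi z _)); last by rewrite /r3; lra.
have hphz : hol z (2 * d) phi.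
  apply: hol_sub hphol => w hw; rewrite subr0 /r3.
  have -> : w = (w - z) + z by ring.
  by apply: le_lt_trans (nmD _ _) _; lra.
have dd : d < 2 * d by lra.
have := cauchy_est hphz d0 dd (B := 2 * A * r2 / d).
rewrite expr2 invfM mulrA; apply => w hw; apply: phiB.
have -> : w = (w - z) + z by ring.
by apply: le_trans (nmD _ _) _; lra.
Qed.

Lemma is_cder_prod (I : Type) (s : seq I) (F : I -> C -> C) (D : I -> C) z :
  (forall i, is_cder (F i) z (D i)) -> (forall i, List.In i s -> F i z != 0) ->
  is_cder (fun w => \prod_(i <- s) F i w) z ((\prod_(i <- s) F i z) * \sum_(i <- s) (D i / F i z)).
Proof.
move=> hF; elim: s => [|i s IH] h0.
  rewrite big_nil [X in _ * X]big_nil mulr0; have := is_cder_cst 1 z; congr is_cder.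
  by apply: funext => w; rewrite big_nil.
rewrite big_cons [X in _ * X]big_cons.
have := is_cderM (hF i) (IH (fun j hj => h0 j (or_intror hj))).
have -> : D i * (\prod_(j <- s) F j z) +
   F i z * ((\prod_(j <- s) F j z) * \sum_(j <- s) D j / F j z) =
  F i z * (\prod_(j <- s) F j z) * (D i / F i z + \sum_(j <- s) D j / F j z).
  by field; apply: h0; left.
by congr is_cder; apply: funext => w; rewrite big_cons.
Qed.

Lemma cder_poly1 z a (c : C) : is_cder (fun w => c * (w - a)) z c.
Proof.
have := is_cderZ c (is_cderB (is_cder_id z) (is_cder_cst a z)).
by rewrite subr0 mulr1.
Qed.

Lemma cder_bden1 z (c a : C) : is_cder (fun w => c - a * w) z (- a).
Proof.
have := is_cderB (is_cder_cst c z) (is_cderZ a (is_cder_id z)).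
by rewrite mulr1 sub0r.
Qed.

Lemma InP (T : eqType) (x : T) (s : seq T) : List.In x s -> x \in s.
Proof. by elim: s => //= y s IH [->|/IH]; rewrite inE ?eqxx// => ->; rewrite orbT. Qed.

(** u is v times a Blaschke product, so u'/u is v'/v plus, for each zero a, a term 1/(z - a) of size
    at most 1/tau and a term from the denominator of size at most 1/(r1 - r2). As v has no zero,
    v'/v falls under [borel_caratheodory]. *)
Lemma logder_bound (u v : C -> C) (s : seq C) (rho r1 r2 r d A tau : R) :
  0 <= r -> 0 < d -> 0 < A -> 0 < tau -> r + 4 * d <= r2 -> r2 < r1 -> r1 < rho ->
  hol 0 rho u -> hol 0 rho v -> (forall a, a \in s -> nm a < r2) ->
  (forall z, u z * bden r1 s z = v z * bnum r1 s z) ->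
  (forall z, nm z < r2 -> v z != 0) ->
  (forall z, nm z = r1 -> nm (v z) <= nm (v 0) * expR A) ->
  forall z, nm z <= r -> (forall a, a \in s -> tau <= nm (z - a)) ->
  u z != 0 /\ nm (cder u z / u z) <=
    (size s)%:R * (tau^-1 + (r1 - r2)^-1) + 2 * A * (r + 2 * d) / d ^+ 2.
Proof.
move=> r0 d0 A0 t0 h2 h21 h1 hu hv hs E v0 hB z hz hzs.
have r20 : 0 < r2 by lra.
have r10 : 0 < r1 by lra.
have z2 : nm z < r2 by lra.
have rc0 : r1%:C%C != 0 :> C by rewrite -nm_gt0 nm_real gtr0_norm.
have za a : a \in s -> z - a != 0.
  by move=> /hzs ha; rewrite -nm_gt0; exact: lt_le_trans ha.
have dz a : a \in s -> r1 * (r1 - r2) <= nm ((r1 ^+ 2)%:C%C - conjc a * z).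
  by move=> /hs ha; apply: blaschke_den => //; lra.
have dz0 a : a \in s -> (r1 ^+ 2)%:C%C - conjc a * z != 0.
  by move=> /dz ha; rewrite -nm_gt0; apply: lt_le_trans ha; rewrite mulr_gt0// subr_gt0.
have hn := is_cder_prod (fun a => cder_poly1 z a r1%:C%C) (s := s) _.
have {}hn := hn (fun a ha => mulf_neq0 rc0 (za a (InP ha))).
have hd := is_cder_prod (fun a => cder_bden1 z ((r1 ^+ 2)%:C%C) (conjc a)) (s := s) (fun a ha => dz0 a (InP ha)).
have n0 : bnum r1 s z != 0.
  by rewrite prodf_seq_neq0; apply/allP => a ha; rewrite /= mulf_neq0 ?rc0 ?za.
have e0 : bden r1 s z != 0.
  by rewrite prodf_seq_neq0; apply/allP => a ha; rewrite /= dz0.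
have vz := v0 z z2.
have uz : u z != 0.
  have : u z * bden r1 s z != 0 by rewrite E mulf_neq0.
  by rewrite mulf_eq0 negb_or => /andP[].
split => //.
have zr : nm (z - 0) < rho by rewrite subr0; lra.
have c1 := is_cderM (hol_cder hu zr) hd.
have c2 := is_cderM (hol_cder hv zr) hn.
have c12 : is_cder (fun w => u w * bden r1 s w) z (cder v z * bnum r1 s z +
   v z * (bnum r1 s z * \sum_(a <- s) r1%:C%C / (r1%:C%C * (z - a)))).
  by have := c2; congr is_cder; apply: funext => w; rewrite E.
have EQ := is_cder_unique c1 c12.
set S1 := \sum_(a <- s) - _ / _ in EQ; set S2 := \sum_(a <- s) _ / _ in EQ.
rewrite -/(bden r1 s z) in EQ.
have -> : cder u z / u z = cder v z / v z + (S2 - S1).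
  have k1 : cder u z * bden r1 s z = (v z * bnum r1 s z) * (cder v z / v z + S2) - u z * bden r1 s z * S1.
    have -> : cder u z * bden r1 s z = cder v z * bnum r1 s z + v z * (bnum r1 s z * S2) - u z * (bden r1 s z * S1).
      by rewrite -EQ; ring.
    by field.
  rewrite -E in k1.
  have -> : cder u z = u z * (cder v z / v z + S2 - S1).
    apply: (mulIf e0); rewrite k1; ring.
  by field; rewrite uz vz.
apply: le_trans (nmD _ _) _; rewrite addrC; apply: lerD; last first.
  apply: (@borel_caratheodory v rho) => //; first lra.
    by move=> w hw; apply: v0; lra.
  move=> w hw; apply: (maxmod0 hv h1 hB); lra.
apply: le_trans (nmB _ _) _.
rewrite mulrDr; apply: lerD.
  apply: le_trans (nm_sum _ _ _) _.
  apply: (@le_trans _ _ (\sum_(a <- s) tau^-1)); last first.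
    by rewrite big_const_seq count_predT iter_addr_0 -[tau^-1 *+ _]mulr_natl.
  rewrite big_seq [X in _ <= X]big_seq; apply: ler_sum => a ha.
  have z0 := za a ha; have -> : r1%:C%C / (r1%:C%C * (z - a)) = (z - a)^-1 by field; rewrite z0 rc0.
  by rewrite nmV lef_pV2 ?posrE ?nm_gt0// hzs.
apply: le_trans (nm_sum _ _ _) _.
apply: (@le_trans _ _ (\sum_(a <- s) (r1 - r2)^-1)); last first.
  by rewrite big_const_seq count_predT iter_addr_0 -[(r1 - r2)^-1 *+ _]mulr_natl.
rewrite big_seq [X in _ <= X]big_seq; apply: ler_sum => a ha.
rewrite nmM nmN nm_conj nmV ler_pdivrMr ?nm_gt0 ?dz0//.
have r12 : 0 < r1 - r2 by rewrite subr_gt0.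
rewrite mulrC ler_pdivlMr//.
have := dz a ha; have := hs a ha; nra.
Qed.

(** Pigeonhole: the interval splits into one subinterval of length 2w more than there are points,
    and the midpoint [c j] of one containing no point in its interior is at distance at least w from
    all of them. *)
Lemma good_radius (s : seq R) (al be : R) : al < be ->
  exists r, [/\ al < r, r < be &
    forall x, x \in s -> (be - al) / (2 * (size s).+1%:R) <= `|r - x|].
Proof.
move=> ab; set n := size s; set w := (be - al) / _.
have n0 : (0 : R) < n.+1%:R by rewrite ltr0n.
have w0 : 0 < w by rewrite divr_gt0 ?subr_gt0 ?mulr_gt0.
have Ew : (2 * n.+1%:R) * w = be - al by rewrite mulrC divfK// mulf_neq0 ?pnatr_eq0 ?gt_eqF.
pose c (j : nat) := al + (2 * j%:R + 1) * w.
have [[j hj]|hn] := pselect (exists j : 'I_n.+1, forall x, x \in s -> w <= `|c j - x|).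
  exists (c j); split => //; rewrite /c.
    by rewrite ltrDl mulr_gt0// addr_gt0// ?ltr_pwDr// mulr_ge0.
  have jn : (j%:R : R) + 1 <= n.+1%:R by rewrite natr1 ler_nat.
  nra.
have ex (j : 'I_n.+1) : exists i : 'I_n, `|c j - nth 0 s i| < w.
  apply: contrapT => hj; apply: hn; exists j => x xs; rewrite leNgt; apply/negP => hx.
  have hi : (index x s < n)%N by rewrite index_mem.
  by apply: hj; exists (Ordinal hi); rewrite /= nth_index.
have [f hf] := choice ex.
have finj : injective f.
  move=> i j ij; have h1 := hf i; have h2 := hf j; rewrite ij in h1.
  have h3 : `|c i - c j| < 2 * w.
    have -> : c i - c j = (c i - nth 0 s (f j)) - (c j - nth 0 s (f j)) by ring.
    by apply: le_lt_trans (ler_normB _ _) _; lra.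
  have h4 : c i - c j = 2 * w * (i%:R - j%:R) by rewrite /c; ring.
  have w02 : 0 < 2 * w by lra.
  move: h3; rewrite h4 normrM (gtr0_norm w02) gtr_pMr// => h5.
  have h8 : (i < j.+1)%N && (j < i.+1)%N.
    move: h5; rewrite ltr_norml => /andP[h6 h7].
    by rewrite -!(ltr_nat R) -[j.+1%:R]natr1 -[i.+1%:R]natr1; apply/andP; split; lra.
  by apply: val_inj; apply/eqP; rewrite /= eqn_leq; move: h8; rewrite !ltnS.
have := leq_card f finj; rewrite !card_ord ltnn //.
Qed.

End GrowthTools.

(** * Iterated derivatives and Wronskians *)

Section Wronskian.
Variable R : realType.
Local Notation C := R[i].
Implicit Types (h : C -> C) (z w a : C).

Lemma clopen_segment (A : C -> Prop) z1 z2 :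
  (forall t : R, 0 <= t <= 1 -> exists2 d, 0 < d &
     forall w, nm (w - (z1 + t%:C%C * (z2 - z1))) < d -> (A w <-> A (z1 + t%:C%C * (z2 - z1)))) ->
  A z1 -> A z2.
Proof.
move=> hloc h1; pose p (t : R) := z1 + t%:C%C * (z2 - z1).
have p0 : p 0 = z1 by rewrite /p rmorph0; ring.
have p1 : p 1 = z2 by rewrite /p rmorph1; ring.
have K0 : 0 < 1 + nm (z2 - z1) by rewrite ltr_pwDl ?nm_ge0.
pose Q (a b c d : R) := A (p a) <-> A (p b).
suff : Q 0 1 0 0 by rewrite /Q p0 p1 => h; apply/h.
apply: cousin => //.
  by move=> a b c d _ _ h2 h3 _ _; rewrite /Q; split => [/h2/h3|/h3/h2].
move=> t y ht _; have [d d0 hd] := hloc t ht.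
exists (d / (1 + nm (z2 - z1))); first by rewrite divr_gt0.
move=> a b c' d' _ _ _ _ /andP[h2 h3] _; rewrite ltr_pdivlMr// => h4 _.
have near s : `|s - t| <= b - a -> A (p s) <-> A (p t).
  move=> hs; apply: hd; have -> : p s - (z1 + t%:C%C * (z2 - z1)) = (s - t)%:C%C * (z2 - z1).
    by rewrite /p rmorphB /=; ring.
  rewrite nmM nm_real; apply: le_lt_trans h4.
  by apply: ler_pM; rewrite ?nm_ge0// lerDr.
have na : A (p a) <-> A (p t) by apply: near; rewrite ler0_norm; lra.
have nb : A (p b) <-> A (p t) by apply: near; rewrite ger0_norm; lra.
by rewrite /Q; split => [/na/nb|/nb/na].
Qed.

Lemma convex_disc a rho z1 z2 (t : R) : nm (z1 - a) < rho -> nm (z2 - a) < rho -> 0 <= t <= 1 ->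
  nm (z1 + t%:C%C * (z2 - z1) - a) < rho.
Proof.
move=> h1 h2 ht.
have -> : z1 + t%:C%C * (z2 - z1) - a = (z1 - a) + t%:C%C * ((z2 - a) - (z1 - a)) by ring.
apply: (@le_lt_trans _ _ (Num.max (nm (z1 - a)) (nm (z2 - a)))); last by rewrite gt_max h1.
by apply: convex_nm => //; rewrite le_max lexx ?orbT.
Qed.

Lemma hol_near a rho h z : hol a rho h -> nm (z - a) < rho -> exists2 d, 0 < d & hol z d h.
Proof.
by move=> hh hz; have [s s0 hs] := disc_open hz; exists s => //; exact: hol_sub hh.
Qed.

(** By [hol_isolated], the set of points near which h vanishes identically is locally constant along
    segments of the disc. *)
Lemma hol_identity_gen a rho h z1 d1 : hol a rho h -> nm (z1 - a) < rho -> 0 < d1 ->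
  (forall z, nm (z - z1) < d1 -> h z = 0) -> forall z, nm (z - a) < rho -> h z = 0.
Proof.
move=> hh hz1 d10 h1 z2 hz2.
pose A z := exists2 d, 0 < d & forall w, nm (w - z) < d -> h w = 0.
suff : A z2 by case=> d d0; apply; rewrite subrr nm0.
apply: (@clopen_segment A z1); last by exists d1.
move=> t ht; set p := z1 + _.
have hp : nm (p - a) < rho by exact: convex_disc.
have [s s0 hs] := hol_near hh hp.
have [[d d0 hd]|[d d0 hd]] := hol_isolated s0 hs.
  exists d => // w hw; split => _; first by exists d.
  by have [e e0 he] := disc_open hw; exists e => // x /he /hd.
exists d => // w hw; split => [[e e0 he]|[e e0 he]]; exfalso.
  have [e' e'0 he'] := disc_open hw.
  pose m := Num.min e e' / 4.
  have m0 : 0 < m by rewrite divr_gt0// lt_min e0 e'0.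
  have mp : 0 < Num.min e e' by rewrite lt_min e0 e'0.
  have mm : 2 * m < Num.min e e' by rewrite /m; lra.
  move: mm; rewrite lt_min => /andP[me me'].
  have pick : exists x, nm (x - w) <= 2 * m /\ x != p.
    have [->|wp] := eqVneq w p; last by exists w; rewrite subrr nm0; split => //; lra.
    exists (p + m%:C%C); have E : p + m%:C%C - p = m%:C%C by ring.
    rewrite E nm_real gtr0_norm//; split; first lra.
    by rewrite -subr_eq0 E -nm_gt0 nm_real gtr0_norm.
  have [x [xw xp]] := pick.
  have xd : nm (x - p) < d by apply: he'; lra.
  by have := hd x xd xp; rewrite he ?eqxx//; lra.
pose m := Num.min e d / 2.
have m0 : 0 < m by rewrite divr_gt0// lt_min e0 d0.
have mp : 0 < Num.min e d by rewrite lt_min e0 d0.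
have mm : m < Num.min e d by rewrite /m; lra.
move: mm; rewrite lt_min => /andP[me md].
have E : p + m%:C%C - p = m%:C%C by ring.
have nE : nm (p + m%:C%C - p) = m by rewrite E nm_real gtr0_norm.
have pm : p + m%:C%C != p by rewrite -subr_eq0 E -nm_gt0 nm_real gtr0_norm.
have := hd (p + m%:C%C); rewrite nE md => /(_ isT pm).
by rewrite he ?eqxx// nE.
Qed.

Lemma cder0_const a rho h : hol a rho h -> (forall z, nm (z - a) < rho -> cder h z = 0) ->
  forall z, nm (z - a) < rho -> h z = h a.
Proof.
move=> hh h0 z hz; have rho0 : 0 < rho := le_lt_trans (nm_ge0 _) hz.
have aa : nm (a - a) < rho by rewrite subrr nm0.
have := @mvt_segment R h (fun=> 0) a z 0 0; rewrite !mul0r !subr0 => H.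
apply/eqP; rewrite -subr_eq0 -nm_eq0 eq_le nm_ge0 andbT; apply: H => t ht.
  have hp := convex_disc aa hz ht; rewrite -(h0 _ hp); exact: hol_cder hh hp.
by rewrite nm0.
Qed.

Definition dn (i : nat) h := iter i (@cder R) h.

Lemma dnS i h : dn i.+1 h = cder (dn i h). Proof. by []. Qed.

Lemma hol_dn a rho i h : hol a rho h -> hol a rho (dn i h).
Proof. by move=> hh; elim: i => // i IH; exact: hol_der. Qed.

Lemma dn_ext a rho i h k : (forall z, nm (z - a) < rho -> h z = k z) -> hol a rho h ->
  forall z, nm (z - a) < rho -> dn i h z = dn i k z.
Proof.
move=> hk hh; elim: i => // i IH z hz.
by rewrite !dnS; apply: (cder_ext IH) hz; exact: hol_dn.
Qed.

Lemma dn_sum a rho i (I : Type) (s : seq I) (F : I -> C -> C) :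
  (forall j, hol a rho (F j)) -> forall z, nm (z - a) < rho ->
  dn i (fun w => \sum_(j <- s) F j w) z = \sum_(j <- s) dn i (F j) z.
Proof.
move=> hF; elim: i => // i IH z hz; rewrite dnS.
have hs : hol a rho (dn i (fun w => \sum_(j <- s) F j w)) by apply: hol_dn; exact: hol_sum.
rewrite (cder_ext IH hs hz); apply: cderE; apply: is_cder_sum => j.
by rewrite dnS; apply: hol_cder hz; exact: hol_dn.
Qed.

Lemma dn_mul a rho i h k : hol a rho h -> hol a rho k -> forall z, nm (z - a) < rho ->
  dn i (fun w => h w * k w) z = \sum_(j < i.+1) 'C(i, j)%:R * dn (i - j) h z * dn j k z.
Proof.
move=> hh hk; elim: i => [|i IH] z hz.
  by rewrite big_ord1 bin0 subn0 mul1r.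
rewrite dnS.
have hs : hol a rho (dn i (fun w => h w * k w)) by apply: hol_dn; exact: holM.
rewrite (cder_ext IH hs hz).
have D (j : 'I_i.+1) : is_cder (fun w => 'C(i, j)%:R * dn (i - j) h w * dn j k w) z
   ('C(i, j)%:R * dn (i - j).+1 h z * dn j k z + 'C(i, j)%:R * dn (i - j) h z * dn j.+1 k z).
  by apply: is_cderM; [apply: is_cderZ|]; apply: hol_cder hz; exact: hol_dn.
rewrite (cderE (is_cder_sum (index_enum _) D)) big_split /=.
rewrite big_ord_recl bin0 subn0 [X in _ + X]big_ord_recr /= binn subnn.
rewrite [RHS]big_ord_recl bin0 subn0 [X in _ = _ + X]big_ord_recr /= binn subnn.
rewrite -!addrA; congr (_ + _); rewrite addrA; congr (_ + _); rewrite -big_split /=.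
apply: eq_bigr => j _; rewrite /bump /= !add1n subSS binS natrD.
have -> : dn (i - j) h z = cder (dn (i - j.+1) h) z by rewrite -dnS subnSK.
rewrite add0n; ring.
Qed.

(** The j-th derivative is h l_j with l_(j+1) = l_j' + (h'/h) l_j. Bounding l_j' by Cauchy's
    estimate on radius tau/(2s) costs a factor 2s/tau, and the discs shrink by tau/s each time,
    which allows s steps. *)
Lemma logder_iter a (tau K0 : R) (s : nat) h : 0 < tau -> 0 <= K0 -> hol a tau h ->
  (forall z, nm (z - a) < tau -> h z != 0) ->
  (forall z, nm (z - a) < tau -> nm (cder h z / h z) <= K0) ->
  forall i, (i < s)%N -> nm (dn i h a) <= (K0 + 2 * s%:R / tau) ^+ i * nm (h a).
Proof.
move=> t0 K00 hh h0 hK i his; have s0 : (0 < s)%N by apply: leq_ltn_trans his.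
have sR0 : (0 : R) < s%:R by rewrite ltr0n.
set K := K0 + _; have K1 : 0 < K by rewrite ltr_wpDl// divr_gt0// mulr_gt0.
have hL : hol a tau (fun z => cder h z / h z) by apply: holM; [exact: hol_der|exact: holV].
suff key j : (j < s)%N -> exists2 l, hol a tau l &
    (forall z, nm (z - a) < tau -> dn j h z = h z * l z) /\
    (forall z, nm (z - a) < tau * (1 - j%:R / s%:R) -> nm (l z) <= K ^+ j).
  have [l hl [E B]] := key i his; rewrite E ?subrr ?nm0// nmM mulrC ler_wpM2r ?nm_ge0// B//.
  by rewrite subrr nm0 mulr_gt0// subr_gt0 ltr_pdivrMr// mul1r ltr_nat.
elim: j => [_|j IH js].
  exists (fun=> 1); first exact: hol_cst.
  by split => [z _|z _]; rewrite ?mulr1// nm1 expr0.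
have [l hl [E B]] := IH (ltnW js).
exists (fun z => cder l z + cder h z / h z * l z).
  by apply: holD; [exact: hol_der|exact: holM].
split => z hz.
  rewrite dnS (cder_ext E _ hz); last exact: hol_dn.
  rewrite (cderE (is_cderM (hol_cder hh hz) (hol_cder hl hz))).
  by field; exact: h0.
have hz1 : nm (z - a) < tau.
  apply: lt_le_trans hz _; rewrite ler_piMr ?(ltW t0)// lerBlDr lerDl.
have sE : tau * (1 - j%:R / s%:R) = tau * (1 - j.+1%:R / s%:R) + tau / s%:R.
  by rewrite -natr1; field; exact: lt0r_neq0.
have tsp : 0 < tau / s%:R by rewrite divr_gt0.
have hz2 : nm (z - a) < tau * (1 - j%:R / s%:R) by rewrite sE; lra.
have r0 : 0 < tau / (2 * s%:R) by rewrite divr_gt0// mulr_gt0.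
have r1 : tau / (2 * s%:R) < tau / s%:R.
  by rewrite ltr_pM2l// ltf_pV2 ?posrE ?mulr_gt0//; lra.
have js1 : tau * (1 - j%:R / s%:R) <= tau.
  rewrite ler_piMr ?(ltW t0)// lerBlDr lerDl.
have hsub w : nm (w - z) < tau / s%:R -> nm (w - a) < tau * (1 - j%:R / s%:R).
  move=> hw; have -> : w - a = (w - z) + (z - a) by ring.
  by apply: le_lt_trans (nmD _ _) _; rewrite sE; lra.
have hlz : hol z (tau / s%:R) l.
  by apply: hol_sub hl => w /hsub hw; exact: lt_le_trans js1.
have c1 : nm (cder l z) <= K ^+ j / (tau / (2 * s%:R)).
  by apply: (cauchy_est hlz r0 r1) => w hw; apply: B; apply: hsub; rewrite hw.
apply: le_trans (nmD _ _) _; rewrite nmM.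
have c2 : nm (cder h z / h z) * nm (l z) <= K0 * K ^+ j by rewrite ler_pM ?nm_ge0 ?hK ?B.
apply: le_trans (lerD c1 c2) _; rewrite exprS /K invf_div; apply/eqP/eqP; nra.
Qed.

Section Matrix.
Variable s : nat.
Implicit Type u : 'I_s -> C -> C.

Definition wmx u z : 'M[C]_s := \matrix_(i, k) dn i (u k) z.
Definition wronsk u z : C := \det (wmx u z).

Lemma hol_det a rho n (M : C -> 'M[C]_n) : (forall i j, hol a rho (fun z => M z i j)) ->
  hol a rho (fun z => \det (M z)).
Proof.
move=> hM; rewrite /determinant; apply: hol_sum => sg _; apply: holM; first exact: hol_cst.
by apply: hol_prod => i _; exact: hM.
Qed.

Lemma hol_wronsk a rho u : (forall k, hol a rho (u k)) -> hol a rho (wronsk u).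
Proof.
move=> hu; apply: hol_det => i j.
by apply: hol_ext (hol_dn i (hu j)) => z _; rewrite mxE.
Qed.

Lemma wronsk_bound u z (K : R) : 1 <= K ->
  (forall (i k : 'I_s), nm (dn i (u k) z) <= K ^+ i * nm (u k z)) ->
  nm (wronsk u z) <= (s`!)%:R * K ^+ (s * s) * \prod_k nm (u k z).
Proof.
move=> K1 hK; have K0 : 0 <= K by apply: le_trans K1.
rewrite /wronsk /determinant; apply: le_trans (nm_sum _ _ _) _.
apply: (@le_trans _ _ (\sum_(sg : 'S_s) (K ^+ (s * s) * \prod_k nm (u k z)))); last first.
  by rewrite sumr_const card_Sn -mulrA mulr_natl.
apply: ler_sum => sg _; rewrite nmM nmX nmN nm1 expr1n mul1r nm_prod.
apply: (@le_trans _ _ (\prod_(i < s) (K ^+ s * nm (u (sg i) z)))).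
  apply: ler_prod => i _; rewrite nm_ge0 mxE /=; apply: le_trans (hK _ _) _.
  by rewrite ler_wpM2r ?nm_ge0// ler_weXn2l// ltnW.
rewrite big_split /= prodr_const card_ord -exprM ler_wpM2l ?exprn_ge0//.
by rewrite [X in _ <= X](reindex_inj (@perm_inj _ sg)).
Qed.

Lemma wronsk_sum a rho u (i0 : 'I_s) z : (forall k, hol a rho (u k)) -> nm (z - a) < rho ->
  wronsk (fun k => if k == i0 then (fun w => \sum_j u j w) else u k) z = wronsk u z.
Proof.
move=> hu hz; pose T : 'M[C]_s := \matrix_(j, k) (if k == i0 then 1 else (j == k)%:R).
rewrite /wronsk; have -> : wmx (fun k => if k == i0 then (fun w => \sum_j u j w) else u k) z = wmx u z *m T :> 'M[C]_s.
  apply/matrixP => i k; rewrite !mxE; case: ifP => ki.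
    rewrite (dn_sum _ _ hu hz); apply: eq_bigr => j _.
    by rewrite !mxE ki mulr1.
  rewrite (bigD1 k)//= big1 ?addr0; first by rewrite !mxE ki eqxx mulr1.
  by move=> j jk; rewrite !mxE ki (negbTE jk) mulr0.
rewrite det_mulmx; suff -> : \det T = 1 by rewrite mulr1.
rewrite (expand_det_row _ i0) (bigD1 i0)//= big1 ?addr0; last first.
  by move=> k ki; rewrite mxE (negbTE ki) eq_sym (negbTE ki) mul0r.
rewrite mxE eqxx mul1r /cofactor addnn -signr_odd odd_double expr0 mul1r.
have -> : row' i0 (col' i0 T) = 1%:M.
  apply/matrixP => i k; rewrite !mxE; rewrite eq_sym (negbTE (neq_lift _ _)).
  by rewrite (inj_eq lift_inj).
by rewrite det1.
Qed.

(** By Leibniz's rule the Wronski matrix is multiplied by a lower triangular matrix with h on the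
    diagonal. Through this lemma the Wronskian at 0 does not depend on the homogeneous coordinates
    chosen. *)
Lemma wronsk_scale a rho h u z : hol a rho h -> (forall k, hol a rho (u k)) ->
  nm (z - a) < rho -> wronsk (fun k w => h w * u k w) z = h z ^+ s * wronsk u z.
Proof.
move=> hh hu hz.
pose L : 'M[C]_s := \matrix_(i, j) (if (j <= i)%N then 'C(i, j)%:R * dn (i - j) h z else 0).
have E : wmx (fun k w => h w * u k w) z = L *m wmx u z.
  apply/matrixP => i k; rewrite !mxE (dn_mul i hh (hu k) hz).
  rewrite (bigID (fun j : 'I_s => (j <= i)%N))/= [X in _ + X]big1 ?addr0; last first.
    by move=> j ji; rewrite !mxE (negbTE ji) mul0r.
  rewrite (big_ord_widen _ (fun j => 'C(i, j)%:R * dn (i - j) h z * dn j (u k) z) (ltn_ord i)).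
  by apply: eq_big => [j|j ji]; rewrite ?ltnS// !mxE -ltnS ji.
rewrite /wronsk E det_mulmx; congr (_ * _).
rewrite det_trig; last first.
  by apply/is_trig_mxP => i j ij; rewrite mxE leqNgt ij.
under eq_bigr => i _ do rewrite mxE leqnn binn subnn mul1r.
by rewrite prodr_const card_ord.
Qed.

(* P clears the simple poles of the logarithmic derivatives of the u k *)
Lemma wronsk_divides a rho u (P : C -> C) : hol a rho P -> (forall k, hol a rho (u k)) ->
  (forall k, exists2 l, hol a rho l &
     forall z, nm (z - a) < rho -> cder (u k) z * P z = u k z * l z) ->
  exists2 H, hol a rho H & forall z, nm (z - a) < rho ->
    P z ^+ (\sum_(i < s) i) * wronsk u z = (\prod_k u k z) * H z.
Proof.
move=> hP hu hl.
have key (k : 'I_s) : exists l : nat -> C -> C, forall i, hol a rho (l i) /\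
    forall z, nm (z - a) < rho -> P z ^+ i * dn i (u k) z = u k z * l i z.
  have [l1 hl1 E1] := hl k.
  (* Differentiate P^i u^(i) = u l_i, multiply by P and use u' P = u l_1: this gives l_(i+1) = l_1
     l_i + P l_i' - i P' l_i. *)
  pose l := fix l i := if i is i'.+1 then
    (fun z => l1 z * l i' z + P z * cder (l i') z - i'%:R * cder P z * l i' z) else (fun=> 1 : C).
  exists l; elim=> [|i [IH1 IH2]].
    by split; [exact: hol_cst|move=> z _; rewrite expr0 mul1r mulr1].
  split.
    apply: holB; first by apply: holD; apply: holM => //; exact: hol_der.
    by apply: holM => //; apply: holM; [exact: hol_cst|exact: hol_der].
  move=> z hz; rewrite dnS /=.
  have hPi : is_cder (fun w => P w ^+ i) z (i%:R * P z ^+ i.-1 * cder P z).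
    have dP := hol_cder hP hz; elim: (i) => [|m IHm].
      rewrite !mul0r; have := is_cder_cst 1 z; congr is_cder; by apply: funext => w; rewrite expr0.
    have := is_cderM dP IHm; have -> : cder P z * P z ^+ m + P z * (m%:R * P z ^+ m.-1 * cder P z) =
       m.+1%:R * P z ^+ m.+1.-1 * cder P z.
      by case: m {IHm} => [|m] /=; rewrite -?natr1 ?exprS; ring.
    by congr is_cder; apply: funext => w; rewrite exprS.
  have d1 := is_cderM hPi (hol_cder (hol_dn i (hu k)) hz).
  have d2 := is_cderM (hol_cder (hu k) hz) (hol_cder IH1 hz).
  have [r r0 hr] := disc_open hz.
  have d1' := is_cder_near r0 (fun w hw => IH2 w (hr w hw)) d1.
  have EQ := is_cder_unique d1' d2.
  have E2 := IH2 z hz; have E3 := E1 z hz.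
  have -> : P z ^+ i.+1 * cder (dn i (u k)) z =
     P z * (i%:R * P z ^+ i.-1 * cder P z * dn i (u k) z + P z ^+ i * cder (dn i (u k)) z)
     - i%:R * cder P z * (P z * P z ^+ i.-1 * dn i (u k) z).
    by rewrite exprS; ring.
  have -> : i%:R * cder P z * (P z * P z ^+ i.-1 * dn i (u k) z) = i%:R * cder P z * (u k z * l i z).
    rewrite -E2; case: (i) => [|m]; first by rewrite !mul0r.
    by rewrite /= -exprS.
  rewrite EQ mulrDr mulrA [P z * cder (u k) z]mulrC E3; ring.
have [l hlk] := choice key.
pose Lm z : 'M[C]_s := \matrix_(i, k) l k i z.
exists (fun z => \det (Lm z)).
  apply: hol_det => i k; apply: hol_ext (hlk k i).1 => z _; by rewrite mxE.
move=> z hz.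
pose DP : 'rV[C]_s := \row_i P z ^+ i; pose DU : 'rV[C]_s := \row_k u k z.
have E : diag_mx DP *m wmx u z = Lm z *m diag_mx DU.
  apply/matrixP => i k; rewrite mul_diag_mx mul_mx_diag !mxE (hlk k i).2//.
  by rewrite mulrC.
have := congr1 (fun M => \det M) E; rewrite !det_mulmx !det_diag.
have -> : \prod_i DP 0 i = \prod_(i < s) P z ^+ i by apply: eq_bigr => i _; rewrite mxE.
have -> : \prod_i DU 0 i = \prod_k u k z by apply: eq_bigr => k _; rewrite mxE.
by rewrite -expr_sum => ->; rewrite mulrC.
Qed.

End Matrix.

Lemma kernel_col n (M : 'M[C]_n) : \det M = 0 -> exists2 v : 'cV[C]_n, v != 0 & M *m v = 0.
Proof.
move=> h; have : \det M^T == 0 by rewrite det_tr h.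
move=> /det0P [v v0 hv]; exists v^T; first by rewrite trmx_eq0.
by rewrite -[M]trmxK -trmx_mul hv trmx0.
Qed.

(** Induction on the number of functions: near a point where the Wronskian of all but the last is
    nonzero, vanishing of the full Wronskian would make the last function a constant combination of
    the others. *)
Lemma wronsk_neq0 s (u : 'I_s -> C -> C) a rho : 0 < rho -> (forall k, hol a rho (u k)) ->
  (forall c : 'I_s -> C, (forall z, nm (z - a) < rho -> \sum_k c k * u k z = 0) -> forall k, c k = 0) ->
  exists2 z, nm (z - a) < rho & wronsk u z != 0.
Proof.
move=> rho0; elim: s u => [|s IH] u hu hind.
  by exists a; rewrite ?subrr ?nm0// /wronsk det_mx00 oner_eq0.
pose u' (k : 'I_s) := u (widen_ord (leqnSn s) k).
have hu' k : hol a rho (u' k) by exact: hu.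
have [c hc k|z1 hz1 W1] := IH u' hu'.
  pose c' (k : 'I_s.+1) : C := if unlift ord_max k is Some k' then c k' else 0.
  have := hind c' _ (widen_ord (leqnSn s) k).
  have -> : c' (widen_ord (leqnSn s) k) = c k.
    rewrite /c'; have -> : widen_ord (leqnSn s) k = lift ord_max k.
      by apply: val_inj; rewrite /= /bump leqNgt ltn_ord.
    by rewrite liftK.
  apply => z hz; rewrite big_ord_recr /= /c' unlift_none mul0r addr0 -[RHS](hc z hz).
  apply: eq_bigr => j _; congr (_ * _).
  have -> : widen_ord (leqnSn s) j = lift ord_max j.
    by apply: val_inj; rewrite /= /bump leqNgt ltn_ord.
  by rewrite liftK.
apply: contrapT => hW.
have W0 z : nm (z - a) < rho -> wronsk u z = 0.
  by move=> hz; apply: contrapT => /eqP h; apply: hW; exists z.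
have hW' := hol_wronsk hu'.
have [d1 d10 hd1] := disc_open hz1.
have [d2 d20 hd2] : exists2 d, 0 < d & forall z, nm (z - z1) < d -> wronsk u' z != 0.
  have n0 : 0 < nm (wronsk u' z1) by rewrite nm_gt0.
  have [d d0 hd] := hol_cont hW' hz1 n0; exists d => // z /hd.
  by apply: contraTneq => ->; rewrite sub0r nmN ltxx.
pose d := Num.min d1 d2; have d0 : 0 < d by rewrite lt_min d10 d20.
have hda z : nm (z - z1) < d -> nm (z - a) < rho by rewrite lt_min => /andP[/hd1].
have hdW z : nm (z - z1) < d -> wronsk u' z != 0 by rewrite lt_min => /andP[_ /hd2].
(* by Cramer's rule the last function is a combination of the others, with holomorphic
   coefficients which turn out to be constant *)
pose co z : 'cV[C]_s := (wronsk u' z)^-1 *: (\adj (wmx u' z) *m \col_i dn i (u ord_max) z).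
have coE z : nm (z - z1) < d -> wmx u' z *m co z = \col_i dn i (u ord_max) z.
  move=> hz; rewrite /co -scalemxAr mulmxA mul_mx_adj mul_scalar_mx scalerA mulVf ?scale1r//.
  exact: hdW.
have hcol j : hol z1 d (fun z => co z j 0).
  have E z : (wronsk u' z)^-1 * \sum_i (\adj (wmx u' z)) j i * dn i (u ord_max) z = co z j 0.
    rewrite /co !mxE; congr (_ * _); apply: eq_bigr => i _; by rewrite !mxE.
  apply: hol_ext (fun z _ => E z) _; apply: holM.
    by apply: holV; [exact: hol_sub hW'|exact: hdW].
  apply: hol_sum => i _; apply: holM; last by apply: hol_sub (hol_dn i (hu ord_max)).
  have F z : (-1) ^+ (i + j) * \det (row' i (col' j (wmx u' z))) = (\adj (wmx u' z)) j i.
    by rewrite mxE.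
  apply: hol_ext (fun z _ => F z) _; apply: holM; first exact: hol_cst.
  apply: hol_det => p q; apply: (@hol_ext _ _ _ (dn (lift i p) (u' (lift j q)))).
    by move=> z _; rewrite !mxE.
  by apply: hol_sub (hol_dn _ (hu' _)).
have all_rows z (i : nat) : nm (z - z1) < d -> (i <= s)%N ->
    dn i (u ord_max) z = \sum_j dn i (u' j) z * co z j 0.
  move=> hz; rewrite leq_eqVlt => /orP[/eqP ->|his]; last first.
    have /matrixP/(_ (Ordinal his) 0) := coE z hz; rewrite !mxE /= => <-.
    by apply: eq_bigr => j _; rewrite mxE.
  (* The last row is not among the equations solved by [co]. A kernel vector of the singular full
     matrix has nonzero last entry because the leading block is invertible; scaled to last entry -1
     it is [co z] in the other entries, and it satisfies the last row. *)
  have [v v0 hv] := kernel_col (W0 z (hda z hz)).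
  pose v' : 'cV[C]_s := \col_j v (widen_ord (leqnSn s) j) 0.
  have hrow (i1 : 'I_s.+1) : \sum_j dn i1 (u' j) z * v' j 0 + dn i1 (u ord_max) z * v ord_max 0 = 0.
    have /matrixP/(_ i1 0) := hv; rewrite !mxE big_ord_recr /= mxE => H; rewrite -[RHS]H; congr (_ + _).
    by apply: eq_bigr => j _; rewrite !mxE.
  have inj (w : 'cV[C]_s) : wmx u' z *m w = 0 -> w = 0.
    move=> hw; have : \adj (wmx u' z) *m (wmx u' z *m w) = 0 by rewrite hw mulmx0.
    rewrite mulmxA mul_adj_mx mul_scalar_mx => /eqP; rewrite scaler_eq0 => /orP[/eqP h|/eqP //].
    by have := hdW z hz; rewrite /wronsk h eqxx.
  have vm : v ord_max 0 != 0.
    apply: contra v0 => /eqP vm; have v'0 : v' = 0.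
      apply: inj; apply/matrixP => i1 j; rewrite !mxE.
      have := hrow (widen_ord (leqnSn s) i1); rewrite vm mulr0 addr0 => {2}<-.
      by apply: eq_bigr => k _; rewrite ord1 !mxE.
    apply/eqP/matrixP => i1 j; rewrite ord1 mxE.
    case: (unliftP ord_max i1) => [k ->|-> //].
    have -> : lift ord_max k = widen_ord (leqnSn s) k.
      by apply: val_inj; rewrite /= /bump leqNgt ltn_ord.
    by have /matrixP/(_ k 0) := v'0; rewrite !mxE.
  have coV : co z = - (v ord_max 0)^-1 *: v'.
    apply/eqP; rewrite -subr_eq0; apply/eqP; apply: inj.
    rewrite mulmxBr coE//; apply/matrixP => i1 j; rewrite -scalemxAr !mxE.
    have := hrow (widen_ord (leqnSn s) i1) => /eqP; rewrite addr_eq0 => /eqP h.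
    have -> : \sum_j0 wmx u' z i1 j0 * v' j0 j = - (dn i1 (u ord_max) z * v ord_max 0).
      by rewrite -h; apply: eq_bigr => k _; rewrite ord1 !mxE.
    by field.
  have := hrow ord_max => /eqP; rewrite addr_eq0 => /eqP /= h.
  rewrite coV; under eq_bigr do rewrite mxE mulrCA.
  by rewrite -mulr_sumr h; field.
have dco z : nm (z - z1) < d -> forall j, cder (fun w => co w j 0) z = 0.
  move=> hz; pose dv : 'cV[C]_s := \col_j cder (fun w => co w j 0) z.
  suff dv0 : dv = 0 by move=> j; have /matrixP/(_ j 0) := dv0; rewrite !mxE.
  (* Row i differentiated, minus row i + 1; for the last i this uses the additional row obtained in
     [all_rows]. *)
  have hdv : wmx u' z *m dv = 0.
    apply/matrixP => i k; rewrite ord1 !mxE.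
    have is' : (i <= s)%N by exact: ltnW.
    have e1 : is_cder (fun w => \sum_j dn i (u' j) w * co w j 0) z
        (\sum_j (dn i.+1 (u' j) z * co z j 0 + dn i (u' j) z * cder (fun w => co w j 0) z)).
      apply: is_cder_sum => j; apply: is_cderM; last exact: hol_cder hz.
      by apply: hol_cder (hda z hz); exact: hol_dn.
    have [r r0 hr] := disc_open hz.
    have e2 := is_cder_near r0 (fun w hw => esym (all_rows w i (hr w hw) is')) e1.
    have := cderE e2; rewrite -dnS (all_rows z i.+1 hz (ltn_ord i)) big_split /= => /eqP.
    rewrite -subr_eq0 opprD addrA subrr sub0r oppr_eq0 => /eqP h; rewrite -[RHS]h.
    by apply: eq_bigr => j _; rewrite !mxE.
  have : \adj (wmx u' z) *m (wmx u' z *m dv) = 0 by rewrite hdv mulmx0.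
  rewrite mulmxA mul_adj_mx mul_scalar_mx => /eqP; rewrite scaler_eq0 => /orP[/eqP h|/eqP //].
  by have := hdW z hz; rewrite /wronsk h eqxx.
have cco z j : nm (z - z1) < d -> co z j 0 = co z1 j 0.
  move=> hz; apply: (cder0_const (hcol j)) hz => w hw; exact: dco.
pose c (k : 'I_s.+1) : C := if unlift ord_max k is Some k' then co z1 k' 0 else -1.
have cw j : c (widen_ord (leqnSn s) j) = co z1 j 0.
  rewrite /c; have -> : widen_ord (leqnSn s) j = lift ord_max j.
    by apply: val_inj; rewrite /= /bump leqNgt ltn_ord.
  by rewrite liftK.
have : c ord_max = 0.
  apply: hind; apply: (hol_identity_gen _ hz1 d0).
    by apply: hol_sum => k _; apply: holM; [exact: hol_cst|exact: hu].
  move=> z hz; rewrite big_ord_recr /= {2}/c unlift_none mulN1r.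
  rewrite -[u ord_max z]/(dn 0 (u ord_max) z) (all_rows z 0%N hz)//.
  rewrite -sumrB big1// => j _; rewrite cw cco//=; rewrite /u'; ring.
by rewrite /c unlift_none => /eqP; rewrite oppr_eq0 oner_eq0.
Qed.

End Wronskian.

(** * Common zeros of N forms in N + 1 variables *)

Lemma lin_dep (K : fieldType) (V : lmodType K) (I G : finType) (x : I -> V) (g : G -> V)
    (w : I -> G -> K) : (#|G| < #|I|)%N -> (forall i, x i = \sum_j w i j *: g j) ->
  exists2 v : I -> K, (exists i, v i != 0) & \sum_i v i *: x i = 0.
Proof.
move=> hc hx; pose M : 'M[K]_(#|I|, #|G|) := \matrix_(i, j) w (enum_val i) (enum_val j).
have : kermx M != 0.
  rewrite kermx_eq0 /row_free neq_ltn; apply/orP; left.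
  exact: leq_ltn_trans (rank_leq_col M) hc.
case/rowV0Pn => v /sub_kermxP hv v0.
exists (fun i => v 0 (enum_rank i)).
  by have /rV0Pn [i hi] := v0; exists (enum_val i); rewrite enum_valK.
under eq_bigr => i _ do rewrite hx scaler_sumr.
rewrite exchange_big big1 //= => j _.
under eq_bigr => i _ do rewrite scalerA.
rewrite -scaler_suml; have /matrixP/(_ 0 (enum_rank j)) := hv; rewrite !mxE => h.
have -> : \sum_i v 0 (enum_rank i) * w i j = 0; last by rewrite scale0r.
rewrite -[RHS]h (reindex (@enum_rank I)) /=; last by apply: onW_bij; exact: enum_rank_bij.
by apply: eq_bigr => i _; rewrite !mxE !enum_rankK.
Qed.

(** * A weak Nullstellensatz from the uncountability of the real numbers *)

Section Nullstellensatz.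
Variables (R : realType) (n : nat).
Local Notation C := R[i].
Local Notation A := (mpoly n R[i]).
Local Notation X i := (mpolyX R[i] (mnm1 i) : A).
Local Notation cst := (@mpolyC n R[i]).
Implicit Types (J : A -> Prop) (p q : A).

Definition is_ideal J := [/\ J 0, forall p q, J p -> J q -> J (p + q) & forall p q, J q -> J (p * q)].

Definition addgen J (a : A) p := exists j q, J j /\ p = j + q * a.

Lemma is_idealB J p q : is_ideal J -> J p -> J q -> J (p - q).
Proof. by case=> _ hD hM hp hq; apply: hD => //; rewrite -mulN1r; exact: hM. Qed.

Lemma addgen_ideal J a : is_ideal J -> is_ideal (addgen J a).
Proof.
case=> h0 hD hM; split.
- by exists 0, 0; split => //; rewrite mul0r addr0.
- move=> p q [j [r [hj ->]]] [j' [r' [hj' ->]]]; exists (j + j'), (r + r').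
  by split; [exact: hD|ring].
- by move=> p q [j [r [hj ->]]]; exists (p * j), (p * r); split; [exact: hM|ring].
Qed.

Lemma addgen_sub J a p : J p -> addgen J a p.
Proof. by move=> hp; exists p, 0; rewrite mul0r addr0. Qed.

Lemma addgen_gen J a : is_ideal J -> addgen J a a.
Proof. by case=> h0 _ _; exists 0, 1; split => //; rewrite mul1r add0r. Qed.

(** The polynomials congruent modulo J to their value at c form a ring that contains the constants
    and the variables. *)
Lemma ideal_eval J (c : 'I_n -> C) p : is_ideal J -> (forall i, J (X i - cst (c i))) ->
  J (p - cst (meval c p)).
Proof.
move=> hJ hX; have [h0 hD hM] := hJ.
pose S q := J (q - cst (meval c q)).
have SM q r : S q -> S r -> S (q * r).
  move=> hq hr; rewrite /S mevalM mpolyCM.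
  have -> : q * r - cst (meval c q) * cst (meval c r) =
     r * (q - cst (meval c q)) + cst (meval c q) * (r - cst (meval c r)) by ring.
  by apply: hD; apply: hM.
have SD q r : S q -> S r -> S (q + r).
  move=> hq hr; rewrite /S mevalD mpolyCD.
  have -> : q + r - (cst (meval c q) + cst (meval c r)) =
     (q - cst (meval c q)) + (r - cst (meval c r)) by ring.
  exact: hD.
have SC a : S (cst a) by rewrite /S mevalC subrr.
have SX i : S (X i) by rewrite /S mevalXU.
have Sm m : S (mpolyX C m).
  rewrite mpolyXE_id; elim/big_ind: _ => [||i _]; first by rewrite -mpolyC1.
    exact: SM.
  by elim: (m i) => [|k IH]; rewrite ?expr0 -?mpolyC1// exprS; exact: SM.
rewrite -/(S p) (mpolyE p); elim/big_ind: _ => [||m _]; first by rewrite -mpolyC0.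
  exact: SD.
by rewrite -mul_mpolyC; exact: SM.
Qed.

(** If all pieces were finite, their union would be countable, hence of Lebesgue measure zero,
    whereas it contains [0, 1]. The number [K d] of points may depend on the piece. *)
Lemma real_cover_infinite (E : nat -> set R) (K : nat -> nat) :
  (forall x, exists d, E d x) -> exists d (s : seq R), [/\ uniq s, size s = K d & forall x, x \in s -> E d x].
Proof.
move=> hE; apply: contrapT => hn.
have hfin d : finite_set (E d).
  apply: contrapT => hinf; apply: hn.
  have [B sB hB] := infinite_set_fset (K d) hinf.
  exists d, (take (K d) (finmap.enum_fset B)); split.
  - by rewrite take_uniq// finmap.fset_uniq.
  - by rewrite size_takel// -finmap.cardfE.
  - by move=> x /mem_take hx; apply: sB.
have hcount : countable (\bigcup_d E d).
  by apply: bigcup_countable => // d _; exact: finite_set_countable.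
have hT : \bigcup_d E d = setT.
  by apply/seteqP; split => // x _; have [d hd] := hE x; exists d.
rewrite hT in hcount.
have := countable_lebesgue_measure0 hcount.
have : (@lebesgue_measure R `[0%R, 1%R] <= @lebesgue_measure R setT)%E.
  by apply: le_measure; rewrite ?inE//.
rewrite lebesgue_measure_itv /= lte_fin ltr01 oppr0 adde0 => h1 h2.
by move: h1; rewrite h2 lee_fin ler10.
Qed.

(* If X_i - c were invertible modulo J for every real c, uncountably many inverses would have
   bounded degree, hence satisfy a linear relation; clearing denominators gives a nonzero
   polynomial in X_i that lies in J, whereas it is a product of units modulo J. *)
Lemma ideal_ext J (i : 'I_n) : is_ideal J -> ~ J 1 -> exists c, ~ addgen J (X i - cst c) 1.
Proof.
move=> hJ J1; have [h0 hD hM] := hJ; apply: contrapT => hn.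
have unit_mod c : exists p, J (1 - p * (X i - cst c)).
  apply: contrapT => hc; apply: hn; exists c => -[j [p [hj e]]]; apply: hc; exists p.
  by rewrite e addrK.
pose E d (x : R) := exists p, (@mmeasure _ _ mdeg p <= d)%N /\ J (1 - p * (X i - cst x%:C%C)).
have hE x : exists d, E d x.
  by have [p hp] := unit_mod x%:C%C; exists (mmeasure mdeg p), p.
have [d [s [us sz hs]]] := real_cover_infinite (fun d => #|{: bmultinom n d}|.+1) hE.
pose I := 'I_(size s); pose c (k : I) : C := (nth 0 s k)%:C%C.
have ex (k : I) : exists p, (@mmeasure _ _ mdeg p <= d)%N /\ J (1 - p * (X i - cst (c k))).
  by apply: hs; rewrite mem_nth.
have [p hp] := choice ex.
have hcard : (#|{: bmultinom n d}| < #|{: I}|)%N by rewrite card_ord sz.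
have hx (k : I) : p k = \sum_(m : bmultinom n d) (mcoeff m (p k)) *: mpolyX C m.
  by rewrite -(mpolywE (hp k).1).
have [v [k0 vk0] hv] := lin_dep hcard hx.
pose m : {poly C} := \sum_(k : I) v k *: \prod_(l | l != k) ('X - (c l)%:P).
pose ev (r : {poly C}) : A := (map_poly cst r).[X i].
have evM r r' : ev (r * r') = ev r * ev r' by rewrite /ev rmorphM hornerM.
have evX a : ev ('X - a%:P) = X i - cst a.
  by rewrite /ev rmorphB /= map_polyX map_polyC /= hornerD hornerN hornerX hornerC.
have cinj (k l : I) : c k = c l -> k = l.
  move=> /complexI/eqP; rewrite nth_uniq// => /eqP; exact: val_inj.
have m0 : m != 0.
  apply/eqP => /(congr1 (fun r : {poly C} => r.[c k0])); rewrite horner0 /m horner_sum.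
  rewrite (bigD1 k0)//= [Z in _ + Z]big1 ?addr0; last first.
    move=> k kk0; rewrite hornerZ horner_prod (bigD1 k0) 1?eq_sym//=.
    by rewrite hornerXsubC subrr mul0r mulr0.
  rewrite hornerZ horner_prod => /eqP; rewrite mulf_eq0 (negbTE vk0)/= prodf_seq_eq0.
  case/hasP => l _ /andP[lk]; rewrite !hornerE subr_eq0 => /eqP /cinj e.
  by rewrite e eqxx in lk.
have Jm : J (ev m).
  pose Pi := \prod_(l : I) (X i - cst (c l)).
  have e1 : ev m - \sum_(k : I) Pi * (v k *: p k) =
     \sum_(k : I) (v k *: \prod_(l | l != k) (X i - cst (c l))) * (1 - p k * (X i - cst (c k))).
    have -> : ev m = \sum_(k : I) v k *: \prod_(l | l != k) (X i - cst (c l)).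
      rewrite /ev /m rmorph_sum horner_sum; apply: eq_bigr => k _.
      rewrite -mul_polyC rmorphM /= map_polyC /= hornerM hornerC mul_mpolyC; congr (_ *: _).
      by rewrite rmorph_prod horner_prod; apply: eq_bigr => l _; exact: evX.
    rewrite -sumrB; apply: eq_bigr => k _.
    rewrite -scalerAr -scalerAl -scalerBr; congr (_ *: _).
    have -> : Pi = (X i - cst (c k)) * \prod_(l | l != k) (X i - cst (c l)) by rewrite /Pi (bigD1 k).
    set Z := \prod_(l | l != k) _; ring.
  rewrite -mulr_sumr hv mulr0 subr0 in e1; rewrite e1.
  by elim/big_ind: _ => // k _; apply: hM; case: (hp k).
have [rs ers] := closed_field_poly_normal m.
have Jprod (t : seq C) a : J (a * \prod_(r <- t) (X i - cst r)) -> J a.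
  elim: t a => [|r t IH] a; first by rewrite big_nil mulr1.
  rewrite big_cons mulrA => /IH hJa; have [u hu] := unit_mod r.
  have -> : a = a * (1 - u * (X i - cst r)) + u * (a * (X i - cst r)) by ring.
  by apply: hD; apply: hM.
have el : ev m = cst (lead_coef m) * \prod_(r <- rs) (X i - cst r).
  rewrite {1}ers -mul_polyC evM; congr (_ * _).
    by rewrite /ev map_polyC hornerC.
  rewrite /ev rmorph_prod horner_prod; apply: eq_bigr => r _; exact: evX.
rewrite el in Jm; have := Jprod _ _ Jm => /(hM (cst (lead_coef m)^-1)).
by rewrite -mpolyCM mulVf ?lead_coef_eq0// mpolyC1.
Qed.

(** By [ideal_ext] some X_i - c_i can be adjoined for one variable after the other while the ideal
    stays proper; in the end every polynomial is congruent to its value at c, and a nonzero value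
    would be a unit. *)
Lemma nullstellensatz J : is_ideal J -> ~ J 1 ->
  exists c : 'I_n -> C, forall p, J p -> meval c p = 0.
Proof.
move=> hJ J1.
suff [J' [hJ' J'1 sub hX]] : exists J', [/\ is_ideal J', ~ J' 1, (forall p, J p -> J' p) &
    forall i, exists a, J' (X i - cst a)].
  have [c hc] := choice hX; exists c => p hp.
  have [h0 hD hM] := hJ'.
  have := is_idealB hJ' (sub p hp) (ideal_eval p hJ' hc).
  rewrite opprB addrC subrK => hev; apply: contrapT => /eqP e; apply: J'1.
  by have := hM (cst (meval c p)^-1) _ hev; rewrite -mpolyCM mulVf// mpolyC1.
suff : forall s : seq 'I_n, exists J', [/\ is_ideal J', ~ J' 1, (forall p, J p -> J' p) &
    forall i, i \in s -> exists a, J' (X i - cst a)].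
  move=> /(_ (enum 'I_n)) [J' [a b c d]]; exists J'; split => // i; apply: d.
  by rewrite mem_enum.
elim=> [|i s [J' [hJ' J'1 sub hX]]]; first by exists J.
have [c hc] := ideal_ext i hJ' J'1.
exists (addgen J' (X i - cst c)); split => //.
- exact: addgen_ideal.
- by move=> p /sub; exact: addgen_sub.
- move=> j; rewrite inE => /orP[/eqP ->|/hX [a ha]]; last by exists a; exact: addgen_sub.
  by exists c; exact: addgen_gen.
Qed.

End Nullstellensatz.

(** * Counting monomials modulo N forms *)

Section Dimension.
Variables (R : realType) (N d0 : nat).
Local Notation C := R[i].
Local Notation A := (mpoly N.+1 R[i]).
Local Notation X i := (mpolyX R[i] (mnm1 i) : A).
Local Notation cst := (@mpolyC N.+1 R[i]).
Local Notation comp := (@pihomog N.+1 R[i] mdeg).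

Lemma comp_mul (d e : nat) (p q : A) : q \is ishomog1 e mdeg ->
  comp d (p * q) = if (e <= d)%N then comp (d - e) p * q else 0.
Proof.
move=> hq; rewrite {1}(mpolyE p) mulr_suml raddf_sum /=.
have E m : comp d (mcoeff m p *: mpolyX C m * q) =
    if (e <= d)%N then comp (d - e) (mcoeff m p *: mpolyX C m) * q else 0.
  rewrite -scalerAl linearZ /=.
  have hm : mpolyX C m * q \is ishomog1 (mdeg m + e) mdeg.
    by apply: dhomogM => //; rewrite dhomogX.
  have [ed|de] := leqP e d.
    rewrite [comp (d - e) _]linearZ /= pihomogX; have [hE|ne] := eqVneq (mdeg m) (d - e)%N.
      have dE : d = (mdeg m + e)%N by rewrite hE subnK.
      by rewrite dE pihomog_dE// scalerAl.
    rewrite scaler0 mul0r (pihomog_ne0 _ hm) ?scaler0//.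
    by apply: contra ne => /eqP <-; rewrite addnK.
  rewrite (pihomog_ne0 _ hm) ?scaler0//.
  by apply: contraTneq de => <-; rewrite -leqNgt leq_addl.
rewrite (eq_bigr _ (fun m _ => E m)); case: ifP => _; last by rewrite big1.
by rewrite -mulr_suml -raddf_sum /= -mpolyE.
Qed.

Variable Q : 'I_N -> A.
Hypothesis d0_gt0 : (0 < d0)%N.
Hypothesis hQ : forall k, Q k \is ishomog1 d0 mdeg.

Definition idQ (p : A) := exists r : 'I_N -> A, p = \sum_k r k * Q k.

Lemma idQ_ideal : is_ideal idQ.
Proof.
split; first by exists (fun=> 0); rewrite big1// => k _; rewrite mul0r.
- move=> p q [r ->] [r' ->]; exists (fun k => r k + r' k).
  by rewrite -big_split; apply: eq_bigr => k _; rewrite mulrDl.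
- move=> p q [r ->]; exists (fun k => p * r k).
  by rewrite mulr_sumr; apply: eq_bigr => k _; rewrite mulrA.
Qed.

Lemma idQ_comp d p : idQ p -> exists r : 'I_N -> A,
  comp d p = \sum_k r k * Q k /\ forall k, r k \is ishomog1 (d - d0) mdeg.
Proof.
move=> [r ->]; have [hd|hd] := leqP d0 d.
  exists (fun k => comp (d - d0) (r k)); split; last by move=> k; exact: pihomogP.
  by rewrite raddf_sum; apply: eq_bigr => k _; rewrite /= (comp_mul _ _ (hQ k)) hd.
(* Below degree d0 the component is 0; zero coefficients are homogeneous of every degree, so the
   truncated difference d - d0 is harmless. *)
exists (fun=> 0); split; last by move=> k; exact: dhomog0.
rewrite raddf_sum /= big1 ?big1// => k _; first by rewrite mul0r.
by rewrite (comp_mul _ _ (hQ k)) leqNgt hd.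
Qed.

Section Growth.
Variable D : nat.

(** The index bounds each exponent [al k] separately rather than their sum. This crude count
    suffices: only N exponents can grow, since the [mu i] stay below the fixed D. *)
Inductive spanQ : nat -> A -> Prop :=
| spanQ0 d : spanQ d 0
| spanQg d (al : 'I_N -> nat) (mu : 'I_N.+1 -> nat) : (forall k, (al k <= d)%N) ->
    (forall i, (mu i < D)%N) -> spanQ d ((\prod_k Q k ^+ al k) * \prod_i X i ^+ mu i)
| spanQD d p q : spanQ d p -> spanQ d q -> spanQ d (p + q)
| spanQZ d c p : spanQ d p -> spanQ d (c *: p).

Lemma spanQ_le d e p : spanQ d p -> (d <= e)%N -> spanQ e p.
Proof.
elim=> {d p} [d|d al mu h1 h2|d p q _ hp _ hq|d c p _ hp] de; try by constructor; auto.
by apply: spanQg => // k; apply: leq_trans (h1 k) de.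
Qed.

Lemma spanQ_mul d k p : spanQ d p -> spanQ d.+1 (Q k * p).
Proof.
elim=> {d p} [d|d al mu h1 h2|d p q _ hp _ hq|d c p _ hp].
- by rewrite mulr0; constructor.
- rewrite mulrA.
  have -> : Q k * \prod_k0 Q k0 ^+ al k0 = \prod_k0 Q k0 ^+ (al k0 + (k0 == k)).
    rewrite [RHS](bigD1 k)//= eqxx addn1 exprS (bigD1 k)//= mulrA; congr (_ * _).
    by apply: eq_bigr => l lk; rewrite (negbTE lk) addn0.
  apply: spanQg => // l; have := h1 l; case: eqP => _; rewrite ?addn1 ?addn0 //.
  by move=> h; exact: leqW.
- by rewrite mulrDr; constructor.
- by rewrite -scalerAr; constructor.
Qed.

Hypothesis hD : forall i, idQ (X i ^+ D).

(** If some exponent reaches D, then X_i^D is a combination of the Q_k with homogeneous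
    coefficients, and the monomial becomes a sum of products of Q_k with forms of smaller degree, to
    which the induction applies. *)
Lemma monomial_span (m : multinom N.+1) : spanQ (mdeg m) (mpolyX C m).
Proof.
move: {2}(mdeg m).+1 (ltnSn (mdeg m)) => e; elim: e m => // e IH m hm.
have [hall|/existsNP [i /negP]] := pselect (forall i, m i < D)%N.
  have -> : mpolyX C m = (\prod_k Q k ^+ 0) * \prod_i X i ^+ m i.
    by rewrite big1 ?mul1r -?mpolyXE_id// => k _; rewrite expr0.
  by apply: spanQg.
rewrite -leqNgt => hi.
pose m' : multinom N.+1 := mnm_sub m (mnm_muln (mnm1 i) D).
have Em : m = mnm_add (mnm_muln (mnm1 i) D) m'.
  apply/mnmP => j; rewrite mnmDE /m' mnmBE mulmnE mnm1E.
  by case: eqP => [<-|_]; rewrite ?mul1n ?mul0n ?subn0 ?subnKC.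
have Ed : mdeg m = (D + mdeg m')%N by rewrite {1}Em mdegD mdegMn mdeg1 mul1n.
have [r [Er hr]] := idQ_comp D (hD i).
have hXD : X i ^+ D \is ishomog1 D mdeg.
  have -> : X i ^+ D \is ishomog1 D mdeg = (X i ^+ D \is ishomog1 (1 * D) mdeg) by rewrite mul1n.
  by apply: dhomogMn; rewrite dhomogX /= mdeg1.
rewrite pihomog_dE// in Er.
have -> : mpolyX C m = \sum_k Q k * (r k * mpolyX C m').
  rewrite Em mpolyXD -mpolyXn Er mulr_suml; apply: eq_bigr => k _; ring.
have [Dd|dD] := leqP d0 D; last first.
  have X0 : X i ^+ D = 0.
    have [r3 e3] := hD i; have := congr1 (comp D) e3.
    rewrite pihomog_dE// raddf_sum /= => ->; apply: big1 => k _.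
    by rewrite (comp_mul _ _ (hQ k)) leqNgt dD.
  have := congr1 (mcoeff (mnm_muln (mnm1 i) D)) X0.
  by rewrite mpolyXn mcoeffX eqxx mcoeff0 => /eqP; rewrite oner_eq0.
have hk k : spanQ (mdeg m).-1 (r k * mpolyX C m').
  have hh : r k * mpolyX C m' \is ishomog1 (D - d0 + mdeg m') mdeg.
    by apply: dhomogM => //; rewrite dhomogX.
  rewrite (mpolyE (r k * mpolyX C m')) big_seq.
  elim/big_ind: _ => [||m1 hm1]; [exact: spanQ0|exact: spanQD|].
  apply: spanQZ; have e1 := dhomog_mf hh hm1.
  have lt1 : (mdeg m1 < mdeg m)%N by rewrite e1 Ed ltn_add2r ltn_subrL d0_gt0 (leq_trans d0_gt0).
  apply: (spanQ_le (IH m1 _)); first exact: leq_trans lt1 hm.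
  by rewrite -ltnS (ltn_predK lt1).
elim/big_ind: _ => [||k _]; [exact: spanQ0|exact: spanQD|].
have : (0 < mdeg m)%N by rewrite Ed (leq_trans d0_gt0)// (leq_trans Dd)// leq_addr.
by move=> /prednK <-; exact: spanQ_mul.
Qed.

(* The monomials with exponents below T number T ^ N.+1, whereas the generators of spanQ in
   degree N.+1 * T number only O(T ^ N). *)
Lemma growth_absurd : (0 < D)%N -> False.
Proof.
(* t bounds the degrees of the monomials with exponents below T, and t + 1 <= (N + 2) T. The (t +
   1)^N D^(N+1) generators are thus at most (N + 2)^N D^(N+1) T^N, less than T^(N+1) by the choice
   of T. *)
move=> D0; pose T := ((N.+2) ^ N * D ^ N.+1).+1; pose t := (N.+1 * T)%N.
pose G : finType := ({ffun 'I_N -> 'I_t.+1} * {ffun 'I_N.+1 -> 'I_D})%type.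
pose gen (g : G) : A := (\prod_k Q k ^+ g.1 k) * \prod_i X i ^+ g.2 i.
pose M : finType := {ffun 'I_N.+1 -> 'I_T}.
pose mon (a : M) : multinom N.+1 := Multinom [tuple (a i : nat) | i < N.+1].
have hcard : (#|G| < #|M|)%N.
  rewrite card_prod !card_ffun !card_ord.
  have h1 : (t.+1 <= N.+2 * T)%N by rewrite /t [(N.+2 * T)%N]mulSn -addn1 addnC leq_add2r.
  apply: (@leq_ltn_trans ((N.+2 * T) ^ N * D ^ N.+1)).
    rewrite leq_mul2r; apply/orP; right.
    have hexp k : (t.+1 ^ k <= (N.+2 * T) ^ k)%N.
      by elim: k => // k IH; rewrite !expnS leq_mul.
    exact: hexp.
  by rewrite expnMn mulnAC [(T ^ N.+1)%N]expnS ltn_pmul2r ?expn_gt0.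
have span_fin p : spanQ t p -> exists w : G -> C, p = \sum_g w g *: gen g.
  move=> hp0; suff : forall d p, spanQ d p -> (d <= t)%N -> exists w : G -> C, p = \sum_g w g *: gen g.
    by move=> h; exact: h hp0 (leqnn t).
  move=> {p hp0} d p; elim => {d p} [d|d al mu h1 h2|d p q _ hp _ hq|d c p _ hp] hd.
  - by exists (fun=> 0); rewrite big1// => g _; rewrite scale0r.
  - pose g0 : G := ([ffun k => inord (al k)], [ffun i => Ordinal (h2 i)]).
    exists (fun g => (g == g0)%:R); rewrite (bigD1 g0)//= [Z in _ + Z]big1 ?addr0; last first.
      by move=> g /negbTE ->; rewrite scale0r.
    rewrite eqxx scale1r /gen /=; congr (_ * _); apply: eq_bigr => k _; rewrite ffunE //.
    by rewrite inordK// ltnS (leq_trans (h1 k)).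
  - have [w ->] := hp hd; have [w' ->] := hq hd; exists (fun g => w g + w' g).
    by rewrite -big_split; apply: eq_bigr => g _; rewrite scalerDl.
  - have [w ->] := hp hd; exists (fun g => c * w g).
    by rewrite scaler_sumr; apply: eq_bigr => g _; rewrite scalerA.
have ex (a : M) : exists w : G -> C, mpolyX C (mon a) = \sum_g w g *: gen g.
  apply: span_fin; apply: (spanQ_le (monomial_span _)); rewrite mdegE.
  apply: (@leq_trans (\sum_(i < N.+1) T)); last by rewrite sum_nat_const card_ord.
  by apply: leq_sum => i _; rewrite /mon mnmE ltnW.
have [w hw] := choice ex.
have [v [a0 va0] hv] := lin_dep hcard hw.
have := congr1 (mcoeff (mon a0)) hv; rewrite mcoeff0 raddf_sum /= (bigD1 a0)//= big1 ?addr0.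
  by rewrite mcoeffZ mcoeffX eqxx mulr1 => /eqP; rewrite (negbTE va0).
move=> a aa0; rewrite mcoeffZ mcoeffX; case: eqP => [e|_]; last by rewrite mulr0.
case/eqP: aa0; apply/ffunP => i; apply: val_inj.
by have /mnmP/(_ i) := e; rewrite /mon !mnmE.
Qed.

End Growth.

(* If every X_i were nilpotent modulo (Q k), growth_absurd would apply; a non-nilpotent X_i stays
   proper after adding X_i - 1 to the ideal. *)
Theorem common_zero : exists x : 'I_N.+1 -> C, (exists i, x i != 0) /\ forall k, meval x (Q k) = 0.
Proof.
have hI := idQ_ideal; have [I0 ID IM] := hI.
have [i hi] : exists i, forall d, ~ idQ (X i ^+ d).
  apply: contrapT => hn.
  have ex i : exists d, idQ (X i ^+ d).
    by apply: contrapT => hd; apply: hn; exists i => d h; apply: hd; exists d.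
  have [d hd] := choice ex.
  apply: (@growth_absurd (\sum_i d i).+1) => // i.
  have le : (d i <= (\sum_i d i).+1)%N by apply: leqW; rewrite (bigD1 i)//= leq_addr.
  by rewrite -(subnK le) exprD; exact: IM.
have hJ1 : ~ addgen idQ (X i - cst 1) 1.
  move=> [P [S [hP e]]].
  have hXi : X i - cst 1 = X i - 1 by rewrite mpolyC1.
  rewrite hXi in e.
  have hX1 : X i \is ishomog1 1 mdeg by rewrite dhomogX /= mdeg1.
  have h10 : (1 : A) \is ishomog1 0 mdeg by exact: dhomog1.
  (* Compare components in 1 = P + S (X_i - 1): in degree 0 they give S_0 + 1 = P_0, then S_(d+1) =
     P_(d+1) + X_i S_d. Beyond the degree of S only X_i^d is left, which contradicts [hi]. *)
  have key d : idQ (comp d S + X i ^+ d).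
    elim: d => [|d IH].
      have := congr1 (comp 0) e; rewrite pihomog_dE// mulrBr mulr1 raddfD raddfB /= (comp_mul _ _ hX1) ltn0 sub0r.
      move=> e0; have [r [Er _]] := idQ_comp 0 hP; rewrite expr0 e0 addrCA subrr addr0.
      by exists r.
    have := congr1 (comp d.+1) e; rewrite (pihomog_ne0 _ h10)// mulrBr mulr1 raddfD raddfB /= (comp_mul _ _ hX1) subn1 /=.
    move=> e1; have [r [Er _]] := idQ_comp d.+1 hP.
    have -> : comp d.+1 S + X i ^+ d.+1 = comp d.+1 P + X i * (comp d S + X i ^+ d).
      rewrite exprS mulrDr addrA; congr (_ + _); apply/eqP; rewrite -subr_eq0; apply/eqP.
      by rewrite -[RHS]oppr0 e1; ring.
    by apply: ID; [exists r|exact: IM].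
  apply: (hi (mmeasure mdeg S)); have := key (mmeasure mdeg S).
  have -> : comp (mmeasure mdeg S) S = 0; last by rewrite add0r.
  rewrite pihomogE big1_seq// => m /andP[/eqP hm hs].
  by have := msize_mdeg_lt hs; rewrite /= in hm *; rewrite hm ltnn.
have [c hc] := nullstellensatz (addgen_ideal _ hI) hJ1.
exists c; split; last first.
  move=> k; apply: hc; apply: addgen_sub; exists (fun l => (l == k)%:R).
  rewrite (bigD1 k)//= eqxx mul1r big1 ?addr0// => l /negbTE ->; by rewrite mul0r.
exists i; have := hc _ (addgen_gen _ hI); rewrite mevalB mevalXU mevalC => /eqP.
by rewrite subr_eq0 => /eqP ->; exact: oner_neq0.
Qed.

End Dimension.

(** * Evaluation of forms and systems in general position *)

Lemma digits_inj n D (a b : nat -> nat) : (forall i, (a i < D)%N) -> (forall i, (b i < D)%N) ->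
  (\sum_(i < n) a i * D ^ i = \sum_(i < n) b i * D ^ i)%N -> forall i, (i < n)%N -> a i = b i.
Proof.
elim: n a b => // n IH a b ha hb; rewrite !big_ord_recl /= !expn0 !muln1.
have E (c : nat -> nat) : (\sum_(i < n) c (bump 0 i) * D ^ bump 0 i = (\sum_(i < n) c i.+1 * D ^ i) * D)%N.
  by rewrite big_distrl; apply: eq_bigr => i _; rewrite /bump /= add1n expnSr mulnA.
rewrite !E => h.
have D0 : (0 < D)%N := leq_ltn_trans (leq0n _) (ha 0%N).
have h0 : a 0%N = b 0%N.
  by have := congr1 (modn^~ D) h; rewrite /= !(addnC (_ 0%N)) !modnMDl !modn_small.
have h1 := congr1 (divn^~ D) h; rewrite /= !divnDMl// !divn_small// !add0n in h1.
by case=> // i hi; exact: (IH (fun i => a i.+1) (fun i => b i.+1)).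
Qed.

Section HomPoly.
Variables (R : realType) (n : nat).
Local Notation C := R[i].
Local Notation A := (mpoly n R[i]).
Implicit Types (P : A) (x : 'I_n -> C).

(* Kronecker substitution X_i := t ^ (D ^ i) *)
Lemma meval_neq0 P : P != 0 -> exists x, meval x P != 0.
Proof.
move=> P0; pose D := (msize P).+1; pose e (m : multinom n) := (\sum_(i < n) m i * D ^ i)%N.
have lt m i : m \in msupp P -> (m i < D)%N.
  move=> /msize_mdeg_lt h; rewrite ltnS; apply: leq_trans (ltnW h).
  by rewrite mdegE (bigD1 i)//= leq_addr.
have einj m m' : m \in msupp P -> m' \in msupp P -> e m = e m' -> m = m'.
  move=> hm hm' he; apply/mnmP => i.
  pose a (l : multinom n) (k : nat) := if insub k is Some j then l (j : 'I_n) else 0%N.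
  have aE l (j : 'I_n) : a l j = l j by rewrite /a valK.
  have alt l k : l \in msupp P -> (a l k < D)%N.
    by move=> hl; rewrite /a; case: insubP => // j _ _; exact: lt.
  rewrite -2!aE; apply: (@digits_inj n D) => //; try by move=> k; exact: alt.
  by under eq_bigr => j _ do rewrite aE; under [RHS]eq_bigr => j _ do rewrite aE.
pose p : {poly C} := \sum_(m <- msupp P) mcoeff m P *: 'X^(e m).
have p0 : p != 0.
  have [m hm] : exists m, m \in msupp P.
    by case E : (msupp P) => [|m s]; [rewrite -msupp_eq0 E in P0|exists m; rewrite mem_head].
  apply/eqP => /(congr1 (fun q : {poly C} => q`_(e m))); rewrite coef0 /p coef_sum.
  rewrite (bigD1_seq m)//= ?msupp_uniq// big_seq_cond big1 ?addr0; last first.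
    move=> m' /andP[hm' ne]; rewrite coefZ coefXn; case: eqP => [/einj E|_]; last by rewrite mulr0.
    by rewrite E ?eqxx in ne.
  by rewrite coefZ coefXn eqxx mulr1 => /eqP; rewrite mcoeff_eq0 hm.
have /closed_nonrootP [t ht] := p0.
exists (fun i => t ^+ (D ^ i)); rewrite mevalE; move: ht; rewrite /root /p horner_sum.
congr (_ != 0); apply: eq_bigr => m _; rewrite hornerZ hornerXn; congr (_ * _).
by rewrite /e -prodrXr; apply: eq_bigr => i _; rewrite -exprM mulnC.
Qed.

Lemma coord_homog i : mpolyX C (mnm1 i) \is ishomog1 (n := n) 1 mdeg.
Proof. by rewrite dhomogX /= mdeg1. Qed.

Lemma coord_neq0 (i : 'I_n) : mpolyX C (mnm1 i) != 0.
Proof.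
by apply/eqP => /(congr1 (meval (fun=> 1))); rewrite mevalXU meval0 => /eqP; rewrite oner_eq0.
Qed.

Lemma meval_homog d P c x : P \is ishomog1 d mdeg ->
  meval (fun i => c * x i) P = c ^+ d * meval x P.
Proof.
move=> hP; rewrite !mevalE mulr_sumr big_seq [RHS]big_seq; apply: eq_bigr => m hm.
rewrite mulrCA; congr (_ * _); have /= <- := dhomog_mf hP hm.
rewrite mdegE -prodrXr -big_split.
by apply: eq_bigr => i _; rewrite exprMn.
Qed.

Lemma meval_bound d P : P \is ishomog1 d mdeg ->
  exists2 K, 1 <= K & forall x B, (forall i, nm (x i) <= B) -> 0 <= B -> nm (meval x P) <= K * B ^+ d.
Proof.
move=> hP; exists (1 + \sum_(m <- msupp P) nm (mcoeff m P)).
  by rewrite lerDl sumr_ge0// => m _; exact: nm_ge0.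
move=> x B hB B0; rewrite mulrDl mul1r mevalE; apply: le_trans (_ : _ <= 0 + _) _; last first.
  by apply: lerD; [exact: exprn_ge0|exact: lexx].
rewrite add0r; apply: le_trans (nm_sum _ _ _) _; rewrite mulr_suml big_seq [leRHS]big_seq.
apply: ler_sum => m hm; rewrite nmM; apply: ler_wpM2l; first exact: nm_ge0.
rewrite nm_prod; have /= <- := dhomog_mf hP hm; rewrite mdegE -prodrXr; apply: ler_prod => i _.
by rewrite nm_ge0 nmX lerXn2r// ?nnegrE// nm_ge0.
Qed.

Lemma ccvg_meval (T : Type) (F : set_system T) {FF : Filter F} (y : 'I_n -> T -> C) (l : 'I_n -> C) P :
  (forall i, ccvg F (y i) (l i)) -> ccvg F (fun t => meval (y^~ t) P) (meval l P).
Proof.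
move=> h.
have -> : (fun t => meval (y^~ t) P) =
    (fun t => \sum_(m <- msupp P) mcoeff m P * \prod_i y i t ^+ m i).
  by apply/funext => t; rewrite mevalE.
rewrite mevalE; elim: (msupp P) => [|m s IH].
  by rewrite big_nil; under eq_fun do rewrite big_nil; exact: ccvg_cst.
rewrite big_cons; under eq_fun do rewrite big_cons.
apply: ccvgD => //; apply: ccvgM; first exact: ccvg_cst.
elim: (index_enum _) => [|i r IHr].
  by rewrite big_nil; under eq_fun do rewrite big_nil; exact: ccvg_cst.
rewrite big_cons; under eq_fun do rewrite big_cons.
apply: ccvgM => //; elim: (m i) => [|k IHk].
  by rewrite expr0; under eq_fun do rewrite expr0; exact: ccvg_cst.
by rewrite exprS; under eq_fun do rewrite exprS; exact: ccvgM.
Qed.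

Lemma hol_meval a r (F : 'I_n -> C -> C) P : (forall i, hol a r (F i)) ->
  hol a r (fun z => meval (F^~ z) P).
Proof.
move=> h; apply: (@hol_ext R a r (fun z => \sum_(m <- msupp P) mcoeff m P * \prod_i F i z ^+ m i)).
  by move=> z _; rewrite mevalE.
apply: hol_sum => m _; apply: holM; first exact: hol_cst.
by apply: hol_prod => i _; exact: holX.
Qed.

(** If no c worked, vectors scaled to maximum norm 1 with arbitrarily small values of all p_k would
    accumulate at a common zero; the limit is not 0, since each of them has a coordinate equal to
    1. *)
Lemma poly_lower d s (p : 'I_s -> A) : (0 < d)%N -> (forall k, p k \is ishomog1 d mdeg) ->
  (forall x, (forall k, meval x (p k) = 0) -> forall i, x i = 0) ->
  exists2 c, 0 < c & forall x i, exists k, c * nm (x i) ^+ d <= nm (meval x (p k)).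
Proof.
move=> d0 hp hz; apply: contrapT => hn.
have ex (m : nat) : exists x, (exists i, x i = 1) /\ (forall i, nm (x i) <= 1) /\
    forall k, nm (meval x (p k)) <= m.+1%:R^-1.
  apply: contrapT => hm; apply: hn; exists m.+1%:R^-1; first by rewrite invr_gt0 ltr0n.
  move=> x i; apply: contrapT => hk; apply: hm.
  have [j0 _ hj] := arg_maxP (fun j => nm (x j)) (erefl : xpredT i).
  have h1 k : nm (meval x (p k)) < m.+1%:R^-1 * nm (x i) ^+ d.
    by rewrite ltNge; apply/negP => h; apply: hk; exists k.
  have [xj0|xj0] := eqVneq (x j0) 0.
    (* An empty family is impossible: the vector of ones would be a common zero. *)
    have [k hk'] : exists k : 'I_s, True.
      by apply: contrapT => hs; have := hz (fun=> 1) (fun k => False_ind _ (hs (ex_intro _ k I))) i => /eqP; rewrite oner_eq0.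
    have := h1 k; rewrite ltNge => /negP; case.
    have := hj i isT; rewrite /= xj0 nm0 => hi.
    have -> : nm (x i) = 0 by apply/eqP; rewrite eq_le hi nm_ge0.
    by rewrite expr0n eqn0Ngt d0 mulr0 nm_ge0.
  exists (fun j => (x j0)^-1 * x j); split; [|split].
  - by exists j0; rewrite mulVf.
  - move=> j; rewrite nmM nmV mulrC ler_pdivrMr ?nm_gt0// mul1r; exact: hj.
  - move=> k; rewrite (meval_homog _ _ (hp k)) nmM nmX nmV exprVn mulrC ler_pdivrMr ?exprn_gt0 ?nm_gt0//.
    apply: le_trans (ltW (h1 k)) _; apply: ler_wpM2l; first by rewrite invr_ge0.
    by rewrite lerXn2r ?nnegrE ?nm_ge0//; exact: hj.
have [y hy] := choice ex.
have ex2 i : exists l, forall e, 0 < e -> uset (fun m => nm (y m i - l) < e).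
  by have [l [_ hl]] := @cluster_point R (fun m => y m i) 1 (fun m => (hy m).2.1 i); exists l.
have [l hl] := choice ex2.
have l0 : forall i, l i = 0.
  apply: hz => k.
  have h2 : ccvg uset (fun m => meval (y m) (p k)) 0.
    move=> e e0; apply: (@uset_ge _ (Num.bound e^-1)) => m hm; rewrite subr0.
    apply: le_lt_trans ((hy m).2.2 k) _; rewrite invf_plt ?posrE ?ltr0n//.
    apply: lt_le_trans (archi_boundP _) _; first by rewrite invr_ge0 ltW.
    by rewrite ler_nat (leq_trans hm).
  by apply: (ccvg_unique _ h2); exact: (@ccvg_meval _ uset _ (fun i m => y m i)).
have hu : uset (fun m => forall i, nm (y m i - l i) < 1).
  by apply: filter_forall => i; apply: hl.
have [m _ hm] := uset_ex 0 hu; have [[i yi] _] := hy m.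
by have := hm i; rewrite yi l0 subr0 nm1 ltxx.
Qed.

End HomPoly.

(** * A minimal linear relation among forms in general position *)

Section Circuit.
Variables (R : realType) (N q d : nat).
Local Notation C := R[i].
Local Notation A := (mpoly N.+1 R[i]).
Variable Q : 'I_q -> A.
Hypothesis d_gt0 : (0 < d)%N.
Hypothesis hq : (N < q)%N.
Hypothesis hQ : forall j, Q j \is ishomog1 d mdeg.
Hypothesis gp : forall (i : 'I_N.+1 -> 'I_q) x, injective i ->
  (forall k, meval x (Q (i k)) = 0) -> forall j, x j = 0.

(** [None] stands for the additional hypersurface, defined by the sum of all Q_j. *)
Definition Qsum (o : option 'I_q) : A := if o is Some j then Q j else \sum_j Q j.

(* A linearly dependent family contains a minimal relation; all but one of its terms are then
   independent, and they sum to a multiple of the last one. *)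
Theorem circuit : exists s (p : 'I_s -> A) (o : 'I_s -> 'I_q) (c : 'I_s -> C) (o' : option 'I_q) (c' : C),
  [/\ (s <= q)%N, (forall k, c k != 0 /\ p k = c k *: Q (o k)),
   c' != 0 /\ \sum_k p k = c' *: Qsum o',
   (forall v : 'I_s -> C, \sum_k v k *: p k = 0 -> forall k, v k = 0) &
   (forall x, (forall k, meval x (p k) = 0) -> forall i, x i = 0)].
Proof.
have [ind|dep] := pselect (forall v : 'I_q -> C, \sum_k v k *: Q k = 0 -> forall k, v k = 0).
  exists q, Q, id, (fun=> 1), None, 1; split => //.
  - by move=> k; rewrite oner_neq0 scale1r.
  - by rewrite oner_neq0 scale1r.
  - move=> x hx; apply: (@gp (widen_ord hq)) => //.
    by move=> a b /(congr1 val) /= /val_inj.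
pose rel (S : {set 'I_q}) (v : 'I_q -> C) :=
  (exists j, v j != 0) /\ \sum_j v j *: Q j = 0 /\ S = [set j | v j != 0]%SET.
have [S0 hS0] : exists S, `[< exists v, rel S v >].
  move/existsNP: dep => [v /not_implyP [hv /existsNP [k /eqP hk]]].
  exists [set j | v j != 0]%SET; apply/asboolP; exists v; split; [by exists k|by []].
have [S /asboolP [v [[j0 vj0] [hv ES]]] Smin] :=
  @arg_minnP _ S0 (fun S : {set 'I_q} => `[< exists v, rel S v >]) (fun S => #|S|) hS0.
have inS j : (j \in S) = (v j != 0) by rewrite ES inE.
have minrel w : (forall j, j \notin S -> w j = 0) -> w j0 = 0 -> \sum_j w j *: Q j = 0 ->
    forall j, w j = 0.
  move=> hw1 hw2 hw3; apply: contrapT => /existsNP [j /eqP hj].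
  pose Sw := [set j | w j != 0]%SET; have := Smin Sw; rewrite leqNgt.
  have -> : (#|Sw| < #|S|)%N.
    apply: proper_card; apply/properP; split; last first.
      by exists j0; rewrite ?inS// /Sw inE hw2 eqxx.
    apply/fintype.subsetP => k; rewrite /Sw inE; apply: contraNT => hk; by rewrite hw1.
  move=> h; suff : false by []; apply: h; apply/asboolP; exists w.
  by split; [exists j|].
pose S' := (S :\ j0)%SET; pose s := #|S'|.
have j0S : j0 \in S by rewrite inS.
have inS' j : (j \in S') = (j != j0) && (j \in S) by rewrite !inE.
have notS j : j \notin S -> v j = 0 by rewrite inS negbK => /eqP.
have sumS' (w : 'I_q -> A) : \sum_(k < s) w (enum_val k) = \sum_(j in S') w j.
  by rewrite [RHS]big_enum_val.
have splitQ (w : 'I_q -> A) : (forall j, j \notin S -> w j = 0) ->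
    \sum_j w j = w j0 + \sum_(j in S') w j.
  move=> hw; rewrite (bigD1 j0)//=; congr (_ + _).
  rewrite big_mkcond [RHS]big_mkcond /=; apply: eq_bigr => j _; rewrite inS'.
  by case: eqP => //= _; case: ifP => // /negbT; exact: hw.
(* All q indices, with those of the minimal relation in front; general position is applied to the
   first N + 1 entries. *)
pose l := j0 :: enum S' ++ enum (~: S)%SET.
have ul : uniq l.
  rewrite /l /= cat_uniq !enum_uniq mem_cat !mem_enum !inE eqxx j0S /= andbT.
  apply/hasPn => j; rewrite !mem_enum !inE => hj; by rewrite (negbTE hj) andbF.
have sl : size l = q.
  rewrite /l /= size_cat -!cardE.
  by have := cardsC S; rewrite card_ord (cardsD1 j0 S) j0S add1n addSn.
pose i (k : 'I_N.+1) := nth j0 l k.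
have iinj : injective i.
  have li (k : 'I_N.+1) : (k < size l)%N by rewrite sl (leq_trans (ltn_ord k)).
  by move=> a b /eqP; rewrite nth_uniq// => /eqP /val_inj.
have vanish x : (forall j, j \in S' -> meval x (Q j) = 0) -> meval x (Q j0) = 0.
  move=> hx; have := congr1 (meval x) hv; rewrite raddf_sum /= meval0 (bigD1 j0)//= big1 ?addr0.
    by rewrite mevalZ => /eqP; rewrite mulf_eq0 (negbTE vj0) => /eqP.
  move=> j jj0; rewrite mevalZ; have [jS|/notS ->] := boolP (j \in S); last by rewrite mul0r.
  by rewrite hx ?mulr0// inS' jj0.
(* Otherwise the N forms at positions 1, ..., N of [l] include all Q_j with j in [S']. At their
   common zero Q_j0 vanishes as well, by the relation, and general position fails. *)
have Nbig : (N <= s)%N.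
  rewrite leqNgt; apply/negP => sN.
  have [x [[i0 xi0] hx]] := common_zero d_gt0 (fun k : 'I_N => hQ (nth j0 l k.+1)).
  have h0 : meval x (Q j0) = 0.
    apply: vanish => j jS'; have jin : j \in enum S' by rewrite mem_enum.
    have hlt : (index j (enum S') < N)%N.
      by apply: leq_trans (_ : _ <= s)%N (ltnW sN); rewrite /s cardE index_mem.
    have := hx (Ordinal hlt); rewrite /l /= nth_cat index_mem jin nth_index//.
  have := gp iinj (x := x) => /(_ _ i0) E; move: xi0; rewrite E ?eqxx//.
  move=> k; rewrite /i; case: k => [[|k] hk] //.
  exact: (hx (Ordinal (hk : (k < N)%N))).
exists s, (fun k => v (enum_val k) *: Q (enum_val k)), (fun k => enum_val k),
  (fun k => v (enum_val k)), (Some j0), (- v j0); split.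
- apply: leq_trans (_ : #|S| <= _)%N; first by rewrite /s (cardsD1 j0 S) j0S leq_addl.
  by rewrite -[leqRHS]card_ord max_card.
- move=> k; split => //; have := enum_valP k; by rewrite inS' inS => /andP[].
- split; first by rewrite oppr_eq0.
  rewrite (sumS' (fun j => v j *: Q j)) /= scaleNr; apply/eqP; rewrite -addr_eq0 addrC.
  by rewrite -(splitQ (fun j => v j *: Q j)) ?hv// => j /notS ->; rewrite scale0r.
- move=> w hw k.
  pose w' j := if j \in S' then (\sum_(k < s | enum_val k == j) w k) * v j else 0.
  have w'E (k' : 'I_s) : w' (enum_val k') = w k' * v (enum_val k').
    rewrite /w' enum_valP; congr (_ * _); rewrite (bigD1 k')//= big1 ?addr0// => k2.
    by rewrite (inj_eq enum_val_inj) => /andP[/eqP ->]; rewrite eqxx.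
  have : w' (enum_val k) = 0.
    apply: minrel.
    + by move=> j jS; rewrite /w' inS' (negbTE jS) andbF.
    + by rewrite /w' inS' eqxx.
    + rewrite (splitQ (fun j => w' j *: Q j)); last first.
        by move=> j jS; rewrite /w' inS' (negbTE jS) andbF scale0r.
      rewrite /= {1}/w' inS' eqxx /= scale0r add0r -sumS' -[RHS]hw.
      by apply: eq_bigr => k' _; rewrite w'E scalerA.
  rewrite w'E => /eqP; rewrite mulf_eq0 => /orP[/eqP //|].
  by have := enum_valP k; rewrite inS' inS => /andP[_ /negbTE ->].
- move=> x hx.
  have hS' j : j \in S' -> meval x (Q j) = 0.
    move=> jS'; have := hx (enum_rank_in jS' j); rewrite enum_rankK_in// mevalZ => /eqP.
    by rewrite mulf_eq0 => /orP[|/eqP //]; move: jS'; rewrite inS' inS => /andP[_ /negbTE ->].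
  apply: (gp iinj) => k; rewrite /i; case: k => [[|k] hk] /=; first exact: vanish.
  apply: hS'; rewrite nth_cat -cardE -/s (leq_trans _ Nbig)//.
  by rewrite -mem_enum mem_nth// -cardE -/s (leq_trans _ Nbig).
Qed.

End Circuit.

(** * Zeros of holomorphic families and their Wronskians *)

Section Quotients.
Variable R : realType.
Local Notation C := R[i].
Implicit Types (h u w k : C -> C) (a c z : C).

Lemma hol_nz_near a (rho : R) w z1 : hol a rho w -> nm (z1 - a) < rho -> w z1 != 0 ->
  exists2 d, 0 < d & forall z, nm (z - z1) < d -> nm (z - a) < rho /\ w z != 0.
Proof.
move=> hw hz1 wz1; have [s s0 hs] := disc_open hz1.
have [d1 d10 hd1] := hol_near hw hz1.
have [[d d0 hd]|[d d0 hd]] := hol_isolated d10 hd1.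
  by case/eqP: wz1; apply: hd; rewrite subrr nm0.
exists (Num.min s d); first by rewrite lt_min s0.
move=> z; rewrite lt_min => /andP[zs zd]; split; first exact: hs.
by have [->//|ne] := eqVneq z z1; exact: hd.
Qed.

Lemma hol_mul_eq0 a (rho : R) w h z1 : hol a rho w -> hol a rho h -> nm (z1 - a) < rho ->
  w z1 != 0 -> (forall z, nm (z - a) < rho -> w z * h z = 0) ->
  forall z, nm (z - a) < rho -> h z = 0.
Proof.
move=> hw hh hz1 wz1 h0; have [d d0 hd] := hol_nz_near hw hz1 wz1.
apply: (hol_identity_gen hh hz1 d0) => z /hd [hz wz].
by have /eqP := h0 z hz; rewrite mulf_eq0 (negbTE wz) => /eqP.
Qed.

(** Near each point one of the u_i has no zero and defines H as a holomorphic quotient; the cross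
    relations make these quotients agree. *)
Lemma hol_glue_quot (I : Type) a (rho : R) (h u : I -> C -> C) :
  (forall i, hol a rho (h i)) -> (forall i, hol a rho (u i)) ->
  (forall i j z, nm (z - a) < rho -> h i z * u j z = h j z * u i z) ->
  (forall z, nm (z - a) < rho -> exists i, u i z != 0) ->
  exists2 H, hol a rho H & forall i z, nm (z - a) < rho -> h i z = u i z * H z.
Proof.
move=> hh hu hc hn.
have ex z : exists y, nm (z - a) < rho -> forall i, h i z = u i z * y.
  have [hz|hz] := boolP (nm (z - a) < rho); last by exists 0.
  have [j uj] := hn z hz; exists (h j z / u j z) => _ i.
  by rewrite mulrA [u i z * _]mulrC -hc// mulfK.
have [H hH] := choice ex; exists H; last by move=> i z hz; exact: hH.
move=> z hz; have [j uj] := hn z hz; have [d d0 hd] := hol_nz_near (hu j) hz uj.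
have sub k : hol a rho k -> hol z d k by apply: hol_sub => w /hd [].
suff hz0 : hol z d H by apply: hz0; rewrite subrr nm0.
have : hol z d (fun y => h j y * (u j y)^-1).
  by apply: holM; [exact: sub|apply: holV; [exact: sub|move=> y /hd []]].
by apply: hol_ext => y /hd [hy uy]; rewrite (hH y hy j) [u j y * _]mulrC mulfK.
Qed.

Lemma hol_div_list c (rho : R) (Z : seq C) h : hol c rho h -> uniq Z ->
  (forall a, a \in Z -> nm (a - c) < rho /\ h a = 0) ->
  exists2 k, hol c rho k & forall z, h z = (\prod_(a <- Z) (z - a)) * k z.
Proof.
elim: Z h => [|a Z IH] h hh /=; first by exists h => // z; rewrite big_nil mul1r.
move=> /andP[aZ uZ] hZ; have [ha ha0] := hZ a (mem_head _ _).
have [k1 hk1 E1] := hol_div hh ha ha0.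
have [k hk E2] : exists2 k, hol c rho k & forall z, k1 z = (\prod_(a <- Z) (z - a)) * k z.
  apply: IH => // b bZ; have [hb hb0] := hZ b (mem_behead (s := a :: Z) bZ).
  split => //; have /eqP := hb0; rewrite E1 mulf_eq0 subr_eq0 => /orP[/eqP e|/eqP //].
  by rewrite -e bZ in aZ.
by exists k => // z; rewrite E1 E2 big_cons mulrA.
Qed.

(** t lists the zeros with multiplicity, Z each of them once: a logarithmic derivative has simple
    poles only, so one factor z - a for each distinct zero clears it. *)
Lemma pole_free c (r : R) (t Z : seq C) u w : uniq Z -> {subset t <= Z} ->
  hol c r w -> (forall z, nm (z - c) < r -> w z != 0) ->
  (forall z, nm (z - c) < r -> u z = w z * \prod_(a <- t) (z - a)) ->
  exists2 l, hol c r l & forall z, nm (z - c) < r ->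
    cder u z * (\prod_(a <- Z) (z - a)) = u z * l z.
Proof.
move=> uZ sub hw w0 hu.
have hP (T : seq C) : hol c r (fun z => \prod_(a <- T) (z - a)).
  by apply: hol_prod => a _; exact: hol_poly1.
suff [l hl E] : exists2 l, hol c r l & forall z, nm (z - c) < r ->
    cder (fun z => w z * \prod_(a <- t) (z - a)) z * (\prod_(a <- Z) (z - a)) =
    (w z * \prod_(a <- t) (z - a)) * l z.
  exists l => // z hz; rewrite hu// -E//; congr (_ * _); symmetry.
  by apply: (cder_ext (a := c) (r := r)) => // [y hy|]; [rewrite hu|exact: holM].
elim: t sub {hu} => [|a t IH] sub.
  exists (fun z => (cder w z / w z) * \prod_(a <- Z) (z - a)).
    by apply: holM => //; apply: holM; [exact: hol_der|exact: holV].
  move=> z hz; have -> : cder (fun z => w z * \prod_(a <- [::]) (z - a)) z = cder w z.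
    symmetry; apply: (cder_ext (a := c) (r := r)) => // y hy; by rewrite big_nil mulr1.
  rewrite big_nil mulr1; set P := \prod_(a <- Z) _.
  by rewrite mulrA [w z * _]mulrC mulfVK// w0.
have [l hl E] := IH (fun b hb => sub b (mem_behead (s := a :: t) hb)).
exists (fun z => \prod_(b <- rem a Z) (z - b) + l z); first exact: holD.
move=> z hz; have aZ : a \in Z by apply: sub; exact: mem_head.
set u1 := fun z => w z * \prod_(a <- t) (z - a) in E.
have hu1 : hol c r u1 by exact: holM.
have EP : \prod_(b <- Z) (z - b) = (z - a) * \prod_(b <- rem a Z) (z - b).
  by rewrite (perm_big _ (perm_to_rem aZ)) big_cons.
have -> : cder (fun z => w z * \prod_(a0 <- (a :: t)) (z - a0)) z = u1 z + (z - a) * cder u1 z.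
  apply: cderE; have h1 := cder_poly1 z a 1; have h2 := is_cderM h1 (hol_cder hu1 hz).
  rewrite !mul1r in h2; move: h2; congr is_cder; apply/funext => y.
  by rewrite mul1r big_cons /u1; ring.
rewrite mulrDl -mulrA E// EP big_cons -/(u1 z) /u1; ring.
Qed.

Lemma expR_half (y : R) : 0 <= y -> y <= 1 -> expR (y / 2) <= 1 + y.
Proof.
move=> y0 y1; have h : 1 - y / 2 <= expR (- (y / 2)) by apply: expR_ge1Dx.
rewrite expRN in h; have e0 := expR_gt0 (y / 2).
have p0 : 0 < 1 - y / 2 by lra.
apply: le_trans (_ : _ <= (1 - y / 2)^-1) _.
  by rewrite -[leLHS]invrK lef_pV2 ?posrE ?invr_gt0.
rewrite -[leLHS]mul1r ler_pdivrMr//; nra.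
Qed.

(** As exp(y/2) <= 1 + y for y in [0, 1], a bound on a power of 1 + y bounds the exponent; this
    turns the gain of Blaschke factors into a count of zeros. *)
Lemma expR_count (y A : R) m : 0 < y -> y <= 1 -> (1 + y) ^+ m <= expR A ->
  m%:R <= 2 * A / y.
Proof.
move=> y0 y1 h.
have : expR (m%:R * (y / 2)) <= expR A.
  rewrite expRM_natl; apply: le_trans h; rewrite lerXn2r ?nnegrE ?expR_ge0//.
    by rewrite addr_ge0// ltW.
  by apply: expR_half => //; exact: ltW.
rewrite ler_expR => h2; rewrite ler_pdivlMr//; lra.
Qed.

(** Jensen's count: each Blaschke factor removed from u raises the value at 0 by at least r1/r2 >= 1
    + 1/(10x), while the total gain is at most exp A; hence at most 20 x A zeros. What remains after
    the removal is zero-free, which yields the last two clauses. *)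
Lemma zero_list (x eta A : R) u : 1 <= x -> 0 < eta -> 0 < A -> hol 0 (10 * x * eta) u ->
  u 0 != 0 -> (forall z, nm z = 10 * x * eta - eta -> nm (u z) <= nm (u 0) * expR A) ->
  exists t : seq C, [/\ (size t)%:R <= 20 * x * A,
   forall a, a \in t -> nm a < 10 * x * eta - 2 * eta /\ u a = 0,
   forall Z, uniq Z -> {subset t <= Z} ->
     exists2 l, hol 0 (10 * x * eta - 2 * eta) l & forall z, nm (z - 0) < 10 * x * eta - 2 * eta ->
       cder u z * (\prod_(a <- Z) (z - a)) = u z * l z &
   forall tau r z, 0 < tau -> 0 <= r -> r + 4 * eta <= 10 * x * eta - 2 * eta -> nm z <= r ->
     (forall a, a \in t -> tau <= nm (z - a)) ->
     u z != 0 /\ nm (cder u z / u z) <= (size t)%:R * (tau^-1 + eta^-1) + 2 * A * (r + 2 * eta) / eta ^+ 2].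
Proof.
move=> x1 eta0 A0 hu u0 hB.
set RR := 10 * x * eta; set r1 := RR - eta; set r2 := RR - 2 * eta.
have xe : eta <= x * eta by rewrite ler_pMl.
have RRE : RR = 10 * (x * eta) by rewrite /RR mulrA.
have r20 : 0 < r2 by rewrite /r2 RRE; lra.
have r21 : r2 < r1 by rewrite /r1 /r2; lra.
have r1R : r1 < RR by rewrite /r1; lra.
have r12 : r1 - r2 = eta by rewrite /r1 /r2; ring.
have [t [v [hv ht Et vB [v0 vnz]]]] := @blaschke_factor R unit tt (fun=> u) RR r1 r2 _ r20 r21 r1R
  (fun=> hu) (fun=> hB) u0.
set v1 := v tt in hv *.
have r10 : 0 < r1 := lt_trans r20 r21.
have q1 : r2 / r1 <= 1 by rewrite ler_pdivrMr// mul1r ltW.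
have q0 : 0 <= r2 / r1 by rewrite divr_ge0// ltW.
have uv0 : nm (u 0) <= nm (v1 0).
  by apply: le_trans v0 _; rewrite ler_piMr ?nm_ge0// exprn_ile1.
have vz z : nm z < r2 -> v1 z != 0 by move=> /vnz [[]].
have t0 a : a \in t -> u a = 0.
  move=> ta; have := Et tt a; have -> : bnum r1 t a = 0.
    by rewrite /bnum (big_rem a)//= subrr mulr0 mul0r.
  rewrite mulr0 => /eqP; rewrite mulf_eq0 => /orP[/eqP //|].
  rewrite /bden prodf_seq_eq0 => /hasP[b bt /= /eqP e].
  have := @blaschke_den R r1 r2 b a (ht b bt).1 r21 (ltW (lt_trans (ht a ta).1 r21)).
  by rewrite e nm0 leNgt mulr_gt0// r12.
exists t; split.
- have m1 : (1 + (10 * x)^-1) ^+ size t <= expR A.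
    have h1 : nm (v1 0) <= nm (u 0) * expR A.
      apply: (maxmod0 (hv tt) r1R) => [z hz|]; first exact: vB.
      by rewrite nm0 ltW.
    have up : 0 < nm (u 0) by rewrite nm_gt0.
    have vp : 0 < nm (v1 0) by exact: lt_le_trans up uv0.
    have h2 : (r1 / r2) ^+ size t <= expR A.
      have q2 : 0 < (r2 / r1) ^+ size t by rewrite exprn_gt0// divr_gt0.
      have -> : r1 / r2 = (r2 / r1)^-1 by rewrite invf_div.
      rewrite exprVn -[leLHS]mul1r ler_pdivrMr//.
      rewrite -(ler_pM2l up) mulr1; apply: le_trans v0 _.
      by rewrite mulrA; apply: ler_wpM2r => //; exact: ltW.
    apply: le_trans h2; rewrite lerXn2r ?nnegrE//.
    + by rewrite addr_ge0// invr_ge0; lra.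
    + by rewrite divr_ge0// ltW.
    + rewrite ler_pdivlMr// mulrDl mul1r.
      have : (10 * x)^-1 * r2 <= eta.
        by rewrite mulrC ler_pdivrMr; [rewrite /r2 RRE; lra|lra].
      rewrite /r1 /r2; lra.
  have := expR_count (y := (10 * x)^-1) _ _ m1; rewrite invrK => h.
  apply: le_trans (h _ _) _; [by rewrite invr_gt0; lra|by rewrite invf_le1; lra|].
  by rewrite le_eqVlt; apply/orP; left; apply/eqP; ring.
- by move=> a ta; split; [exact: (ht a ta).1|exact: t0].
- move=> Z uZ sub.
  have den z : nm (z - 0) < r2 -> bden r1 t z != 0.
    rewrite subr0 => hz; rewrite /bden prodf_seq_neq0; apply/allP => b bt /=.
    rewrite -nm_gt0; apply: lt_le_trans (blaschke_den (ht b bt).1 r21 _).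
      by rewrite r12 mulr_gt0.
    exact: ltW (lt_trans hz r21).
  apply: (@pole_free 0 r2 t Z u (fun z => v1 z * r1%:C%C ^+ size t / bden r1 t z)) => //.
  + apply: holM; last first.
      apply: holV => //; apply: hol_prod => b _; exact: hol_bden.
    apply: holM; last exact: hol_cst.
    by apply: hol_le (hv tt); exact: ltW (lt_trans r21 r1R).
  + move=> z hz; have hz' := hz; rewrite subr0 in hz'.
    rewrite !mulf_neq0 ?vz ?invr_eq0 ?den// expf_neq0//.
    by rewrite -nm_gt0 nm_real gtr0_norm.
  + move=> z hz; have := Et tt z; have d0 := den z hz.
    have -> : bnum r1 t z = r1%:C%C ^+ size t * \prod_(a <- t) (z - a).
      by rewrite /bnum big_split /= big_const_seq count_predT iter_mulr_1.
    by move=> E; rewrite -[LHS](mulfK d0) E /v1; field.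
- move=> tau r z tau0 r0 hr hz hta; rewrite -[in eta^-1]r12.
  apply: (@logder_bound R u v1 t RR r1 r2 r eta A tau) => //.
  + exact: hv.
  + by move=> a /ht [].
  + by move=> y; exact: Et.
  + by move=> y hy; apply: le_trans (vB tt y hy) _; apply: ler_wpM2r => //; exact: expR_ge0.
Qed.

End Quotients.

(** * The Wronskian against the product of a family and of its sum *)

Section Side.
Variables (R : realType) (s : nat).
Local Notation C := R[i].
Implicit Types (u : 'I_s -> C -> C) (z : C).

(* [None] stands for the sum of the family, which enters on the same footing as its members. *)
Definition usum u (o : option 'I_s) : C -> C :=
  if o is Some k then u k else fun z => \sum_k u k z.

Definition uprod u z : C := (\sum_k u k z) * \prod_k u k z.

Definition uswap u k : 'I_s -> C -> C :=
  fun j => if j == k then (fun w => \sum_i u i w) else u j.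

Lemma uswapE u k j : uswap u k j = usum u (if j == k then None else Some j).
Proof. by rewrite /uswap; case: eqP. Qed.

Lemma uprod_swap u k z : uprod u z = (\prod_j uswap u k j z) * u k z.
Proof.
rewrite /uprod [Y in _ * Y = _](bigD1 k)//= [in RHS](bigD1 k)//= /uswap eqxx.
rewrite [u k z * _]mulrC mulrA; congr (_ * _ * _).
by apply: eq_bigr => j /negbTE ->.
Qed.

Lemma uprod_neq0 u z : (forall o, usum u o z != 0) -> uprod u z != 0.
Proof.
move=> h; rewrite mulf_neq0 ?(h None)// prodf_seq_neq0; apply/allP => k _.
exact: (h (Some k)).
Qed.

Lemma hol_usum a (rho : R) u o : (forall k, hol a rho (u k)) -> hol a rho (usum u o).
Proof. by move=> h; case: o => [k|] //=; apply: hol_sum. Qed.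

Lemma hol_uprod a (rho : R) u : (forall k, hol a rho (u k)) -> hol a rho (uprod u).
Proof. by move=> h; apply: holM; [apply: hol_sum|apply: hol_prod]. Qed.

(** Replacing u_k by the sum keeps the Wronskian W and turns the product of the family into [uprod]
    / u_k. So P^e W u_k = [uprod] H_k for every k, with e = s(s-1)/2, and the quotients H_k / u_k
    glue because the u_k have no common zero. Away from the zeros the same exchange bounds W u_k by
    [uprod] for every k; the additional factor u_k is what [poly_lower] exploits. *)
Lemma zeros_family (x eta A : R) u : 1 <= x -> 0 < eta -> 0 < A ->
  (forall k, hol 0 (10 * x * eta) (u k)) -> (forall o, usum u o 0 != 0) ->
  (forall o z, nm z = 10 * x * eta - eta -> nm (usum u o z) <= nm (usum u o 0) * expR A) ->
  exists T : seq C, [/\ (size T)%:R <= s.+1%:R * (20 * x * A),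
   forall a, a \in T -> nm a < 10 * x * eta - 2 * eta /\ exists o, usum u o a = 0,
   forall Z, uniq Z -> {subset T <= Z} ->
     (forall z, nm (z - 0) < 10 * x * eta - 2 * eta -> exists k, u k z != 0) ->
     exists2 H, hol 0 (10 * x * eta - 2 * eta) H & forall z, nm (z - 0) < 10 * x * eta - 2 * eta ->
       (\prod_(a <- Z) (z - a)) ^+ (\sum_(i < s) i) * wronsk u z = uprod u z * H z &
   forall tau z, 0 < tau -> tau <= eta -> nm z <= 10 * x * eta - 7 * eta ->
     (forall a, a \in T -> 2 * tau <= nm (z - a)) ->
     uprod u z != 0 /\ forall k, nm (wronsk u z) * nm (u k z) <=
       s`!%:R * (1 + 20 * x * A * (tau^-1 + eta^-1) + 2 * A * (10 * x * eta) / eta ^+ 2 + 2 * s%:R / tau)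
          ^+ (s * s) * nm (uprod u z)].
Proof.
move=> x1 eta0 A0 hu u0 hB; set RR := 10 * x * eta in hu hB *; set r2 := RR - 2 * eta.
have xe : eta <= x * eta by rewrite ler_pMl.
have RRE : RR = 10 * (x * eta) by rewrite /RR mulrA.
have x0 : 0 < x by lra.
have huo o : hol 0 RR (usum u o) by exact: hol_usum.
have [t ht] := choice (fun o => zero_list x1 eta0 A0 (huo o) (u0 o) (hB o)).
have tT o : {subset t o <= flatten [seq t o | o <- enum {: option 'I_s}]}.
  by move=> a ha; apply/flatten_mapP; exists o => //; rewrite mem_enum.
have r2R : r2 <= RR by rewrite /r2; lra.
have r20 : 0 < r2 by rewrite /r2 RRE; lra.
have hu2 k : hol 0 r2 (u k) by apply: hol_le (hu k).
exists (flatten [seq t o | o <- enum {: option 'I_s}]); split.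
- rewrite size_flatten /shape -map_comp sumnE big_map natr_sum big_enum /=.
  apply: le_trans (_ : _ <= \sum_(o : option 'I_s) (20 * x * A)) _.
    by apply: ler_sum => o _; case: (ht o).
  by rewrite sumr_const card_option card_ord -[_ *+ s.+1]mulr_natl.
- move=> a /flatten_mapP [k0 _ ha]; have [_ h _ _] := ht k0; have [h1 h2] := h a ha.
  by split => //; exists k0.
- move=> Z uZ sub nz; set P := fun z => \prod_(a <- Z) (z - a).
  have hP : hol 0 r2 P by apply: hol_prod => a _; exact: hol_poly1.
  have hsw k j : hol 0 r2 (uswap u k j) by rewrite uswapE; exact: hol_usum.
  have ex k : exists H, hol 0 r2 H /\ forall z, nm (z - 0) < r2 ->
      P z ^+ (\sum_(i < s) i) * wronsk u z * u k z = uprod u z * H z.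
    have [|H hH E] := wronsk_divides hP (hsw k).
      move=> j; rewrite uswapE; set o := if _ then _ else _.
      have [_ _ h _] := ht o; have [l hl E] := h Z uZ (fun a ha => sub a (tT o a ha)).
      by exists l.
    exists H; split => // z hz; rewrite (uprod_swap u k) -(wronsk_sum k hu2 hz).
    by rewrite (E z hz) mulrAC.
  have [H hH] := choice ex.
  have cons i j z : nm (z - 0) < r2 -> H i z * u j z = H j z * u i z.
    move=> hz; apply/eqP; rewrite -subr_eq0; apply/eqP; move: z hz.
    apply: (@hol_mul_eq0 R 0 r2 (uprod u) (fun z => H i z * u j z - H j z * u i z) 0).
    + exact: hol_uprod.
    + by apply: holB; apply: holM; try exact: hu2; case: (hH i); case: (hH j).
    + by rewrite subrr nm0.
    + exact: uprod_neq0.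
    + move=> z hz; rewrite mulrBr !mulrA -(hH i).2// -(hH j).2//; ring.
  have [H0 hH0 EH0] := hol_glue_quot (fun k => (hH k).1) hu2 cons nz.
  exists H0 => // z hz; have [k uk] := nz z hz; apply: (mulIf uk).
  by rewrite (hH k).2// EH0//; ring.
- move=> tau z tau0 te hz hT.
  set K0 := 20 * x * A * (tau^-1 + eta^-1) + 2 * A * RR / eta ^+ 2.
  have i0 : 0 < tau^-1 + eta^-1 by rewrite addr_gt0 ?invr_gt0.
  have K00 : 0 <= K0.
    apply: addr_ge0; first by rewrite !mulr_ge0 ?(ltW i0) ?(ltW A0) ?(ltW x0).
    by rewrite divr_ge0 ?sqr_ge0// RRE !mulr_ge0 ?(ltW A0) ?(ltW x0) ?(ltW eta0).
  have near o w : nm (w - z) < tau -> usum u o w != 0 /\ nm (cder (usum u o) w / usum u o w) <= K0.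
    move=> hw; have [h1 _ _ h4] := ht o.
    have wz : nm w <= nm z + tau.
      by rewrite -[w](subrK z) addrC; apply: le_trans (nmD _ _) _; rewrite lerD2l ltW.
    (* w stays within RR - 7 eta + tau <= RR - 6 eta, and [zero_list] asks for a margin of 4 eta
       below RR - 2 eta. *)
    have [|||||nz b] := h4 tau (RR - 6 * eta) w => //.
    + by rewrite RRE; lra.
    + by rewrite /r2 -/RR; lra.
    + by apply: le_trans wz _; lra.
    + move=> a ha; have := hT a (tT o a ha).
      have -> : z - a = (w - a) - (w - z) by ring.
      by move=> h; have := le_trans h (nmB _ _); lra.
    split => //; apply: le_trans b _; rewrite /K0; apply: lerD.
      by apply: ler_wpM2r => //; exact: ltW.
    apply: ler_wpM2r; first by rewrite invr_ge0 sqr_ge0.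
    by apply: ler_wpM2l; [rewrite mulr_ge0// ltW|lra].
  have z0 : nm (z - z) < tau by rewrite subrr nm0.
  split; first by apply: uprod_neq0 => o; case: (near o z z0).
  have hz1 : nm (z - 0) < r2 by rewrite subr0 /r2; apply: le_lt_trans hz _; lra.
  have hol_z o : hol z tau (usum u o).
    apply: hol_sub (huo o) => w hw; rewrite subr0 -[w](subrK z) addrC.
    apply: le_lt_trans (nmD _ _) _; apply: lt_le_trans (_ : nm z + tau <= _); first by rewrite ltrD2l.
    lra.
  set K := 1 + _ + _ + _.
  have KE : K = 1 + (K0 + 2 * s%:R / tau) by rewrite /K /K0 !addrA.
  have st0 : 0 <= 2 * s%:R / tau by rewrite divr_ge0 ?mulr_ge0 ?ler0n// ltW.
  have Kp : 0 <= K0 + 2 * s%:R / tau by exact: addr_ge0.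
  have K1 : 1 <= K by rewrite KE lerDl addr_ge0.
  have der o i : (i < s)%N -> nm (dn i (usum u o) z) <= K ^+ i * nm (usum u o z).
    move=> ilt; apply: le_trans (logder_iter tau0 K00 (hol_z o) _ _ ilt) _.
    + by move=> w /(near o) [].
    + by move=> w /(near o) [].
    apply: ler_wpM2r; first exact: nm_ge0.
    by rewrite KE; apply: lerXn2r; rewrite ?nnegrE; [exact: addr_ge0|lra|lra].
  move=> k; rewrite (uprod_swap u k) nmM mulrA; apply: ler_wpM2r; first exact: nm_ge0.
  rewrite -(wronsk_sum k hu2 hz1) nm_prod; apply: wronsk_bound => // i j.
  by rewrite -/(uswap u k j) uswapE; apply: der.
Qed.

End Side.

(** * Line fields and their representations *)

Section LineField.
Variables (R : realType) (N : nat).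
Local Notation C := R[i].
Local Notation A := (mpoly N.+1 R[i]).
Implicit Types (x y : 'I_N.+1 -> C) (F G : 'I_N.+1 -> C -> C) (L : C -> ('I_N.+1 -> C) -> Prop).

(** Proportionality through the 2 x 2 minors: a closed condition, fit for the identity theorem. The
    zero vector is parallel to everything, whence the conditions of nonvanishing that accompany
    it. *)
Definition par x y := forall i j, x i * y j = x j * y i.

(* A holomorphic line field: L z is a line through the origin (lf_par and lf_sub) that has a local
   holomorphic nonvanishing section (lf_sec). *)
Record linefield L : Prop := LineField {
  lf_par : forall z x y, L z x -> L z y -> par x y;
  lf_sub : forall z x y, L z y -> (exists i, y i != 0) -> par x y -> L z x;
  lf_sec : forall z, exists d k, [/\ 0 < d, forall i, hol z d (k i) &
    forall w, nm (w - z) < d -> L w (fun i => k i w) /\ exists i, k i w != 0] }.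

Lemma lf_scale L z x c : linefield L -> L z x -> L z (fun i => c * x i).
Proof.
move=> hL hx; have [d [k [d0 _ hk]]] := lf_sec hL z.
have [|h1 h2] := hk z; first by rewrite subrr nm0.
apply: (lf_sub hL h1 h2) => i j; rewrite -!mulrA; congr (_ * _); exact: (lf_par hL hx h1).
Qed.

(** Where w is nonzero F is parallel to a local section; the minors of F with the section are
    holomorphic, so they vanish at the zeros of w too. *)
Lemma lf_quot L c (rho : R) (w : C -> C) F z0 : linefield L -> hol c rho w -> nm (z0 - c) < rho ->
  w z0 != 0 -> (forall i, hol c rho (F i)) ->
  (forall z, nm (z - c) < rho -> L z (fun i => w z * F i z)) ->
  forall z, nm (z - c) < rho -> L z (fun i => F i z).
Proof.
move=> hL hw hz0 wz0 hF hLw a ha; have [d [k [d0 hk hkL]]] := lf_sec hL a.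
have [d1 d10 hd1] := disc_open ha.
pose e := Num.min d d1; have e0 : 0 < e by rewrite lt_min d0.
have sub1 z : nm (z - a) < e -> nm (z - c) < rho by rewrite lt_min => /andP[_ /hd1].
have sub2 z : nm (z - a) < e -> nm (z - a) < d by rewrite lt_min => /andP[].
have aa : nm (a - a) < e by rewrite subrr nm0.
have [|h1 h2] := hkL a; first exact: sub2.
apply: (lf_sub hL h1 h2) => i j; apply/eqP; rewrite -subr_eq0; apply/eqP.
have [z1 hz1 wz1] : exists2 z1, nm (z1 - a) < e & w z1 != 0.
  apply: contrapT => hn; case/eqP: wz0.
  apply: (hol_identity_gen hw ha e0) => // z hz; apply: contrapT => /eqP wz; by apply: hn; exists z.
have hFe l : hol a e (F l) by apply: hol_sub (hF l) => z; exact: sub1.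
have hke l : hol a e (k l) by apply: hol_sub (hk l) => z; exact: sub2.
apply: (@hol_mul_eq0 R a e w (fun z => F i z * k j z - F j z * k i z) z1) => //.
- by apply: hol_sub hw => z; exact: sub1.
- by apply: holB; apply: holM.
move=> z hz; have [hk1 _] := hkL z (sub2 z hz).
have := lf_par hL (hLw z (sub1 z hz)) hk1 i j; rewrite -!mulrA mulrBr => ->; exact: subrr.
Qed.

(** Common zeros are removed by Blaschke factors, which keep the bound on the circle. They can only
    raise |F_0(0)| = 1, so the final normalisation at 0 does not spoil the bound. *)
Lemma clean_rep L F (rho r1 r2 B : R) : linefield L -> 0 < r2 -> r2 < r1 -> r1 < rho ->
  (forall i, hol 0 rho (F i)) -> (forall z, nm (z - 0) < rho -> L z (fun i => F i z)) ->
  F ord0 0 = 1 -> (forall i z, nm z = r1 -> nm (F i z) <= B) ->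
  exists F', [/\ forall i, hol 0 rho (F' i), forall z, nm (z - 0) < rho -> L z (fun i => F' i z),
    F' ord0 0 = 1, forall i z, nm z = r1 -> nm (F' i z) <= B &
    forall z, nm (z - 0) < r2 -> exists i, F' i z != 0].
Proof.
move=> hL r20 r21 r1r hF hLF F0 hB.
have F0' : F ord0 0 != 0 by rewrite F0 oner_neq0.
have [t [v [hv ht Et vB [v0 vnz]]]] := blaschke_factor r20 r21 r1r hF hB F0'.
have r10 : 0 < r1 := lt_trans r20 r21.
have v1 : 1 <= nm (v ord0 0).
  rewrite -(nm1 R) -{1}F0; apply: le_trans v0 _; rewrite ler_piMr ?nm_ge0// exprn_ile1//.
    by rewrite divr_ge0// ltW.
  by rewrite ler_pdivrMr// mul1r ltW.
have vp : 0 < nm (v ord0 0) by exact: lt_le_trans ltr01 v1.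
have vn : v ord0 0 != 0 by rewrite -nm_gt0.
have hLv z : nm (z - 0) < rho -> L z (fun i => v i z).
  apply: (@lf_quot L 0 rho (bnum r1 t) v 0) => //.
  - by apply: hol_prod => a _; apply: holM; [exact: hol_cst|exact: hol_poly1].
  - by rewrite subrr nm0 (lt_trans r10).
  - rewrite /bnum prodf_seq_neq0; apply/allP => a /ht [_ a0] /=.
    rewrite sub0r mulf_neq0 ?oppr_eq0//.
    by rewrite -nm_gt0 nm_real gtr0_norm.
  move=> y hy; have -> : (fun i => bnum r1 t y * v i y) = (fun i => bden r1 t y * F i y).
    by apply/funext => i; rewrite mulrC -Et mulrC.
  by apply: lf_scale => //; exact: hLF.
exists (fun i z => (v ord0 0)^-1 * v i z); split.
- by move=> i; apply: holM; [exact: hol_cst|].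
- by move=> z hz; apply: lf_scale => //; exact: hLv.
- by rewrite mulVf.
- move=> i z hz; rewrite nmM nmV; apply: le_trans (vB i z hz); rewrite ler_piMl ?nm_ge0//.
  by rewrite invf_le1.
- move=> z; rewrite subr0 => /vnz [i vi]; exists i; by rewrite mulf_neq0 ?invr_eq0.
Qed.

Section Family.
Variables (s n : nat) (p : 'I_s -> A).
Hypothesis n_gt0 : (0 < n)%N.
Hypothesis hp : forall k, p k \is ishomog1 n mdeg.

Definition ufam F : 'I_s -> C -> C := fun k z => meval (fun i => F i z) (p k).

Definition pval (o : option 'I_s) x : C :=
  if o is Some k then meval x (p k) else \sum_k meval x (p k).

Lemma usum_ufam F o z : usum (ufam F) o z = pval o (fun i => F i z).
Proof. by case: o. Qed.

Lemma hol_ufam a (rho : R) F k : (forall i, hol a rho (F i)) -> hol a rho (ufam F k).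
Proof. exact: hol_meval. Qed.

Lemma pval_bound : exists2 K, 0 < K & forall o x B, (forall i, nm (x i) <= B) -> 0 <= B ->
  nm (pval o x) <= K * B ^+ n.
Proof.
have ex k : exists K, 1 <= K /\ forall x B, (forall i, nm (x i) <= B) -> 0 <= B ->
    nm (meval x (p k)) <= K * B ^+ n.
  by have [K K1 hK] := meval_bound (hp k); exists K.
have [K hK] := choice ex.
have K0 k : 0 <= K k by apply: le_trans ler01 (hK k).1.
exists (1 + \sum_k K k); first by rewrite ltr_pwDl// sumr_ge0.
move=> o x B hx B0; have Bn : 0 <= B ^+ n by exact: exprn_ge0.
rewrite mulrDl mul1r; case: o => [k|] /=.
  apply: le_trans ((hK k).2 x B hx B0) _; apply: le_trans (_ : _ <= (\sum_k K k) * B ^+ n) _.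
    by apply: ler_wpM2r => //; rewrite (bigD1 k)//= lerDl sumr_ge0.
  by rewrite lerDr.
apply: le_trans (nm_sum _ _ _) _; apply: le_trans (_ : _ <= (\sum_k K k) * B ^+ n) _.
  by rewrite mulr_suml; apply: ler_sum => k _; exact: (hK k).2.
by rewrite lerDr.
Qed.

(** The ratio K / |p_o(x0)| is absorbed by an exponential through q <= exp q. The constant depends
    on the value x0 at 0 but not on F, so it can be kept along the iteration. *)
Lemma growth_const x0 : (forall o, pval o x0 != 0) -> exists2 c1, 0 < c1 &
  forall (c x r1 : R) F, c1 <= c -> 1 <= x -> (forall i, F i 0 = x0 i) ->
   (forall i z, nm z = r1 -> nm (F i z) <= expR x) -> forall o z, nm z = r1 ->
   nm (usum (ufam F) o z) <= nm (usum (ufam F) o 0) * expR (c * x).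
Proof.
move=> h0; have [K K0 hK] := pval_bound.
pose q o := K / nm (pval o x0).
have pp o : 0 < nm (pval o x0) by rewrite nm_gt0.
have q0 o : 0 < q o by rewrite divr_gt0.
exists (n%:R + \sum_o q o).
  by rewrite ltr_pwDl ?ltr0n// sumr_ge0// => o _; exact: ltW.
move=> c x r1 F hc x1 hF hB o z hz; rewrite !usum_ufam.
have -> : (fun i => F i 0) = x0 by apply/funext.
apply: le_trans (hK o _ _ (fun i => hB i z hz) (expR_ge0 _)) _.
rewrite -expRM_natl.
have -> : K = nm (pval o x0) * q o by rewrite /q mulrCA divff ?mulr1// gt_eqF.
rewrite -mulrA; apply: ler_wpM2l; first exact: nm_ge0.
apply: le_trans (_ : _ <= expR (q o) * expR (n%:R * x)) _.
  apply: ler_wpM2r; first exact: expR_ge0.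
  by apply: le_trans (expR_ge1Dx _); rewrite lerDr.
rewrite -expRD ler_expR; apply: le_trans (_ : _ <= (n%:R + \sum_o q o) * x) _.
  rewrite mulrDl addrC; apply: lerD => //.
  apply: le_trans (_ : _ <= \sum_o q o) _.
    by rewrite (bigD1 o)//= lerDl sumr_ge0// => o' _; exact: ltW.
  by rewrite ler_peMr// sumr_ge0// => o' _; exact: ltW.
by apply: ler_wpM2r => //; exact: le_trans ler01 x1.
Qed.

Lemma wronsk_ext a (rho : R) (u v : 'I_s -> C -> C) z : (forall k, hol a rho (u k)) ->
  (forall k w, nm (w - a) < rho -> u k w = v k w) -> nm (z - a) < rho ->
  wronsk u z = wronsk v z.
Proof.
move=> hu huv hz; rewrite /wronsk; congr (\det _); apply/matrixP => i k; rewrite !mxE.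
exact: (dn_ext (a := a) (rho := rho) i (huv k) (hu k) hz).
Qed.

(** Near 0 one has F = F_0 h, so the Wronskian of the p_k(F) is F_0^(n s) times that of the p_k(h),
    and F_0(0) = 1. *)
Lemma germ_invariant L F h (rho d : R) : linefield L -> 0 < rho -> 0 < d -> (forall i, hol 0 rho (F i)) ->
  (forall z, nm (z - 0) < rho -> L z (fun i => F i z)) -> F ord0 0 = 1 ->
  (forall i, hol 0 d (h i)) -> (forall z, nm (z - 0) < d -> L z (fun i => h i z) /\ h ord0 z = 1) ->
  (forall i, F i 0 = h i 0) /\ wronsk (ufam F) 0 = wronsk (ufam h) 0.
Proof.
move=> hL rho0 d0 hF hLF F0 hh hLh; pose e := Num.min rho d.
have e0 : 0 < e by rewrite lt_min rho0.
have zz : nm (0 - 0 : C) < e by rewrite subrr nm0.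
have E i z : nm (z - 0) < e -> F i z = F ord0 z * h i z.
  rewrite lt_min => /andP[z1 z2]; have [h1 h2] := hLh z z2.
  by have := lf_par hL (hLF z z1) h1 i ord0; rewrite h2 mulr1.
split; first by move=> i; rewrite E// F0 mul1r.
have hFe i : hol 0 e (F i) by apply: hol_le (hF i); rewrite ge_min lexx.
have hhe i : hol 0 e (h i) by apply: hol_le (hh i); rewrite ge_min lexx orbT.
rewrite (@wronsk_ext 0 e _ (fun k z => F ord0 z ^+ n * ufam h k z))//.
- rewrite (wronsk_scale (holX n (hFe ord0)) _ zz); last by move=> k; exact: hol_ufam.
  by rewrite F0 !expr1n mul1r.
- by move=> k; exact: hol_ufam.
move=> k w hw; rewrite /ufam -(meval_homog _ _ (hp k)); congr (meval _ _).
by apply/funext => i; exact: E.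
Qed.

End Family.

(** X and Y stand for the maxima of |F_i| and |G_j|, [Wf] and [Wg] for the Wronskians, [Df] and [Dg]
    for the products, [Gm] for the minor. Multiplying the two first estimates gives c^2 (XY)^(m+1) H
    <= l^2 P^m; the factor H2^m turns P^m into Gm^m <= (2XY)^m, and one factor XY survives. *)
Lemma circle_algebra (c X Y Wf Wg Df Dg H H2 P Gm l : R) m :
  0 <= X -> 0 <= Y -> 0 <= Wf -> 0 <= Wg -> 0 < Df -> 0 < Dg -> 0 <= H -> 0 <= H2 -> 0 <= P ->
  0 < c -> 0 <= l -> c * X ^+ m.+1 * Wf <= l * Df -> c * Y ^+ m.+1 * Wg <= l * Dg ->
  P ^+ m * (Wf * Wg) = Df * Dg * H -> Gm = P * H2 -> Gm <= 2 * (X * Y) ->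
  c ^+ 2 * (X * Y * (H * H2 ^+ m)) <= l ^+ 2 * 2 ^+ m.
Proof.
move=> X0 Y0 Wf0 Wg0 Df0 Dg0 H0 H20 P0 c0 l0 h1 h2 E EG hG.
have [XY|XY] := eqVneq (X * Y) 0.
  by rewrite XY mul0r mulr0 mulr_ge0 ?exprn_ge0.
have XYp : 0 < X * Y by rewrite lt_neqAle eq_sym XY mulr_ge0.
have XYm : 0 < (X * Y) ^+ m by rewrite exprn_gt0.
have Dp : 0 < Df * Dg by rewrite mulr_gt0.
have s1 : c ^+ 2 * (X * Y) ^+ m.+1 * (Wf * Wg) <= l ^+ 2 * (Df * Dg).
  have -> : c ^+ 2 * (X * Y) ^+ m.+1 * (Wf * Wg) = (c * X ^+ m.+1 * Wf) * (c * Y ^+ m.+1 * Wg).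
    by rewrite exprMn; ring.
  have -> : l ^+ 2 * (Df * Dg) = (l * Df) * (l * Dg) by ring.
  apply: ler_pM => //; by rewrite !mulr_ge0 ?exprn_ge0 ?(ltW c0).
have s2 : c ^+ 2 * (X * Y) ^+ m.+1 * H <= l ^+ 2 * P ^+ m.
  rewrite -(ler_pM2r Dp).
  have -> : c ^+ 2 * (X * Y) ^+ m.+1 * H * (Df * Dg) = c ^+ 2 * (X * Y) ^+ m.+1 * (Wf * Wg) * P ^+ m.
    by rewrite -!mulrA [Wf * _]mulrA [(Wf * Wg) * _]mulrC E; ring.
  apply: le_trans (ler_wpM2r _ s1) _; first exact: exprn_ge0.
  by rewrite -!mulrA le_eqVlt; apply/orP; left; apply/eqP; ring.
rewrite -(ler_pM2r XYm).
have -> : c ^+ 2 * (X * Y * (H * H2 ^+ m)) * (X * Y) ^+ m = c ^+ 2 * (X * Y) ^+ m.+1 * H * H2 ^+ m.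
  by rewrite [(X * Y) ^+ m.+1]exprS; ring.
apply: le_trans (ler_wpM2r _ s2) _; first exact: exprn_ge0.
rewrite -mulrA -exprMn -EG -[l ^+ 2 * 2 ^+ m * _]mulrA -exprMn; apply: ler_wpM2l; first exact: exprn_ge0.
by rewrite lerXn2r ?nnegrE// ?EG ?mulr_ge0 ?(ltW XYp).
Qed.

End LineField.

(** * Improving the bound of a representation *)

Lemma radii (R : realType) (x eta : R) : 1 <= x -> 0 < eta ->
  [/\ 0 < 10 * x * eta - 2 * eta, 10 * x * eta - 2 * eta < 10 * x * eta - eta,
      10 * x * eta - eta < 10 * x * eta & 10 * x * eta - 8 * eta < 10 * x * eta - 7 * eta].
Proof.
move=> x1 eta0; have xe : eta <= x * eta by rewrite ler_pMl.
have -> : 10 * x * eta = 10 * (x * eta) by rewrite mulrA.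
by split; lra.
Qed.

Lemma radius_choice (R : realType) (rho eta r y : R) : 0 < eta -> rho - 8 * eta < r ->
  r < rho - 7 * eta -> 0 <= y -> [/\ r < rho - 2 * eta, rho - 10 * eta <= r & 1 <= 4 * (2 * y + 1)].
Proof. by move=> *; split; lra. Qed.

Lemma step_const_gt0 (R : realType) (c y t : R) : 0 < c -> 0 < y -> 0 <= t ->
  0 < 1 + 20 * c * (40 * y + 10) + 200 * c + 80 * t * y.
Proof.
move=> c0 y0 t0; have cy : 0 <= c * y by rewrite mulr_ge0// ltW.
have ty : 0 <= t * y by rewrite mulr_ge0// ltW.
have -> : 1 + 20 * c * (40 * y + 10) + 200 * c + 80 * t * y =
  1 + 800 * (c * y) + 400 * c + 80 * (t * y) by ring.
by lra.
Qed.

Section Step.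
Variables (R : realType) (N s m : nat) (p : 'I_s -> mpoly N.+1 R[i]).
Local Notation C := R[i].
Implicit Types (F G : 'I_N.+1 -> C -> C).
Variables (Lf Lg : C -> ('I_N.+1 -> C) -> Prop).

(* A bounded representation on |z| < rho of the image of (f, g) under the Segre embedding. *)
Definition srep (rho B : R) := exists E : 'I_N.+1 -> 'I_N.+1 -> C -> C,
  [/\ forall i j, hol 0 rho (E i j), forall i j z, nm (z - 0) < rho -> nm (E i j z) <= B,
      forall j z, nm (z - 0) < rho -> Lf z (fun i => E i j z),
      forall i z, nm (z - 0) < rho -> Lg z (fun j => E i j z) & E ord0 ord0 0 = 1].

Hypothesis hp : forall k, p k \is ishomog1 m.+1 mdeg.
Hypothesis hz : forall x, (forall k, meval x (p k) = 0) -> forall i, x i = 0.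
Hypothesis hsm : (2 * (\sum_(i < s) i) <= m)%N.
Hypothesis hLf : linefield Lf.
Hypothesis hLg : linefield Lg.
Hypothesis agree : forall z x y o, Lf z x -> Lg z y -> (exists i, x i != 0) ->
  (exists i, y i != 0) -> pval p o x = 0 \/ pval p o y = 0 -> par x y.
Variables (d : R) (hf hg : 'I_N.+1 -> C -> C) (i0 j0 : 'I_N.+1).
Hypothesis d_gt0 : 0 < d.
Hypothesis hhf : forall i, hol 0 d (hf i).
Hypothesis hhg : forall i, hol 0 d (hg i).
Hypothesis hLhf : forall z, nm (z - 0) < d -> Lf z (fun i => hf i z) /\ hf ord0 z = 1.
Hypothesis hLhg : forall z, nm (z - 0) < d -> Lg z (fun i => hg i z) /\ hg ord0 z = 1.
Hypothesis pf0 : forall o, pval p o (fun i => hf i 0) != 0.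
Hypothesis pg0 : forall o, pval p o (fun i => hg i 0) != 0.
Hypothesis Wf0 : wronsk (ufam p hf) 0 != 0.
Hypothesis Wg0 : wronsk (ufam p hg) 0 != 0.
Hypothesis Gm0 : hf i0 0 * hg j0 0 - hf j0 0 * hg i0 0 != 0.

(* the value at 0 of the multiplier of step_raw: it does not depend on the representation *)
Let kappa : C := wronsk (ufam p hf) 0 * wronsk (ufam p hg) 0 *
  (hf i0 0 * hg j0 0 - hf j0 0 * hg i0 0) ^+ m / (uprod (ufam p hf) 0 * uprod (ufam p hg) 0).

(** The constant of [zeros_family] with A = c x, the growth that [growth_const] gives for
    coordinates bounded by exp x. *)
Let Kf c x eta tau : R := 1 + 20 * x * (c * x) * (tau^-1 + eta^-1) +
  2 * (c * x) * (10 * x * eta) / eta ^+ 2 + 2 * s%:R / tau.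

Lemma uprod_hf0 h : (forall o, pval p o (fun i => h i 0) != 0) -> uprod (ufam p h) 0 != 0.
Proof. by move=> h0; apply: uprod_neq0 => o; rewrite usum_ufam. Qed.

Lemma kappa_neq0 : kappa != 0.
Proof.
rewrite /kappa; apply: mulf_neq0; last by rewrite invr_eq0; apply: mulf_neq0; exact: uprod_hf0.
exact: mulf_neq0 (mulf_neq0 Wf0 Wg0) (expf_neq0 m Gm0).
Qed.

Lemma Kf_ge0 c x eta tau : 0 < c -> 0 < x -> 0 < eta -> 0 < tau -> 0 <= Kf c x eta tau.
Proof.
move=> h1 h2 h3 h4; rewrite /Kf; repeat apply: addr_ge0; first exact: ler01.
- by rewrite !mulr_ge0 ?addr_ge0 ?invr_ge0 ?(ltW h1) ?(ltW h2) ?(ltW h3) ?(ltW h4).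
- by rewrite !mulr_ge0 ?invr_ge0 ?sqr_ge0 ?(ltW h1) ?(ltW h2) ?(ltW h3).
- by rewrite !mulr_ge0 ?ler0n ?invr_ge0 ?(ltW h4).
Qed.

(* The new representation is F_i G_j Th / kappa, where P is the product over the distinct zeros,
   P ^+ m * (W_f W_g) = (product of all members) * H, the 2 x 2 minor is P * H2, and
   Th = H * H2 ^+ m; its bound holds on a circle that avoids the zeros. *)
Lemma step_raw c x eta : (forall x r1 F, 1 <= x -> (forall i, F i 0 = hf i 0) ->
   (forall i z, nm z = r1 -> nm (F i z) <= expR x) -> forall o z, nm z = r1 ->
   nm (usum (ufam p F) o z) <= nm (usum (ufam p F) o 0) * expR (c * x)) ->
  (forall x r1 F, 1 <= x -> (forall i, F i 0 = hg i 0) ->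
   (forall i z, nm z = r1 -> nm (F i z) <= expR x) -> forall o z, nm z = r1 ->
   nm (usum (ufam p F) o z) <= nm (usum (ufam p F) o 0) * expR (c * x)) ->
  0 < c -> 1 <= x -> 0 < eta -> srep (10 * x * eta) (expR x) ->
  forall c0 tau, 0 < c0 -> (forall x i, exists k, c0 * nm (x i) ^+ m.+1 <= nm (meval x (p k))) ->
  0 < tau -> 4 * tau * (2 * (s.+1%:R * (20 * x * (c * x))) + 1) <= eta ->
  srep (10 * x * eta - 10 * eta)
    ((s`!%:R * (Kf c x eta tau) ^+ (s * s)) ^+ 2 * 2 ^+ m / c0 ^+ 2 / nm kappa).
Proof.
move=> gf gg c_gt0 x1 eta0 [E [hE EB hEf hEg E0]] c0 tau c00 hc0 tau0 htau.
set RR := 10 * x * eta in hE EB hEf hEg *.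
have x0 : 0 < x by exact: lt_le_trans ltr01 x1.
have cx0 : 0 < c * x by rewrite mulr_gt0.
set r2 := RR - 2 * eta; have [r20 r21 r1R albe] := radii x1 eta0.
have EB1 i j z : nm z = RR - eta -> nm (E i j z) <= expR x.
  by move=> hzr; apply: EB; rewrite subr0 hzr.
(* The first column of E represents f and the first row represents g, both with value 1 of the 0-th
   coordinate at 0. *)
have [F [hF hFL F0 FB Fnz]] := clean_rep hLf r20 r21 r1R (fun i => hE i ord0) (hEf ord0) E0
  (fun i z h => EB1 i ord0 z h).
have [G [hG hGL G0 GB Gnz]] := clean_rep hLg r20 r21 r1R (fun j => hE ord0 j) (hEg ord0) E0
  (fun j z h => EB1 ord0 j z h).
have RR0 : 0 < RR by exact: lt_trans (lt_trans r20 r21) r1R.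
have r2R : r2 <= RR by exact: ltW (lt_trans r21 r1R).
have [FE WFE] := germ_invariant hp hLf RR0 d_gt0 hF hFL F0 hhf hLhf.
have [GE WGE] := germ_invariant hp hLg RR0 d_gt0 hG hGL G0 hhg hLhg.
have huF k : hol 0 RR (ufam p F k) by exact: hol_ufam.
have huG k : hol 0 RR (ufam p G k) by exact: hol_ufam.
have uF0 o : usum (ufam p F) o 0 != 0.
  by rewrite usum_ufam (_ : (fun i => F i 0) = (fun i => hf i 0)) //; apply/funext.
have uG0 o : usum (ufam p G) o 0 != 0.
  by rewrite usum_ufam (_ : (fun i => G i 0) = (fun i => hg i 0)) //; apply/funext.
have [Tf [szf Tf1 Tf2 Tf3]] := zeros_family x1 eta0 cx0 huF uF0 (gf x _ F x1 FE FB).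
have [Tg [szg Tg1 Tg2 Tg3]] := zeros_family x1 eta0 cx0 huG uG0 (gg x _ G x1 GE GB).
pose T := Tf ++ Tg; pose Z := undup T.
have uZ : uniq Z by exact: undup_uniq.
have subf : {subset Tf <= Z} by move=> a ha; rewrite mem_undup mem_cat ha.
have subg : {subset Tg <= Z} by move=> a ha; rewrite mem_undup mem_cat ha orbT.
have unz F' : (forall z, nm (z - 0) < r2 -> exists i, F' i z != 0) ->
    forall z, nm (z - 0) < r2 -> exists k, ufam p F' k z != 0.
  move=> h z hz'; apply: contrapT => hn; have [i /eqP] := h z hz'; apply.
  by apply: (hz (x := fun i => F' i z)) => k; apply: contrapT => /eqP hk; apply: hn; exists k.
have [Hf hHf EHf] := Tf2 Z uZ subf (unz F Fnz).
have [Hg hHg EHg] := Tg2 Z uZ subg (unz G Gnz).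
pose Gm z := F i0 z * G j0 z - F j0 z * G i0 z.
have hGm : hol 0 r2 Gm.
  have hl h : hol 0 RR h -> hol 0 r2 h by exact: hol_le.
  by apply: holB; apply: holM; apply: hl.
have Z1 a : a \in Z -> nm (a - 0) < r2 /\ exists o,
    usum (ufam p F) o a = 0 \/ usum (ufam p G) o a = 0.
  rewrite mem_undup mem_cat subr0 => /orP[/Tf1|/Tg1] [h1 [k h2]]; split; try exact: h1; exists k.
    by left.
  by right.
have [|H2 hH2 EH2] := hol_div_list hGm uZ.
  move=> a /Z1 [ha [k hk]]; split => //.
  have haR : nm (a - 0) < RR by exact: lt_le_trans ha r2R.
  apply/eqP; rewrite subr_eq0; apply/eqP.
  apply: (agree (o := k) (hFL a haR) (hGL a haR) (Fnz a ha) (Gnz a ha)).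
  by rewrite !usum_ufam in hk.
pose P z := \prod_(a <- Z) (z - a).
have hP : hol 0 r2 P by apply: hol_prod => a _; exact: hol_poly1.
pose e := (\sum_(i < s) i)%N.
(* The two Wronskians consume P^e each; the surplus is stored in [H], so that P occurs to the power
   m, as in the m-th power of the minor. *)
pose H z := Hf z * Hg z * P z ^+ (m - 2 * e).
pose Th z := H z * H2 z ^+ m.
have hTh : hol 0 r2 Th.
  by apply: holM; [apply: holM; [exact: holM|exact: holX]|exact: holX].
have EH z : nm (z - 0) < r2 -> P z ^+ m * (wronsk (ufam p F) z * wronsk (ufam p G) z) =
    uprod (ufam p F) z * uprod (ufam p G) z * H z.
  move=> hz'; have h1 := EHf z hz'; have h2 := EHg z hz'.
  rewrite -/(P z) -/e in h1 h2.
  have -> : P z ^+ m = P z ^+ e * P z ^+ e * P z ^+ (m - 2 * e).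
    by rewrite -!exprD; congr (_ ^+ _); rewrite addnn -mul2n subnKC.
  rewrite /H -[LHS]/(P z ^+ e * P z ^+ e * P z ^+ (m - 2 * e) * (wronsk (ufam p F) z * wronsk (ufam p G) z)).
  transitivity ((P z ^+ e * wronsk (ufam p F) z) * (P z ^+ e * wronsk (ufam p G) z) * P z ^+ (m - 2 * e)).
    by ring.
  rewrite h1 h2; ring.
have z00 : nm (0 - 0 : C) < r2 by rewrite subrr nm0.
have Th0 : Th 0 = kappa.
  have DF : uprod (ufam p F) 0 = uprod (ufam p hf) 0.
    rewrite /uprod /ufam; have -> : (fun i => F i 0) = (fun i => hf i 0) by apply/funext.
    by [].
  have DG : uprod (ufam p G) 0 = uprod (ufam p hg) 0.
    rewrite /uprod /ufam; have -> : (fun i => G i 0) = (fun i => hg i 0) by apply/funext.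
    by [].
  have D0 : uprod (ufam p hf) 0 * uprod (ufam p hg) 0 != 0 by rewrite mulf_neq0 ?uprod_hf0.
  have h := EH 0 z00; rewrite DF DG WFE WGE in h.
  have hg2 : hf i0 0 * hg j0 0 - hf j0 0 * hg i0 0 = P 0 * H2 0 by rewrite -!FE -!GE -EH2.
  apply: (mulfI D0); rewrite /kappa hg2 [RHS]mulrC divfK// /Th mulrA -h exprMn; ring.
pose T' := [seq nm a | a <- T].
(* A circle whose radius is far from the moduli of the zeros is far from the zeros. The window has
   width eta, and [htau] says that its share for each zero is at least 2 tau. *)
have [r [r_lo r_hi hr]] := good_radius T' albe.
have szT : (size T')%:R <= 2 * (s.+1%:R * (20 * x * (c * x))).
  by rewrite size_map size_cat natrD mulr_natl mulr2n; apply: lerD.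
have M0 : 0 <= s.+1%:R * (20 * x * (c * x)).
  by rewrite !mulr_ge0 ?ler0n ?(ltW x0) ?(ltW c_gt0).
have [rr r10 M1] := radius_choice eta0 r_lo r_hi M0.
have far a z : nm z = r -> a \in T -> 2 * tau <= nm (z - a).
  move=> hzr ha; have h1 := hr (nm a) (map_f _ ha).
  apply: le_trans (_ : _ <= `|r - nm a|) _; last first.
    rewrite -hzr ler_norml; apply/andP; split; last exact: nm_sub.
    by rewrite lerNl opprB -nmBC; exact: nm_sub.
  apply: le_trans h1; rewrite ler_pdivlMr ?mulr_gt0 ?ltr0n//.
  have -> : RR - 7 * eta - (RR - 8 * eta) = eta by ring.
  apply: le_trans htau.
  have -> : (size T').+1%:R = (size T')%:R + 1 :> R by rewrite natr1.
  have -> : 2 * tau * (2 * ((size T')%:R + 1)) = 4 * tau * ((size T')%:R + 1) by ring.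
  by apply: ler_wpM2l; [rewrite mulr_ge0 ?(ltW tau0)|rewrite lerD2r].
have te : tau <= eta.
  apply: le_trans htau; rewrite -[leLHS]mulr1 -mulrA [leRHS]mulrCA; apply: ler_wpM2l; first exact: ltW.
  exact: M1.
pose l := s`!%:R * (Kf c x eta tau) ^+ (s * s).
have K0 : 0 <= Kf c x eta tau.
  exact: Kf_ge0.
have l0 : 0 <= l by rewrite mulr_ge0 ?ler0n ?exprn_ge0.
have bound z : nm z = r -> forall i j, nm (F i z * G j z * Th z) <= l ^+ 2 * 2 ^+ m / c0 ^+ 2.
  move=> hzr i j.
  have zr7 : nm z <= RR - 7 * eta by rewrite hzr ltW.
  have zr2 : nm (z - 0) < r2 by rewrite subr0 hzr.
  have [DF nF] := Tf3 tau z tau0 te zr7 (fun a ha => far a z hzr (ltac:(by rewrite mem_cat ha))).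
  have [DG nG] := Tg3 tau z tau0 te zr7 (fun a ha => far a z hzr (ltac:(by rewrite mem_cat ha orbT))).
  (* At the largest coordinate of F, [hc0] selects a member of the family of size at least c0
     |F|^(m+1); likewise for G. *)
  have [a _ ha] := arg_maxP (fun i => nm (F i z)) (erefl : xpredT i).
  have [b _ hb] := arg_maxP (fun i => nm (G i z)) (erefl : xpredT i).
  have [kf hkf] := hc0 (fun i => F i z) a.
  have [kg hkg] := hc0 (fun i => G i z) b.
  have cc0 : 0 < c0 ^+ 2 by rewrite exprn_gt0.
  rewrite ler_pdivlMr// mulrC.
  apply: le_trans (_ : _ <= c0 ^+ 2 * (nm (F a z) * nm (G b z) * (nm (H z) * nm (H2 z) ^+ m))) _.
    apply: ler_wpM2l; first exact: ltW.
    have -> : nm (F i z * G j z * Th z) = nm (F i z) * nm (G j z) * (nm (H z) * nm (H2 z) ^+ m).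
      by rewrite /Th (nmM (_ * _) (_ * _)) (nmM (F i z)) (nmM (H z)) nmX.
    apply: ler_wpM2r; first by apply: mulr_ge0; rewrite ?exprn_ge0 ?nm_ge0.
    exact: ler_pM (nm_ge0 _) (nm_ge0 _) (ha i isT) (hb j isT).
  have DF' : 0 < nm (uprod (ufam p F) z) by rewrite nm_gt0.
  have DG' : 0 < nm (uprod (ufam p G) z) by rewrite nm_gt0.
  apply: (@circle_algebra R c0 (nm (F a z)) (nm (G b z)) _ _ _ _ (nm (H z)) (nm (H2 z)) (nm (P z))
    (nm (Gm z)) l m (nm_ge0 _) (nm_ge0 _) (nm_ge0 (wronsk (ufam p F) z))
    (nm_ge0 (wronsk (ufam p G) z)) DF' DG' (nm_ge0 _) (nm_ge0 _) (nm_ge0 _) c00 l0).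
  - apply: le_trans (nF kf); rewrite [leRHS]mulrC; apply: ler_wpM2r; [exact: nm_ge0|exact: hkf].
  - apply: le_trans (nG kg); rewrite [leRHS]mulrC; apply: ler_wpM2r; [exact: nm_ge0|exact: hkg].
  - by rewrite -nmX -!nmM EH.
  - by rewrite EH2 nmM.
  apply: le_trans (nmB _ _) _; rewrite (nmM (F i0 z)) (nmM (F j0 z)) mulrDl mul1r.
  apply: lerD; apply: ler_pM; try exact: nm_ge0; by [exact: ha|exact: hb].
have k0 := kappa_neq0.
exists (fun i j z => kappa^-1 * (F i z * G j z * Th z)).
have rR : RR - 10 * eta <= RR by exact: le_trans (ltW (lt_trans (le_lt_trans r10 rr) r21)) (ltW r1R).
have hol2 i j : hol 0 r2 (fun z => kappa^-1 * (F i z * G j z * Th z)).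
  apply: holM; first exact: hol_cst.
  by apply: holM => //; apply: holM; [exact: hol_le (hF i)|exact: hol_le (hG j)].
split.
- by move=> i j; apply: hol_le (hol2 i j); exact: le_trans r10 (ltW rr).
- move=> i j z; rewrite subr0 => hz'; apply: (maxmod0 (hol2 i j) rr).
    move=> w hw; rewrite nmM nmV mulrC; apply: ler_wpM2r; first by rewrite invr_ge0 nm_ge0.
    exact: bound.
  by apply: ltW; apply: lt_le_trans hz' r10.
- move=> j z hz'; have -> : (fun i => kappa^-1 * (F i z * G j z * Th z)) =
     (fun i => (kappa^-1 * G j z * Th z) * F i z) by apply/funext => i; ring.
  by apply: lf_scale => //; apply: hFL; exact: lt_le_trans hz' rR.
- move=> i z hz'; have -> : (fun j => kappa^-1 * (F i z * G j z * Th z)) =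
     (fun j => (kappa^-1 * F i z * Th z) * G j z) by apply/funext => j; ring.
  by apply: lf_scale => //; apply: hGL; exact: lt_le_trans hz' rR.
- by rewrite F0 G0 Th0 !mul1r mulVf.
Qed.

Lemma srep_mono rho rho' B B' : rho' <= rho -> B <= B' -> srep rho B -> srep rho' B'.
Proof.
move=> hr hB [E [h1 h2 h3 h4 h5]]; exists E; split => //.
- by move=> i j; apply: hol_le (h1 i j).
- by move=> i j z hz'; apply: le_trans hB; apply: h2; exact: lt_le_trans hr.
- by move=> j z hz'; apply: h3; exact: lt_le_trans hr.
- by move=> i z hz'; apply: h4; exact: lt_le_trans hr.
Qed.

(** The worst term is 20 c x^2 / tau with 1/tau of order x^3, hence the fifth power. *)
Lemma Kf_poly c M x eta tau : 0 < c -> 0 <= M -> 1 <= x -> 0 < eta -> 0 < tau ->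
  eta^-1 <= 10 * x -> tau^-1 <= 40 * M * x ^+ 3 ->
  Kf c x eta tau <= (1 + 20 * c * (40 * M + 10) + 200 * c + 80 * s%:R * M) * x ^+ 5.
Proof.
move=> c1 M0 x1 eta0 tau0 he ht; have x0 : 0 < x := lt_le_trans ltr01 x1.
have pw (i j : nat) : (i <= j)%N -> x ^+ i <= x ^+ j by move=> ij; rewrite ler_weXn2l.
have -> : (1 + 20 * c * (40 * M + 10) + 200 * c + 80 * s%:R * M) * x ^+ 5 =
  x ^+ 5 + 20 * c * (40 * M + 10) * x ^+ 5 + 200 * c * x ^+ 5 + 80 * s%:R * M * x ^+ 5 by ring.
rewrite /Kf; apply: lerD; [apply: lerD; [apply: lerD|]|].
- exact: (pw 0%N).
- apply: le_trans (_ : _ <= 20 * x * (c * x) * (40 * M * x ^+ 3 + 10 * x ^+ 3)) _.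
    apply: ler_wpM2l; first by rewrite !mulr_ge0 ?(ltW x0) ?(ltW c1).
    by apply: lerD => //; apply: le_trans he _; apply: ler_wpM2l => //; exact: (pw 1%N).
  by rewrite le_eqVlt; apply/orP; left; apply/eqP; ring.
- apply: le_trans (_ : _ <= 200 * c * x ^+ 3) _; last first.
    by apply: ler_wpM2l; [exact: mulr_ge0 (ler0n _ 200) (ltW c1)|exact: pw].
  have -> : 2 * (c * x) * (10 * x * eta) / eta ^+ 2 = 20 * c * x ^+ 2 * eta^-1.
    by field; rewrite gt_eqF.
  have -> : 200 * c * x ^+ 3 = 20 * c * x ^+ 2 * (10 * x) by ring.
  by apply: ler_wpM2l => //; rewrite !mulr_ge0 ?exprn_ge0 ?(ltW x0) ?(ltW c1).
- apply: le_trans (_ : _ <= 2 * s%:R * (40 * M * x ^+ 3)) _.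
    by apply: ler_wpM2l => //; rewrite mulr_ge0.
  have -> : 2 * s%:R * (40 * M * x ^+ 3) = 80 * s%:R * M * x ^+ 3 by ring.
  by apply: ler_wpM2l; [rewrite !mulr_ge0|exact: pw].
Qed.

Lemma step : exists (K : R) k, 0 < K /\ forall x rho, 1 <= x -> 1 <= rho ->
  srep rho (expR x) -> srep (rho * (1 - x^-1)) (K * x ^+ k).
Proof.
have [cf cf0 hcf] := growth_const (ltn0Sn m) hp pf0.
have [cg cg0 hcg] := growth_const (ltn0Sn m) hp pg0.
have [c0 c00 hc0] := poly_lower (ltn0Sn m) hp hz.
have [c [c1 cfc cgc]] : exists c, [/\ 0 < c, cf <= c & cg <= c].
  by exists (cf + cg); rewrite addr_gt0// lerDl lerDr !ltW.
pose M := s.+1%:R * (20 * c); have M0 : 0 <= M by rewrite !mulr_ge0 ?ler0n ?(ltW c1).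
have Mp : 0 < 2 * M + 1 by apply: ltr_wpDl; [exact: mulr_ge0|exact: ltr01].
have [C4 C40 C4E] : exists2 C4, 0 < C4 &
    C4 = 1 + 20 * c * (40 * (2 * M + 1) + 10) + 200 * c + 80 * s%:R * (2 * M + 1).
  eexists; last by []; exact: step_const_gt0 c1 Mp (ler0n _ _).
have k0 : 0 < nm kappa by rewrite nm_gt0 kappa_neq0.
exists ((s`!%:R * C4 ^+ (s * s)) ^+ 2 * 2 ^+ m / c0 ^+ 2 / nm kappa), (5 * (s * s) * 2)%N; split.
  by rewrite !mulr_gt0 ?invr_gt0 ?exprn_gt0 ?mulr_gt0 ?exprn_gt0 ?ltr0n ?fact_gt0.
move=> x rho x1 rho1 hr; have x0 : 0 < x := lt_le_trans ltr01 x1.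
have r0 : 0 < rho := lt_le_trans ltr01 rho1.
have xn : x != 0 by rewrite gt_eqF.
(* Then 10 x eta = rho, and the radius 10 eta lost in [step_raw] is rho / x. *)
pose eta := rho / (10 * x); have eta0 : 0 < eta by rewrite divr_gt0 ?mulr_gt0.
have rE : 10 * x * eta = rho by rewrite /eta; field.
(* M x^2 bounds the number of zeros on each side, and (2M + 1) x^2 >= 2 M x^2 + 1 gives the
   requirement [htau]. *)
pose tau := eta / (4 * (2 * M + 1) * x ^+ 2).
have D0 : 0 < 4 * (2 * M + 1) * x ^+ 2 by rewrite !mulr_gt0 ?exprn_gt0.
have tau0 : 0 < tau by rewrite divr_gt0.
have htau : 4 * tau * (2 * (s.+1%:R * (20 * x * (c * x))) + 1) <= eta.
  rewrite /tau mulrA mulrAC ler_pdivrMr// mulrAC mulrC; apply: ler_wpM2l; first exact: ltW.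
  rewrite -[4 * _ * _]mulrA; apply: ler_wpM2l => //.
  have -> : 2 * (s.+1%:R * (20 * x * (c * x))) = 2 * M * x ^+ 2 by rewrite /M; ring.
  by rewrite [leRHS]mulrDl mul1r lerD2l exprn_ege1.
have gf x' r1 F : 1 <= x' -> (forall i, F i 0 = hf i 0) ->
   (forall i z, nm z = r1 -> nm (F i z) <= expR x') -> forall o z, nm z = r1 ->
   nm (usum (ufam p F) o z) <= nm (usum (ufam p F) o 0) * expR (c * x').
  exact: hcf.
have gg x' r1 F : 1 <= x' -> (forall i, F i 0 = hg i 0) ->
   (forall i z, nm z = r1 -> nm (F i z) <= expR x') -> forall o z, nm z = r1 ->
   nm (usum (ufam p F) o z) <= nm (usum (ufam p F) o 0) * expR (c * x').
  exact: hcg.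
have := step_raw gf gg c1 x1 eta0 _ c00 hc0 tau0 htau; rewrite rE => /(_ hr).
apply: srep_mono; first by rewrite le_eqVlt; apply/orP; left; apply/eqP; rewrite /eta; field.
have ri : rho^-1 <= 1 by rewrite invf_le1.
have e1 : eta^-1 <= 10 * x by rewrite /eta invf_div ler_piMr// mulr_ge0// ltW.
have hK : Kf c x eta tau <= C4 * x ^+ 5.
  rewrite C4E; apply: (Kf_poly c1 (ltW Mp) x1 eta0 tau0 e1).
  rewrite /tau invf_div; apply: le_trans (_ : _ <= 4 * (2 * M + 1) * x ^+ 2 * (10 * x)) _.
    by apply: ler_wpM2l => //; exact: ltW.
  by rewrite le_eqVlt; apply/orP; left; apply/eqP; ring.
have Kp := Kf_ge0 c1 x0 eta0 tau0.
rewrite [leRHS]mulrAC; apply: ler_wpM2r; first by rewrite invr_ge0 ltW.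
rewrite [leRHS]mulrAC; apply: ler_wpM2r; first by rewrite invr_ge0 ltW// exprn_gt0.
rewrite [leRHS]mulrAC; apply: ler_wpM2r; first exact: exprn_ge0.
have -> : x ^+ (5 * (s * s) * 2) = ((x ^+ 5) ^+ (s * s)) ^+ 2.
  by rewrite (exprM x (5 * (s * s)) 2) (exprM x 5).
have mono a b : 0 <= a -> a <= b -> (s`!%:R * a ^+ (s * s)) ^+ 2 <= (s`!%:R * b ^+ (s * s)) ^+ 2 :> R.
  move=> a0 ab; have b0 := le_trans a0 ab.
  apply: lerXn2r; rewrite ?nnegrE ?mulr_ge0 ?exprn_ge0 ?ler0n//.
  by apply: ler_wpM2l; [exact: ler0n|exact: lerXn2r].
by apply: le_trans (mono _ _ Kp hK) _; rewrite (exprMn _ C4) mulrA exprMn.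
Qed.

(** exp x is the (k+1)-st power of exp(x/(k+1)) >= x/(k+1), and one spare factor x absorbs the
    constants. The argument 2x is that of [srep_uniform], where [step] at 2x must return at most exp
    x. *)
Lemma pow_le_exp (K : R) k : 0 < K -> exists2 X, 2 <= X & forall x, X <= x -> K * (2 * x) ^+ k <= expR x.
Proof.
move=> K0; pose D : R := K * 2 ^+ k * k.+1%:R ^+ k.+1.
have D0 : 0 < D by rewrite !mulr_gt0 ?exprn_gt0 ?ltr0n.
exists (2 + D); first by rewrite lerDl ltW.
move=> x hx; have x0 : 0 < x by apply: lt_le_trans hx; rewrite addr_gt0.
have Dx : D <= x by apply: le_trans hx; rewrite lerDr.
have n0 : 0 < k.+1%:R :> R by rewrite ltr0n.
have -> : expR x = expR (x / k.+1%:R) ^+ k.+1.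
  by rewrite -expRM_natl; congr expR; rewrite mulrCA divff ?mulr1// gt_eqF.
apply: le_trans (_ : _ <= (x / k.+1%:R) ^+ k.+1) _; last first.
  apply: lerXn2r; rewrite ?nnegrE ?expR_ge0 ?divr_ge0 ?ler0n ?(ltW x0)//.
  by apply: le_trans (expR_ge1Dx _); rewrite lerDr.
rewrite expr_div_n ler_pdivlMr ?exprn_gt0// exprMn.
have -> : K * (2 ^+ k * x ^+ k) * k.+1%:R ^+ k.+1 = D * x ^+ k by rewrite /D; ring.
by rewrite [leRHS]exprS; apply: ler_wpM2r => //; rewrite exprn_ge0 ?(ltW x0).
Qed.

(* Each step replaces the bound exp (2 x) by exp x at the cost of a factor 1 - 1 / (2 x) of the
   radius; along x = X * 2 ^ t these factors have a positive product. *)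
Lemma srep_uniform : (forall rho, 1 <= rho -> exists B, srep rho B) ->
  exists B, 0 < B /\ forall rho, 1 <= rho -> srep rho B.
Proof.
move=> hall; have [K [k [K0 hstep]]] := step.
have [X X2 hX] := pow_le_exp k K0.
have X0 : 0 < X by apply: lt_le_trans X2.
exists (expR X); split; first exact: expR_gt0.
(* The radii rho (2 - 2^(-t)) stay below 2 rho and end at rho for t = 0, so a start on radius 2 rho
   with any bound is enough. *)
have iter t rho : 1 <= rho -> srep (rho * (2 - 2^-1 ^+ t)) (expR (X * 2 ^+ t)) -> srep rho (expR X).
  elim: t => [|t IH] r1 hr; first by move: hr; rewrite !expr0 mulr1 (_ : 2 - 1 = 1 :> R) ?mulr1//; ring.
  apply: IH => //; pose q : R := 2^-1 ^+ t.
  have q0 : 0 < q by rewrite exprn_gt0 ?invr_gt0.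
  have q1 : q <= 1 by rewrite exprn_ile1 ?invr_ge0 ?invf_le1 ?ler1n.
  have p0 : 0 < 2 ^+ t :> R by rewrite exprn_gt0.
  have p1 : 1 <= 2 ^+ t :> R by rewrite exprn_ege1 ?ler1n.
  have xX : X <= X * 2 ^+ t by rewrite ler_peMr ?(ltW X0).
  have xE : X * 2 ^+ t.+1 = 2 * (X * 2 ^+ t) by rewrite exprS; ring.
  have := hstep (X * 2 ^+ t.+1) (rho * (2 - 2^-1 ^+ t.+1)) _ _ hr.
  rewrite xE => h; apply: (srep_mono _ _ (h _ _)).
  - have -> : (2 * (X * 2 ^+ t))^-1 = q / (2 * X).
      by rewrite !invfM /q exprVn; ring.
    rewrite exprS -/q -mulrA; apply: ler_wpM2l; first by apply: le_trans r1.
    (* With q = 2^(-t) this says (2 - q/2)(1 - q/(2X)) >= 2 - q, the inequality between consecutive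
       radii; it holds because X >= 2. *)
    have : (2 - 2^-1 * q) * (q / (2 * X)) <= q / 2.
      rewrite mulrCA; apply: ler_wpM2l; first exact: ltW.
      rewrite ler_pdivrMr ?mulr_gt0//; lra.
    lra.
  - exact: hX.
  - lra.
  - rewrite exprS -/q; apply: (le_trans r1); rewrite ler_peMr ?(le_trans ler01 r1)//.
    have : 2^-1 * q <= 1 by rewrite mulr_ile1 ?invr_ge0 ?(ltW q0) ?invf_le1 ?ler1n.
    by move: (2^-1 * q) => y; lra.
move=> rho r1; have [|B hB] := hall (rho * 2); first by lra.
have [t ht] : exists t : nat, B <= expR (X * 2 ^+ t).
  exists (Num.bound B); apply: le_trans (_ : _ <= (Num.bound B)%:R) _.
    have [B0|B0] := leP 0 B; first exact: ltW (archi_boundP B0).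
    by apply: le_trans (ltW B0) _.
  apply: le_trans (expR_ge1Dx _); apply: le_trans (_ : _ <= X * 2 ^+ Num.bound B) _; last by rewrite lerDr.
  apply: le_trans (_ : _ <= 2 ^+ Num.bound B) _; last by rewrite ler_peMl ?exprn_ge0//; lra.
  by rewrite -natrX ler_nat ltnW// ltn_expl.
apply: (iter t) => //; apply: srep_mono hB => //.
have q0 : 0 <= 2^-1 ^+ t :> R by rewrite exprn_ge0 ?invr_ge0.
apply: ler_wpM2l; lra.
Qed.

(** The germ h_i lives near 0 only, but D = E_i0 - h_i(0) E_00 lives on the disc of radius rho and
    equals (h_i - h_i(0)) E_00 near 0, so D'(0) = h_i'(0). Its bound does not depend on rho, and
    Cauchy's estimate on large discs concludes. *)
Theorem derivative_zero : (forall rho, 1 <= rho -> exists B, srep rho B) ->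
  forall i, cder (hf i) 0 = 0.
Proof.
move=> hall i; have [B [B0 hB]] := srep_uniform hall.
apply: small_eq0 => e e0.
pose K := (1 + nm (hf i 0)) * B; have K0 : 0 < K by rewrite mulr_gt0// ltr_pwDl ?nm_ge0.
pose rho := 2 * (1 + K / e).
have Ke : 0 < K / e by rewrite divr_gt0.
have rho1 : 1 <= rho by rewrite /rho; lra.
have [E [hE EB hEf _ E0]] := hB rho rho1.
have z00 r : 0 < r -> nm (0 - 0 : C) < r by move=> r0; rewrite subrr nm0.
pose D z := E i ord0 z - hf i 0 * E ord0 ord0 z.
have hD : hol 0 rho D by apply: holB => //; apply: holM => //; exact: hol_cst.
pose dd := Num.min d rho; have dd0 : 0 < dd by rewrite lt_min d_gt0; lra.
have Ed z : nm (z - 0) < dd -> E i ord0 z = E ord0 ord0 z * hf i z.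
  rewrite lt_min => /andP[z1 z2]; have [h1 h2] := hLhf z1.
  by have := lf_par hLf (hEf ord0 z z2) h1 i ord0; rewrite h2 mulr1.
have hEd j : hol 0 dd (E j ord0) by apply: hol_le (hE j ord0); rewrite ge_min lexx orbT.
have hfd : hol 0 dd (hf i) by apply: hol_le (hhf i); rewrite ge_min lexx.
have D1 : cder D 0 = cder (hf i) 0.
  have <- : cder (fun z => (hf i z - hf i 0) * E ord0 ord0 z) 0 = cder D 0.
    apply: (@cder_ext R 0 dd); [|by apply: holM => //; apply: holB => //; exact: hol_cst|exact: z00].
    move=> z hz'; rewrite /D Ed//; ring.
  apply: cderE; have h1 := hol_cder hfd (z00 _ dd0); have h2 := hol_cder (hEd ord0) (z00 _ dd0).
  have := is_cderM (is_cderB h1 (is_cder_cst (hf i 0) 0)) h2.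
  by rewrite E0 subrr mul0r addr0 subr0 mulr1.
rewrite -D1; apply: le_trans (_ : _ <= K / (1 + K / e)) _.
  apply: (cauchy_est (rho := rho) hD); [lra|rewrite /rho; lra|].
  move=> z hz'; apply: le_trans (nmB _ _) _; rewrite nmM /K mulrDl mul1r.
  have zr : nm (z - 0) < rho by rewrite hz' /rho; lra.
  by apply: lerD; [exact: EB|apply: ler_wpM2l; [exact: nm_ge0|exact: EB]].
rewrite ler_pdivrMr; last lra.
by rewrite mulrDr mulr1 mulrCA divff ?gt_eqF// mulr1 lerDr ltW.
Qed.

End Step.

(** * Curves in projective space *)

Section Lines.
Variables (R : realType) (N : nat).
Local Notation C := R[i].
Local Notation A := (mpoly N.+1 R[i]).
Implicit Types (l : proj_space R N) (x y : 'I_N.+1 -> C) (P : A).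

Definition online l x : Prop := (\row_i x i : 'rV[C]_N.+1) \in val l.

Lemma line_pick l : vpick (val l) != 0 /\ val l = <[vpick (val l)]>%VS.
Proof.
have hd : \dim (val l) = 1%N by apply/eqP; case: l.
have h0 : vpick (val l) != 0.
  by rewrite vpick0; apply/eqP => e; move: hd; rewrite e dimv0.
split => //; symmetry; apply/eqP; rewrite eqEdim hd dim_vline h0 andbT.
by rewrite -memvE memv_pick.
Qed.

Lemma onlineP l x : online l x <-> exists c, forall i, x i = c * vpick (val l) ord0 i.
Proof.
have [_ E] := line_pick l; rewrite /online {1}E; split.
  by move=> /vlineP [c /rowP h]; exists c => i; have := h i; rewrite !mxE.
by move=> [c hc]; apply/vlineP; exists c; apply/rowP => i; rewrite !mxE.
Qed.

Lemma pick_coord l : exists i, vpick (val l) ord0 i != 0.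
Proof. by have [h _] := line_pick l; apply/rV0Pn. Qed.

Lemma online_par l x y : online l x -> online l y -> par x y.
Proof. by move=> /onlineP [a ha] /onlineP [b hb] i j; rewrite !ha !hb; ring. Qed.

Lemma online_sub l x y : online l y -> (exists i, y i != 0) -> par x y -> online l x.
Proof.
move=> /onlineP [b hb] [i yi] hp; apply/onlineP; exists (x i / y i * b) => j.
by rewrite -!mulrA -hb mulrCA (hp i j) mulrCA mulVf// mulr1.
Qed.

Lemma online_eq l l' x y : online l x -> online l' y -> (exists i, x i != 0) ->
  (exists i, y i != 0) -> par x y -> l = l'.
Proof.
move=> hx hy x0 y0 hxy; have hx' : online l' x by exact: online_sub hy y0 hxy.
have E (l1 : proj_space R N) : online l1 x -> val l1 = <[\row_i x i]>%VS.
  move=> h; symmetry; apply/eqP; rewrite eqEdim -memvE h /= dim_vline.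
  have -> : \row_i x i != 0 :> 'rV[C]_N.+1.
    by have [i xi] := x0; apply/rV0Pn; exists i; rewrite mxE.
  by case: l1 {h} => l1 /= /eqP ->.
by apply: val_inj; rewrite /= E// E.
Qed.

Lemma line_through x : (exists i, x i != 0) -> exists l, online l x.
Proof.
move=> [i xi]; have h : \dim <[\row_i x i : 'rV[C]_N.+1]>%VS == 1%N.
  rewrite dim_vline (_ : _ != 0)//; apply/rV0Pn; exists i; by rewrite mxE.
by exists (exist (fun L : {vspace 'rV[C]_N.+1} => \dim L == 1%N) _ h); rewrite /online /= memv_line.
Qed.

Lemma zero_locusP d P l x : P \is ishomog1 d mdeg -> online l x -> (exists i, x i != 0) ->
  zero_locus P l <-> meval x P = 0.
Proof.
move=> hP hx x0; split => [h|h v hv].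
  have := h _ hx; congr (_ = _); apply: meval_eq => i; by rewrite mxE.
have hv' : online l (fun i => v ord0 i).
  by rewrite /online (_ : \row_i v ord0 i = v)//; apply/rowP => i; rewrite mxE.
have [i xi] := x0; have hp := online_par hv' hx.
have -> : meval (fun j => v ord0 j) P = meval (fun j => (v ord0 i / x i) * x j) P.
  by apply: meval_eq => j; rewrite mulrAC (hp i j) mulfK.
by rewrite (meval_homog _ _ hP) h mulr0.
Qed.

(** In a chart around f(z) the affine coordinates, one of them constantly 1, form a nonvanishing
    local section. *)
Lemma curve_linefield (f : cplane R -> proj_space R N) : holomorphic_curve f ->
  linefield (fun z => online (f z)).
Proof.
move=> hf; split.
- by move=> z x y; exact: online_par.
- by move=> z x y; exact: online_sub.
move=> z; have [i vi] := pick_coord (f z); have [ho hd] := hf i.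
have : nbhs (z : cplane R) (f @^-1` std_open i) by move: ho; rewrite openE; apply; exact: vi.
move=> /nbhs_nm [d d0 hdz].
exists d, (fun j w => affine_coord i j (f w)); split => // [j w hw|w hw].
  by apply: derivable_cder; apply: hd; exact: hdz.
have wi : vpick (val (f w)) ord0 i != 0 := hdz w hw.
split; last by exists i; rewrite /affine_coord divff ?oner_neq0.
apply/onlineP; exists (vpick (val (f w)) ord0 i)^-1 => j.
by rewrite /affine_coord mulrC.
Qed.

End Lines.

(** * Identity theorems for curves and representations on arbitrary discs *)

Section Global.
Variables (R : realType) (N : nat).
Local Notation C := R[i].
Local Notation A := (mpoly N.+1 R[i]).
Implicit Types (L : C -> ('I_N.+1 -> C) -> Prop) (P : A).

(** Nondegeneracy in a localised form, because it is applied to sections on small discs. *)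
Definition nondeg L := forall P d a (r : R), (0 < d)%N -> P \is ishomog1 d mdeg -> P != 0 ->
  0 < r -> exists z x, [/\ nm (z - a) < r, L z x & meval x P != 0].

Lemma linefield_shift L b : linefield L -> linefield (fun z => L (z + b)).
Proof.
move=> hL; split; [by move=> z; exact: lf_par|by move=> z; exact: lf_sub|].
move=> z; have [d [k [d0 hk hkL]]] := lf_sec hL (z + b).
exists d, (fun i w => k i (w + b)); split => // [i|w hw].
  by have := hol_shift (b := b) (hk i); rewrite addrK.
by apply: hkL; rewrite (_ : w + b - (z + b) = w - z)//; ring.
Qed.

Lemma clopen_everywhere (T : C -> Prop) : (forall z, exists2 d, 0 < d & forall w w',
    nm (w - z) < d -> nm (w' - z) < d -> T w -> T w') -> forall z1 z2, T z1 -> T z2.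
Proof.
move=> h z1 z2; apply: clopen_segment => t _; set z := z1 + _.
have [d d0 hd] := h z; exists d => // w hw; have zz : nm (z - z) < d by rewrite subrr nm0.
by split; exact: hd.
Qed.

(** If P vanished along the curve over one disc, the identity theorem for local sections would
    spread this to the whole plane. The image would lie in the zero locus of P, a proper algebraic
    set since P is nonzero at some point. *)
Lemma curve_nondeg (f : cplane R -> proj_space R N) : holomorphic_curve f ->
  algebraically_nondegenerate f -> nondeg (fun z => online (f z)).
Proof.
move=> hf hnd P e a r e0 hP P0 r0; apply: contrapT => hn.
have hL := curve_linefield hf.
have van z x : nm (z - a) < r -> online (f z) x -> meval x P = 0.
  by move=> hz hx; apply: contrapT => /eqP h; apply: hn; exists z, x.
pose T z := exists2 d, 0 < d & forall w x, nm (w - z) < d -> online (f w) x -> meval x P = 0.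
have Ta : T a by exists r => // w x; exact: van.
have hT z : T z.
  apply: (@clopen_everywhere T _ a z Ta) => {}z.
  have [d [k [d0 hk hkL]]] := lf_sec hL z; exists d => // w w' hw hw' [d1 d10 h1].
  have hh : hol z d (fun y => meval (fun i => k i y) P) by exact: hol_meval.
  have [d2 d20 h2] := disc_open hw.
  have h0 := hol_identity_gen hh hw (d1 := Num.min d1 d2).
  have {}h0 y : nm (y - z) < d -> meval (fun i => k i y) P = 0.
    apply: h0; first by rewrite lt_min d10.
    move=> u; rewrite lt_min => /andP[u1 u2]; apply: (h1 u) => //.
    by case: (hkL u (h2 u u2)).
  have [d3 d30 h3] := disc_open hw'; exists d3 => // u x hu hx.
  have [hku ku0] := hkL u (h3 u hu).
  have zl : zero_locus P (f u) by apply/(zero_locusP hP hku ku0); exact: h0 (h3 u hu).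
  by rewrite -(zl _ hx); apply: meval_eq => i; rewrite mxE.
have [x hx] := meval_neq0 P0.
have x0 : exists i, x i != 0.
  apply: contrapT => hx0; case/eqP: hx.
  have -> : meval x P = meval (fun i => 0 * x i) P.
    apply: meval_eq => i; rewrite mul0r; apply: contrapT => /eqP h; apply: hx0; by exists i.
  by rewrite (meval_homog _ _ hP) expr0n gtn_eqF// mul0r.
have [l hl] := line_through x0.
apply: (hnd (zero_locus P)).
- exists [set P]; split; first by move=> _ ->; exists e.
  by apply/seteqP; split => [y hy _ ->//|y h]; exact: h.
- move=> e1; have : zero_locus P l by rewrite e1.
  by move=> /(zero_locusP hP hl x0) h; rewrite h eqxx in hx.
move=> _ [z _ <-]; have [i vi] := pick_coord (f z).
have hv : online (f z) (fun i => vpick (val (f z)) ord0 i).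
  by apply/onlineP; exists 1 => j; rewrite mul1r.
apply/(zero_locusP hP hv); first by exists i.
have [d d0 hd] := hT z; apply: (hd z) => //; by rewrite subrr nm0.
Qed.

(** Were f and g equal over one disc, the minors of their local sections would vanish there, and by
    the identity theorem everywhere. *)
Lemma curve_neq (f g : cplane R -> proj_space R N) : holomorphic_curve f ->
  holomorphic_curve g -> f <> g -> forall a (r : R), 0 < r ->
  exists z x y i j, [/\ nm (z - a) < r, online (f z) x, online (g z) y & x i * y j - x j * y i != 0].
Proof.
move=> hf hg hne a r r0; apply: contrapT => hn; apply: hne.
have hLf := curve_linefield hf; have hLg := curve_linefield hg.
have van z x y : nm (z - a) < r -> online (f z) x -> online (g z) y -> par x y.
  move=> hz hx hy i j; apply/eqP; rewrite -subr_eq0; apply: contrapT => /negP h; apply: hn.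
  by exists z, x, y, i, j.
pose T z := exists2 d, 0 < d & forall w x y, nm (w - z) < d -> online (f w) x -> online (g w) y -> par x y.
have Ta : T a by exists r => // w x y; exact: van.
have hT z : T z.
  apply: (@clopen_everywhere T _ a z Ta) => {}z.
  have [d1 [k [d10 hk hkL]]] := lf_sec hLf z; have [d2 [k' [d20 hk' hkL']]] := lf_sec hLg z.
  pose d := Num.min d1 d2; have d0 : 0 < d by rewrite lt_min d10.
  have s1 w : nm (w - z) < d -> nm (w - z) < d1 by rewrite lt_min => /andP[].
  have s2 w : nm (w - z) < d -> nm (w - z) < d2 by rewrite lt_min => /andP[].
  exists d => // w w' hw hw' [d3 d30 h3].
  have [d4 d40 h4] := disc_open hw.
  have h0 i j y : nm (y - z) < d -> k i y * k' j y - k j y * k' i y = 0.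
    move: y; apply: (@hol_identity_gen R z d (fun y => k i y * k' j y - k j y * k' i y) w (Num.min d3 d4)) => //.
    - apply: holB; apply: holM; apply: hol_sub; [exact: s1|exact: hk|exact: s2|exact: hk'|exact: s1|exact: hk|exact: s2|exact: hk'].
    - by rewrite lt_min d30.
    move=> u; rewrite lt_min => /andP[u3 u4]; apply/eqP; rewrite subr_eq0; apply/eqP.
    have hu := h4 u u4; have [hk1 _] := hkL u (s1 u hu); have [hk2 _] := hkL' u (s2 u hu).
    exact: (h3 u _ _ u3 hk1 hk2).
  have [d5 d50 h5] := disc_open hw'; exists d5 => // u x y hu hx hy.
  have hu' := h5 u hu.
  have [hk1 k10] := hkL u (s1 u hu'); have [hk2 k20] := hkL' u (s2 u hu').
  have E : f u = g u.
    apply: (online_eq hk1 hk2 k10 k20) => i j; apply/eqP; rewrite -subr_eq0; apply/eqP; exact: h0.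
  by rewrite E in hx; exact: online_par hx hy.
apply/funext => z; have [d d0 hd] := hT z; have zz : nm (z - z) < d by rewrite subrr nm0.
have [d1 [k [d10 _ hkL]]] := lf_sec hLf z; have [d2 [k' [d20 _ hkL']]] := lf_sec hLg z.
have [|h1 h10] := hkL z; first by rewrite subrr nm0.
have [|h2 h20] := hkL' z; first by rewrite subrr nm0.
by apply: (online_eq h1 h2 h10 h20); exact: hd zz h1 h2.
Qed.

Lemma poly_nz (t : seq C) a (r : R) : 0 < r ->
  exists2 z, nm (z - a) < r & \prod_(b <- t) (z - b) != 0.
Proof.
move=> r0; elim: t => [|b t [z hz nz]].
  by exists a; rewrite ?subrr ?nm0// big_nil oner_neq0.
have hP : hol a r (fun y => \prod_(b <- t) (y - b)).
  by apply: hol_prod => c _; exact: hol_poly1.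
have [d d0 hd] := hol_nz_near hP hz nz.
have [e|ne] := eqVneq z b; last by exists z => //; rewrite big_cons mulf_neq0// subr_eq0.
have hw : nm (z + (d / 2)%:C%C - z) < d.
  by rewrite addrAC subrr add0r nm_real gtr0_norm ?divr_gt0//; lra.
have [w1 w2] := hd _ hw; exists (z + (d / 2)%:C%C) => //.
rewrite big_cons mulf_neq0// e addrAC subrr add0r -nm_gt0 nm_real gtr0_norm divr_gt0//.
Qed.

(** Common zeros of the coordinates are allowed, so no Weierstrass product is needed: it suffices to
    find one finite list t such that near every point there is a representation whose 0-th
    coordinate is exactly the product of the z - a for a in t. Such representations agree on
    overlaps and glue. *)
Lemma global_rep L (rho : R) : linefield L -> nondeg L -> 0 < rho ->
  (exists2 x, L 0 x & x ord0 != 0) ->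
  exists F : 'I_N.+1 -> C -> C, [/\ forall i, hol 0 rho (F i),
    forall z, nm (z - 0) < rho -> L z (fun i => F i z) & F ord0 0 = 1].
Proof.
move=> hL hnd rho0 [x0 Lx0 x00].
pose loc (t : seq C) z := exists d (F : 'I_N.+1 -> C -> C), [/\ 0 < d, forall i, hol z d (F i),
  forall w, nm (w - z) < d -> L w (fun i => F i w) &
  forall w, nm (w - z) < d -> F ord0 w = \prod_(a <- t) (w - a)].
(* Entries of t are points where the 0-th coordinate of the line field vanishes, hence different
   from 0; this keeps p(0) nonzero for the final normalisation. *)
pose bad (t : seq C) := forall a, a \in t -> forall x, L a x -> x ord0 = 0.
have loc_cat t t' z : loc t z -> loc (t ++ t') z.
  move=> [d [F [d0 hF hFL F0]]].
  exists d, (fun i w => \prod_(a <- t') (w - a) * F i w); split => //.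
  - by move=> i; apply: holM => //; apply: hol_prod => a _; exact: hol_poly1.
  - by move=> w hw; apply: lf_scale => //; exact: hFL.
  - by move=> w hw; rewrite F0// big_cat mulrC.
have loc_perm t t' z : perm_eq t t' -> loc t z -> loc t' z.
  move=> hp [d [F [d0 hF hFL F0]]]; exists d, F; split => // w hw.
  by rewrite F0// (perm_big _ hp).
pose Q (a b c d : R) := exists t, bad t /\ forall z, a <= complex.Re z <= b -> c <= complex.Im z <= d -> loc t z.
have : Q (- rho) rho (- rho) rho.
  apply: cousin; try by lra.
    move=> a b c d _ _ [t1 [b1 h1]] [t2 [b2 h2]] [t3 [b3 h3]] [t4 [b4 h4]].
    exists (t1 ++ t2 ++ t3 ++ t4); split.
      by move=> y; rewrite !mem_cat => /or4P[/b1|/b2|/b3|/b4].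
    move=> z /andP[z1 z2] /andP[z3 z4].
    have [zr|zr] := lerP (complex.Re z) ((a + b) / 2); have [zi|zi] := lerP (complex.Im z) ((c + d) / 2).
    - by apply: loc_cat; apply: h1; apply/andP.
    - apply: (loc_perm (t3 ++ t1 ++ t2 ++ t4)).
        by apply/seq.permP => y; rewrite !count_cat addnCA; congr addn; rewrite addnCA.
      by apply: loc_cat; apply: h3; rewrite ?z1 ?z2 ?z3 ?z4 ?zr ?zi ?(ltW zi)//.
    - apply: (loc_perm (t2 ++ t1 ++ t3 ++ t4)); first by apply/seq.permP => y; rewrite !count_cat addnCA.
      by apply: loc_cat; apply: h2; rewrite ?z1 ?z2 ?z3 ?z4 ?zr ?zi ?(ltW zr)//.
    - apply: (loc_perm (t4 ++ t1 ++ t2 ++ t3)).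
        by apply/seq.permP => y; rewrite !count_cat addnC -!addnA.
      by apply: loc_cat; apply: h4; rewrite ?z1 ?z2 ?z3 ?z4 ?(ltW zr) ?(ltW zi).
  move=> x y _ _; pose z0 : C := (x +i* y)%C.
  have [d [k [d0 hk hkL]]] := lf_sec hL z0.
  have [w [xw [hw Lw xw0]]] : exists w xw, [/\ nm (w - z0) < d, L w xw & xw ord0 != 0].
    have [w [xw [h1 h2]]] :=
      hnd _ _ z0 d (ltn0Sn 0) (coord_homog R ord0) (coord_neq0 R ord0) d0.
    rewrite mevalXU => h3.
    by exists w, xw.
  have kw : k ord0 w != 0.
    have [h1 [j kj]] := hkL w hw; apply: contraNneq kj => e0.
    have := lf_par hL Lw h1 ord0 j; rewrite e0 mulr0 => /eqP.
    by rewrite mulf_eq0 (negbTE xw0).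
  have [h0|[m [u [hu uz0 Ek]]]] := hol_order d0 (hk ord0); first by rewrite h0 ?eqxx in kw.
  have z00 : nm (z0 - z0) < d by rewrite subrr nm0.
  have [d1 d10 h1] := hol_nz_near hu z00 uz0.
  exists (d1 / 2); first by rewrite divr_gt0.
  move=> a b c e _ _ _ _ /andP[a1 a2] /andP[c1 c2] ba ec.
  exists (nseq m z0); split.
    move=> b0; rewrite mem_nseq => /andP[m0 /eqP ->] v Lv.
    have [k1 [j kj]] := hkL z0 z00.
    have := lf_par hL Lv k1 ord0 j; rewrite Ek subrr expr0n gtn_eqF// mul0r mulr0 => /eqP.
    by rewrite mulf_eq0 (negbTE kj) orbF => /eqP.
  move=> z /andP[y1 y2] /andP[y3 y4].
  have hz : nm (z - z0) < d1.
    apply: le_lt_trans (nm_le_ReIm _) _; rewrite !raddfB /=.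
    have : `|complex.Re z - x| <= b - a by rewrite ler_norml; lra.
    have : `|complex.Im z - y| <= e - c by rewrite ler_norml; lra.
    lra.
  have [d2 d20 h2] := disc_open hz.
  have sub w' : nm (w' - z) < d2 -> nm (w' - z0) < d by move=> /h2 /h1 [].
  have nz w' : nm (w' - z) < d2 -> u w' != 0 by move=> /h2 /h1 [].
  exists d2, (fun i w => (u w)^-1 * k i w); split => //.
  - move=> i; apply: holM; last by apply: hol_sub (hk i); exact: sub.
    by apply: holV => //; apply: hol_sub hu; exact: sub.
  - by move=> w' hw'; apply: lf_scale => //; case: (hkL w' (sub w' hw')).
  - move=> w' hw'; rewrite Ek mulrCA mulVf ?nz// mulr1 big_nseq.
    by rewrite iter_mulr_1.
move=> [t [bt ht]]; pose p (w : C) := \prod_(a <- t) (w - a).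
have hp a r : hol a r p by apply: hol_prod => b _; exact: hol_poly1.
have p0 : p 0 != 0.
  rewrite /p prodf_seq_neq0; apply/allP => a ta /=; rewrite sub0r oppr_eq0.
  by apply: contraNneq x00 => e; rewrite (bt a ta x0) ?eqxx// e.
have ex z : exists dF : R * ('I_N.+1 -> C -> C), nm (z - 0) < rho -> [/\ 0 < dF.1,
    forall i, hol z dF.1 (dF.2 i), forall w, nm (w - z) < dF.1 -> L w (fun i => dF.2 i w) &
    forall w, nm (w - z) < dF.1 -> dF.2 ord0 w = p w].
  have [hz|hz] := boolP (nm (z - 0) < rho); last by exists (0, fun _ _ => 0).
  rewrite subr0 in hz; have [||d [F h]] := ht z; last by exists (d, F).
    by rewrite -ler_norml ltW// (le_lt_trans (Re_le_nm _) hz).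
  by rewrite -ler_norml ltW// (le_lt_trans (Im_le_nm _) hz).
have [dF hdF] := choice ex.
(* Parallel vectors with the same 0-th coordinate p agree where p is nonzero, hence everywhere by
   [hol_mul_eq0]. *)
have agr i z w : nm (z - 0) < rho -> nm (w - 0) < rho -> nm (w - z) < (dF z).1 ->
    (dF w).2 i w = (dF z).2 i w.
  move=> hz hw hwz; have [dz0 hFz hLz Ez] := hdF z hz; have [dw0 hFw hLw Ew] := hdF w hw.
  have [d1 d10 h1] := disc_open hwz; pose e := Num.min d1 (dF w).1.
  have e0 : 0 < e by rewrite lt_min d10.
  have s1 y : nm (y - w) < e -> nm (y - z) < (dF z).1 by rewrite lt_min => /andP[/h1].
  have s2 y : nm (y - w) < e -> nm (y - w) < (dF w).1 by rewrite lt_min => /andP[].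
  have [z1 hz1 pz1] := poly_nz t w e0.
  have ww : nm (w - w) < e by rewrite subrr nm0.
  apply/eqP; rewrite -subr_eq0; apply/eqP.
  apply: (@hol_mul_eq0 R w e p (fun y => (dF w).2 i y - (dF z).2 i y) z1) => //.
    by apply: holB; apply: hol_sub; [exact: s2|exact: hFw|exact: s1|exact: hFz].
  move=> y hy; have := lf_par hL (hLw y (s2 y hy)) (hLz y (s1 y hy)) i ord0.
  by rewrite Ez ?Ew; [move=> h; rewrite mulrBr mulrC h mulrC subrr|exact: s2|exact: s1].
have dz z : nm (z - 0) < rho -> nm (z - z) < (dF z).1.
  by move=> /hdF [h _ _ _]; rewrite subrr nm0.
exists (fun i z => (p 0)^-1 * (dF z).2 i z); split.
- move=> i; apply: holM; first exact: hol_cst.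
  move=> z hz; have [dz0 hFz _ _] := hdF z hz; have [d1 d10 h1] := disc_open hz.
  suff h : hol z (Num.min d1 (dF z).1) (fun y => (dF y).2 i y).
    by apply: h; rewrite subrr nm0 lt_min d10.
  apply: (@hol_ext R z _ ((dF z).2 i)).
    by move=> w; rewrite lt_min => /andP[w1 w2]; rewrite (agr i z w)//; exact: h1.
  by apply: hol_le (hFz i); rewrite ge_min lexx orbT.
- move=> z hz; apply: lf_scale => //; have [_ _ h _] := hdF z hz; exact: h (dz z hz).
- have h0 : nm (0 - 0 : C) < rho by rewrite subrr nm0.
  have [_ _ _ h] := hdF 0 h0; by rewrite h ?mulVf//; exact: dz.
Qed.

End Global.

(** * Choice of a base point *)

Section Base.
Variables (R : realType) (N : nat).
Local Notation C := R[i].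
Local Notation A := (mpoly N.+1 R[i]).
Implicit Types (L : C -> ('I_N.+1 -> C) -> Prop) (P : A) (h : C -> C).

Lemma dn_shift a (rho : R) b h i z : hol a rho h -> nm (z + b - a) < rho ->
  dn i (fun w => h (w + b)) z = dn i h (z + b).
Proof.
move=> hh; elim: i z => [//|i IH] z hz; rewrite !dnS -(cder_shift (hol_dn i hh) hz).
have E w : (w - (a - b)) = w + b - a by ring.
apply: (cder_ext (a := a - b) (r := rho)); last by rewrite E.
  by move=> w hw; apply: IH; rewrite -E.
by apply: hol_dn; exact: hol_shift.
Qed.

Lemma wronsk_shift a (rho : R) b s (u : 'I_s -> C -> C) z : (forall k, hol a rho (u k)) ->
  nm (z + b - a) < rho -> wronsk (fun k w => u k (w + b)) z = wronsk u (z + b).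
Proof.
move=> hu hz; rewrite /wronsk; congr (\det _); apply/matrixP => i k; rewrite !mxE.
exact: (dn_shift i (hu k) hz).
Qed.

(** Closed under finite products, so that a single base point can satisfy all conditions of
    nonvanishing at once. *)
Definition nzd a (d : R) h := hol a d h /\ exists2 z, nm (z - a) < d & h z != 0.

Lemma nzdM a d h k : nzd a d h -> nzd a d k -> nzd a d (fun z => h z * k z).
Proof.
move=> [hh [z1 hz1 h1]] [hk [z2 hz2 k2]]; split; first exact: holM.
apply: contrapT => hn; case/eqP: k2; apply: (hol_mul_eq0 hh hk hz1 h1) => // z hz.
by apply: contrapT => /eqP h0; apply: hn; exists z.
Qed.

Lemma nzd_prod a d (I : eqType) (r : seq I) (h : I -> C -> C) : 0 < d -> (forall i, nzd a d (h i)) ->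
  nzd a d (fun z => \prod_(i <- r) h i z).
Proof.
move=> d0 hh; split; first by apply: hol_prod => i _; case: (hh i).
elim: r => [|i r [z hz nz]].
  by exists a; rewrite ?subrr ?nm0// big_nil oner_neq0.
have [||_ [w hw nw]] := @nzdM a d (h i) (fun z => \prod_(i <- r) h i z); first exact: hh.
  by split; [apply: hol_prod => j _; case: (hh j)|exists z].
by exists w => //; rewrite big_cons.
Qed.

Definition section_on L a (d : R) (k : 'I_N.+1 -> C -> C) := (forall i, hol a d (k i)) /\
  forall w, nm (w - a) < d -> L w (fun i => k i w) /\ exists i, k i w != 0.

Lemma lf_multiple L z x y : linefield L -> L z x -> L z y -> (exists i, y i != 0) ->
  exists c, x = (fun i => c * y i).
Proof.
move=> hL hx hy [j yj]; exists (x j / y j); apply/funext => i.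
by rewrite mulrAC (lf_par hL hx hy j i) mulfK.
Qed.

Lemma nondeg_section L a d k P e : linefield L -> nondeg L -> section_on L a d k -> 0 < d ->
  (0 < e)%N -> P \is ishomog1 e mdeg -> P != 0 ->
  nzd a d (fun z => meval (fun i => k i z) P).
Proof.
move=> hL hnd [hk hkL] d0 e0 hP P0; split; first exact: hol_meval.
have [z [x [hz Lx Px]]] := hnd P e a d e0 hP P0 d0; exists z => //.
have [Lk k0] := hkL z hz; have [c E] := lf_multiple hL Lx Lk k0.
by apply: contraNneq Px => h; rewrite E (meval_homog _ _ hP) h mulr0.
Qed.

(** The function is k_0^2 times the derivative of k_i1 / k_0. If it vanished identically, this
    quotient would be a constant q and the linear form X_i1 - q X_0 would vanish along the line
    field. *)
Lemma nonconstant L a d k (i1 : 'I_N.+1) : linefield L -> nondeg L -> section_on L a d k -> 0 < d ->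
  i1 != ord0 -> nzd a d (fun z => cder (k i1) z * k ord0 z - k i1 z * cder (k ord0) z).
Proof.
move=> hL hnd hs d0 i10; have [hk hkL] := hs; split.
  by apply: holB; apply: holM => //; exact: hol_der.
apply: contrapT => hn.
have van z : nm (z - a) < d -> cder (k i1) z * k ord0 z = k i1 z * cder (k ord0) z.
  move=> hz; apply/eqP; rewrite -subr_eq0; apply: contrapT => /negP h; apply: hn; by exists z.
have [_ [z1 hz1]] := nondeg_section hL hnd hs d0 (ltn0Sn 0) (coord_homog R ord0) (coord_neq0 R ord0).
rewrite mevalXU => kz1.
have [e e0 he] := hol_nz_near (hk ord0) hz1 kz1.
have sub w : nm (w - z1) < e -> nm (w - a) < d by move=> /he [].
have nz w : nm (w - z1) < e -> k ord0 w != 0 by move=> /he [].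
have hke i : hol z1 e (k i) by apply: hol_sub (hk i); exact: sub.
pose q z := k i1 z * (k ord0 z)^-1.
have hq : hol z1 e q by apply: holM => //; apply: holV.
have qE w : nm (w - z1) < e -> q w * k ord0 w = k i1 w by move=> hw; rewrite /q mulfVK ?nz.
have q0 w : nm (w - z1) < e -> cder q w = 0.
  move=> hw; have h1 := is_cderM (hol_cder hq hw) (hol_cder (hke ord0) hw).
  have E : cder q w * k ord0 w + q w * cder (k ord0) w = cder (k i1) w.
    rewrite -(cderE h1); apply: (cder_ext (a := z1) (r := e)) => //.
    by apply: holM.
  have := van w (sub w hw); rewrite -E -(qE w hw) => h.
  have : cder q w * k ord0 w ^+ 2 = 0.
    have -> : cder q w * k ord0 w ^+ 2 = (cder q w * k ord0 w + q w * cder (k ord0) w) * k ord0 w -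
      q w * k ord0 w * cder (k ord0) w by ring.
    by rewrite h subrr.
  by move=> /eqP; rewrite mulf_eq0 expf_eq0 /= (negbTE (nz w hw)) orbF => /eqP.
have qc := cder0_const hq q0.
pose P : A := mpolyX C (mnm1 i1) - q z1 *: mpolyX C (mnm1 ord0).
have Pv x : meval x P = x i1 - q z1 * x ord0 by rewrite /P mevalB mevalZ !mevalXU.
have hP : P \is ishomog1 1 mdeg by apply: rpredB; [|apply: rpredZ]; exact: coord_homog.
have P0 : P != 0.
  apply/eqP => /(congr1 (meval (fun i => (i == i1)%:R))); rewrite Pv meval0 eqxx eq_sym (negbTE i10).
  by rewrite mulr0 subr0 => /eqP; rewrite oner_eq0.
have hs1 : section_on L z1 e k by split => // w hw; apply: hkL; exact: sub.
have [_ [w hw]] := nondeg_section hL hnd hs1 e0 (ltn0Sn 0) hP P0.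
by rewrite Pv -(qE w hw) (qc w hw) subrr eqxx.
Qed.

Section Uniqueness.
Variables (s m : nat) (p : 'I_s -> A).
Hypothesis hp : forall k, p k \is ishomog1 m.+1 mdeg.
Hypothesis hz : forall x, (forall k, meval x (p k) = 0) -> forall i, x i = 0.
Hypothesis hind : forall v : 'I_s -> C, \sum_k v k *: p k = 0 -> forall k, v k = 0.
Hypothesis hsm : (2 * (\sum_(i < s) i) <= m)%N.

Definition ppoly (o : option 'I_s) : A := if o is Some k then p k else \sum_k p k.

Lemma pval_ppoly o x : pval p o x = meval x (ppoly o).
Proof. by case: o => //=; rewrite raddf_sum. Qed.

Lemma ppoly_homog o : ppoly o \is ishomog1 m.+1 mdeg.
Proof. by case: o => [k|] /=; [exact: hp|apply: rpred_sum => k _; exact: hp]. Qed.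

Lemma ppoly_neq0 o : ppoly o != 0.
Proof.
case: o => [k|] /=; apply/eqP => h.
  have := hind (v := fun j => (j == k)%:R); rewrite (bigD1 k)//= eqxx scale1r h add0r.
  rewrite big1 => [/(_ erefl k)|j /negbTE ->]; last by rewrite scale0r.
  by rewrite eqxx => /eqP; rewrite oner_eq0.
have h1 : forall k : 'I_s, (1 : C) = 0.
  move=> k; apply: (hind (v := fun=> 1) _ k); by rewrite -[RHS]h; apply: eq_bigr => j _; rewrite scale1r.
have hz1 k : meval (fun=> 1) (p k) = 0 by have /eqP := h1 k; rewrite oner_eq0.
by have /eqP := hz hz1 ord0; rewrite oner_eq0.
Qed.

Lemma family_wronsk L a d k : linefield L -> nondeg L -> section_on L a d k -> 0 < d ->
  nzd a d (wronsk (ufam p k)).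
Proof.
move=> hL hnd hs d0; have [hk _] := hs.
have hu j : hol a d (ufam p k j) by exact: hol_ufam.
split; first exact: hol_wronsk.
apply: (wronsk_neq0 d0 hu) => c hc; apply: hind; apply: contrapT => /eqP P0.
have hP : \sum_j c j *: p j \is ishomog1 m.+1 mdeg.
  by apply: rpred_sum => j _; apply: rpredZ; exact: hp.
have [_ [z hz1]] := nondeg_section hL hnd hs d0 (ltn0Sn m) hP P0.
rewrite raddf_sum /=; have -> : \sum_j meval (fun i => k i z) (c j *: p j) = \sum_j c j * ufam p k j z.
  by apply: eq_bigr => j _; rewrite mevalZ.
by rewrite hc// eqxx.
Qed.

(** Translate b to 0 and divide by k_0: forms of degree m + 1 are scaled by k_0^-(m+1), the
    Wronskian by k_0^(-(m+1)s), and the derivative of k_i1 / k_0 is the expression of [nonconstant]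
    over k_0^2. So every condition of nonvanishing passes to h. *)
Lemma germ_data L b (d e : R) k i1 : linefield L -> section_on L 0 d k -> 0 < e ->
  (forall z, nm (z - b) < e -> nm (z - 0) < d /\ k ord0 z != 0) ->
  (forall o, usum (ufam p k) o b != 0) -> wronsk (ufam p k) b != 0 ->
  cder (k i1) b * k ord0 b - k i1 b * cder (k ord0) b != 0 ->
  exists h : 'I_N.+1 -> C -> C, (forall i, h i 0 = (k ord0 b)^-1 * k i b) /\
  [/\ forall i, hol 0 e (h i),
     forall z, nm (z - 0) < e -> L (z + b) (fun i => h i z) /\ h ord0 z = 1,
     forall o, pval p o (fun i => h i 0) != 0, wronsk (ufam p h) 0 != 0 & cder (h i1) 0 != 0].
Proof.
move=> hL [hk hkL] e0 hb ub Wb Nb; pose h i z := (k ord0 (z + b))^-1 * k i (z + b).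
have sh z : nm (z - 0) < e -> nm (z + b - b) < e by rewrite addrK subr0.
have hkb i : hol b e (k i) by apply: hol_sub (hk i) => z /hb [].
have hks i : hol 0 e (fun z => k i (z + b)) by have := hol_shift (b := b) (hkb i); rewrite subrr.
have nz z : nm (z - 0) < e -> k ord0 (z + b) != 0 by move=> /sh /hb [].
have hh i : hol 0 e (h i) by apply: holM => //; apply: holV.
have z00 : nm (0 - 0 : C) < e by rewrite subrr nm0.
have kb : k ord0 b != 0 by have := nz 0 z00; rewrite add0r.
have h0 i : h i 0 = (k ord0 b)^-1 * k i b by rewrite /h add0r.
exists h; split => //; split => //.
- move=> z hz'; split; last by rewrite /h mulVf// nz.
  by apply: lf_scale => //; case: (hkL (z + b)) => //; case: (hb _ (sh z hz')).
- move=> o; have := ub o; rewrite usum_ufam !pval_ppoly => hu.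
  have -> : (fun i => h i 0) = (fun i => (k ord0 b)^-1 * k i b) by apply/funext.
  by rewrite (meval_homog _ _ (ppoly_homog o)) mulf_neq0// expf_neq0// invr_eq0.
- have hus j : hol 0 e (fun w => ufam p k j (w + b)).
    by have := hol_shift (b := b) (hol_ufam p j hkb); rewrite subrr.
  pose q z := (k ord0 (z + b))^-1 ^+ m.+1.
  have hq : hol 0 e q by apply: holX; exact: holV.
  rewrite (@wronsk_ext R s 0 e _ (fun j z => q z * ufam p k j (z + b))) //.
  + rewrite (wronsk_scale hq hus z00) mulf_neq0//.
      by rewrite expf_neq0// expf_neq0// invr_eq0 nz.
    by rewrite (@wronsk_shift b e)// ?add0r ?subrr ?nm0// => j; exact: hol_ufam.
  + by move=> j; exact: hol_ufam.
  + by move=> j w hw; rewrite /ufam /q -(meval_homog _ _ (hp j)).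
- have hc i : cder (fun z => k i (z + b)) 0 = cder (k i) b.
    by rewrite (cder_shift (hkb i)) add0r// subrr nm0.
  have h1 := is_cderM (hol_cder (hh i1) z00) (hol_cder (hks ord0) z00).
  have E : cder (h i1) 0 * k ord0 b + h i1 0 * cder (k ord0) b = cder (k i1) b.
    rewrite -(hc i1) -(hc ord0) -[in k ord0 b](add0r b) -(cderE h1).
    apply: (cder_ext (a := 0) (r := e)) => //; last exact: holM.
    by move=> z hz'; rewrite /h mulrAC mulVf ?mul1r// nz.
  apply: contraNneq Nb => c0; rewrite c0 mul0r add0r h0 in E.
  by rewrite -E mulrAC mulrAC [_ * k ord0 b]mulrC; apply/eqP; field.
Qed.

(** The base point b avoids the zeros of a product of functions none of which vanishes identically.
    At b the coordinate [i1] of the germ of f has nonzero derivative, which [derivative_zero]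
    excludes. *)
Theorem line_uniqueness Lf Lg : (0 < N)%N -> linefield Lf -> linefield Lg -> nondeg Lf -> nondeg Lg ->
  (forall z x y o, Lf z x -> Lg z y -> (exists i, x i != 0) ->
    (exists i, y i != 0) -> pval p o x = 0 \/ pval p o y = 0 -> par x y) ->
  (forall a (r : R), 0 < r -> exists z x y i j,
    [/\ nm (z - a) < r, Lf z x, Lg z y & x i * y j - x j * y i != 0]) -> False.
Proof.
move=> N0 hLf hLg nf ng agree neq.
have [d1 [kf [d10 hkf hkfL]]] := lf_sec hLf 0; have [d2 [kg [d20 hkg hkgL]]] := lf_sec hLg 0.
pose d := Num.min d1 d2; have d0 : 0 < d by rewrite lt_min d10.
have s1 w : nm (w - 0) < d -> nm (w - 0) < d1 by rewrite lt_min => /andP[].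
have s2 w : nm (w - 0) < d -> nm (w - 0) < d2 by rewrite lt_min => /andP[].
have sf : section_on Lf 0 d kf.
  by split => [i|w hw]; [apply: hol_sub (hkf i); exact: s1|apply: hkfL; exact: s1].
have sg : section_on Lg 0 d kg.
  by split => [i|w hw]; [apply: hol_sub (hkg i); exact: s2|apply: hkgL; exact: s2].
pose i1 : 'I_N.+1 := Ordinal (N0 : (1 < N.+1)%N).
have [z0 [x [y [i [j [hz0 Lx Ly xy]]]]]] := neq 0 d d0.
have nG : nzd 0 d (fun z => kf i z * kg j z - kf j z * kg i z).
  split; first by apply: holB; apply: holM; [case: sf|case: sg|case: sf|case: sg].
  exists z0 => //; have [Lk k0] := sf.2 z0 hz0; have [Lk' k0'] := sg.2 z0 hz0.
  have [c Ec] := lf_multiple hLf Lx Lk k0; have [c' Ec'] := lf_multiple hLg Ly Lk' k0'.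
  apply: contraNneq xy => h; rewrite Ec Ec' (_ : _ - _ = c * c' * (kf i z0 * kg j z0 - kf j z0 * kg i z0)); last by ring.
  by rewrite h mulr0.
have n0 L k : linefield L -> nondeg L -> section_on L 0 d k -> nzd 0 d (k ord0).
  move=> hL hnd hs; have := nondeg_section hL hnd hs d0 (ltn0Sn 0) (coord_homog R ord0) (coord_neq0 R ord0).
  by congr nzd; apply/funext => z; rewrite mevalXU.
have nu L k : linefield L -> nondeg L -> section_on L 0 d k ->
    nzd 0 d (fun z => \prod_o usum (ufam p k) o z).
  move=> hL hnd hs; apply: nzd_prod => // o.
  have := nondeg_section hL hnd hs d0 (ltn0Sn m) (ppoly_homog o) (ppoly_neq0 o).
  by congr nzd; apply/funext => z; rewrite usum_ufam pval_ppoly.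
have nn L k : linefield L -> nondeg L -> section_on L 0 d k ->
    nzd 0 d (fun z => k ord0 z * (\prod_o usum (ufam p k) o z * (wronsk (ufam p k) z *
      (cder (k i1) z * k ord0 z - k i1 z * cder (k ord0) z)))).
  move=> hL hnd hs; apply: nzdM; first exact: (n0 L).
  apply: nzdM; first exact: (nu L).
  by apply: nzdM; [exact: family_wronsk hnd hs d0|exact: nonconstant hnd hs d0 _].
have [_ [b hb]] := nzdM nG (nzdM (nn Lf kf hLf nf sf) (nn Lg kg hLg ng sg)).
have mnz (u v : C) : u * v != 0 -> u != 0 /\ v != 0.
  by rewrite mulf_eq0 negb_or => /andP[].
have pnz (v : option 'I_s -> C) : \prod_o v o != 0 -> forall o, v o != 0.
  by move=> h o; move: h; rewrite (bigD1 o)//= => /mnz [].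
move=> /mnz [Gb /mnz [/mnz [f0 /mnz [/pnz fu /mnz [fW fN]]] /mnz [g0 /mnz [/pnz gu /mnz [gW gN]]]]].
have [ef ef0 hef] := hol_nz_near (sf.1 ord0) hb f0.
have [eg eg0 heg] := hol_nz_near (sg.1 ord0) hb g0.
pose e := Num.min ef eg; have e0 : 0 < e by rewrite lt_min ef0.
have hef' z : nm (z - b) < e -> nm (z - 0) < d /\ kf ord0 z != 0 by rewrite lt_min => /andP[/hef].
have heg' z : nm (z - b) < e -> nm (z - 0) < d /\ kg ord0 z != 0 by rewrite lt_min => /andP[_ /heg].
have [hf [hf0 [hf1 hf2 hf3 hf4 hf5]]] := germ_data hLf sf e0 hef' fu fW fN.
have [hg [hg0 [hg1 hg2 hg3 hg4 _]]] := germ_data hLg sg e0 heg' gu gW gN.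
have Gh : hf i 0 * hg j 0 - hf j 0 * hg i 0 != 0.
  rewrite !hf0 !hg0 (_ : _ - _ = (kf ord0 b)^-1 * (kg ord0 b)^-1 * (kf i b * kg j b - kf j b * kg i b)); last by ring.
  by rewrite !mulf_neq0 ?invr_eq0.
pose Lf' z := Lf (z + b); pose Lg' z := Lg (z + b).
have hLf' : linefield Lf' by exact: linefield_shift.
have hLg' : linefield Lg' by exact: linefield_shift.
have nds L : nondeg L -> nondeg (fun z => L (z + b)).
  move=> hnd P n a r n1 hP P0 r0; have [z [v [h1 h2 h3]]] := hnd P n (a + b) r n1 hP P0 r0.
  by exists (z - b), v; rewrite subrK; split => //; rewrite -addrA -opprD [b + a]addrC.
have agree' z v w o : Lf' z v -> Lg' z w -> (exists i, v i != 0) -> (exists i, w i != 0) ->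
    pval p o v = 0 \/ pval p o w = 0 -> par v w by exact: agree.
case/eqP: hf5; apply: (derivative_zero hp hz hsm hLf' hLg' agree' e0 hf1 hg1 hf2 hg2 hf3 hg3 hf4 hg4 Gh).
move=> rho rho1; have rp : 0 < rho + 1 by rewrite addr_gt0// (lt_le_trans ltr01).
have start L (h : 'I_N.+1 -> C -> C) : (forall z, nm (z - 0) < e -> L (z + b) (fun i => h i z) /\ h ord0 z = 1) ->
    exists2 v : 'I_N.+1 -> C, L (0 + b) v & v ord0 != 0.
  move=> hh; have [|h1 h2] := hh 0; first by rewrite subrr nm0.
  by exists (fun i => h i 0) => //; rewrite h2 oner_neq0.
have [F [hF hFL F0]] := global_rep hLf' (nds _ nf) rp (start Lf hf hf2).
have [G [hG hGL G0]] := global_rep hLg' (nds _ ng) rp (start Lg hg hg2).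
(* Coordinates holomorphic on radius rho + 1 are bounded on the closed disc of radius rho; this
   supplies the initial bound, of whatever size. *)
have rr : rho < rho + 1 by rewrite ltrDl.
have ex i' : exists Mb : 'I_N.+1 -> R, forall j' z, nm (z - 0) <= rho -> nm (F i' z * G j' z) <= Mb j'.
  have ex2 j' : exists Mj, forall z, nm (z - 0) <= rho -> nm (F i' z * G j' z) <= Mj.
    exact: hol_bounded (holM (hF i') (hG j')) rr.
  by have [Mb hMb] := choice ex2; exists Mb.
have [M hM] := choice ex.
exists (\sum_i' \sum_j' `|M i' j'|), (fun i j z => F i z * G j z); split.
- by move=> i' j'; apply: hol_le (holM (hF i') (hG j')); exact: ltW.
- move=> i' j' z hz'; apply: le_trans (hM i' j' z (ltW hz')) _.
  apply: le_trans (ler_norm _) _; rewrite (bigD1 i')//= (bigD1 j')//= -addrA lerDl.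
  by rewrite addr_ge0// sumr_ge0// => i2 _; rewrite ?sumr_ge0.
- move=> j' z hz'; have -> : (fun i => F i z * G j' z) = (fun i => G j' z * F i z) by apply/funext => i'; rewrite mulrC.
  by apply: (lf_scale _ hLf'); apply: hFL; exact: lt_trans rr.
- by move=> i' z hz'; apply: (lf_scale _ hLg'); apply: hGL; exact: lt_trans rr.
- by rewrite F0 G0 mul1r.
Qed.

End Uniqueness.
End Base.

(** * From hypersurfaces in general position to line fields *)

Theorem theorem5 (R : realType) (N q n : nat)
    (hN : (1 <= N)%N) (hq : (N < q)%N) (hn : (1 < n)%N)
    (Q : 'I_q -> hcpoly R N)
    (hQ0 : forall j, Q j != 0)
    (hQhom : forall j, homogeneous n (Q j))
    (hgp : general_position (fun j => zero_locus (Q j)))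
    (hsum : \sum_j Q j != 0)
    (f g : cplane R -> proj_space R N)
    (hf : holomorphic_curve f) (hg : holomorphic_curve g)
    (hfnd : algebraically_nondegenerate f)
    (hgnd : algebraically_nondegenerate g)
    (hnq : (2 * (q ^ 2 - 1) < n)%N)
    (hfg : forall z : cplane R,
       (\bigcup_j (f @^-1` zero_locus (Q j) `|` g @^-1` zero_locus (Q j))
        `|` (f @^-1` zero_locus (\sum_j Q j)
             `|` g @^-1` zero_locus (\sum_j Q j))) z ->
       f z = g z) :
  f = g.
Proof.
apply: contrapT => fg.
case: n hn hQhom hnq => [//|m] hn hQhom hnq.
have gp (i : 'I_N.+1 -> 'I_q) x : injective i ->
    (forall k, meval x (Q (i k)) = 0) -> forall j, x j = 0.
  move=> iinj hx j; apply: contrapT => /eqP xj.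
  have x0 : exists i, x i != 0 by exists j.
  have [l hl] := line_through x0.
  have : (\bigcap_k zero_locus (Q (i k))) l.
    by move=> k _; apply/(zero_locusP (hQhom (i k)) hl x0).
  by rewrite (hgp i iinj).
have [s [p [jo [c [so [sc [sq hpo [sc0 hsump] hind hz]]]]]]] := circuit (ltn0Sn m) hq hQhom gp.
have hp k : p k \is ishomog1 m.+1 mdeg.
  by have [_ ->] := hpo k; apply: rpredZ; exact: hQhom.
have hQs o1 : Qsum Q o1 \is ishomog1 m.+1 mdeg.
  by case: o1 => [j|] /=; [exact: hQhom|apply: rpred_sum => j _; exact: hQhom].
(* A zero of any member of the family, the sum included, is a zero of some Q_j or of their sum, so f
   and g agree there by [hfg]. *)
have hpQ o1 : exists o2 c2, c2 != 0 /\ forall x, pval p o1 x = c2 * meval x (Qsum Q o2).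
  case: o1 => [k|].
    by have [ck Ek] := hpo k; exists (Some (jo k)), (c k); split => // x /=; rewrite Ek mevalZ.
  by exists so, sc; split => // x /=; rewrite -mevalZ -hsump raddf_sum.
have hfg' z o1 : zero_locus (Qsum Q o1) (f z) \/ zero_locus (Qsum Q o1) (g z) -> f z = g z.
  move=> h; apply: hfg; case: o1 h => [j|] /= h; last by right.
  by left; exists j.
apply: (@line_uniqueness R N s m p hp hz hind _ (fun z => online (f z)) (fun z => online (g z)) hN).
(* Each i < s <= q is at most q - 1, so the sum of the i is at most q (q - 1) <= q^2 - 1. *)
- apply: leq_trans (_ : 2 * (q ^ 2 - 1) <= _)%N; last by rewrite -ltnS.
  rewrite leq_mul2l; apply: (@leq_trans (\sum_(i < s) q.-1)).
    apply: leq_sum => i _; rewrite -ltnS prednK; first exact: leq_trans (ltn_ord i) sq.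
    exact: leq_ltn_trans hq.
  rewrite sum_nat_const card_ord; apply: (@leq_trans (q * q.-1)); first by rewrite leq_mul2r sq orbT.
  by rewrite -subn1 mulnBr muln1 mulnn; apply: leq_sub2l; exact: leq_ltn_trans hq.
- exact: curve_linefield.
- exact: curve_linefield.
- exact: curve_nondeg.
- exact: curve_nondeg.
- move=> z x y o1 hx hy x0 y0 hv.
  have E : f z = g z.
    have [u1 [c2 [c20 h2]]] := hpQ o1.
    apply: (hfg' z u1); case: hv; rewrite h2 => /eqP; rewrite mulf_eq0 (negbTE c20) => /eqP h.
      by left; apply/(zero_locusP (hQs u1) hx x0).
    by right; apply/(zero_locusP (hQs u1) hy y0).
  by rewrite E in hx; exact: online_par hx hy.
- by move=> a r r0; exact: curve_neq.
Qed.
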